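(* Let $(S_j)_{j\in\mathbb{Z}}$ be local potentials satisfying conditions A-E, let $\varepsilon>0$, let $k\ge 2$ be an integer, let $\gamma>0$ and $\sigma>1+2k(k+1)$ be real numbers, and let $\omega\in\mathcal{L}_{\gamma,\sigma}$. Then there exist local potentials $(S^{\varepsilon}_j)_{j\in\mathbb{Z}}$ satisfying conditions A-E and $$\|S_j^{\varepsilon}-S_j\|_{C^k}:=\max_{0\le n\le k}\ \max_{i_1,\dots,i_n\in\mathbb{Z}}\ \sup_{x\in\mathbb{R}^{\mathbb{Z}}}\left|\partial_{i_1,\dots,i_n}(S_j^{\varepsilon}-S_j)(x)\right|\le\varepsilon ,$$ as well as a $\delta>0$ and a nonempty interval $(\eta_-,\eta_+)\subset\mathbb{R}$, such that the following holds. If $\Omega\in\mathbb{R}$ satisfies $|\omega-\Omega|\le\delta$ and $x\in\mathbb{R}^{\mathbb{Z}}$ is a global minimizer of the perturbed potentials $S_j^{\varepsilon}$ which has rotation number $\Omega$, for which the collection $\{\tau_{m,l}x\mid m,l\in\mathbb{Z}\}$ is totally ordered, and which is maximally periodic, then $$x_0\notin(\eta_-,\eta_+).$$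
   Context: Sequences are elements $x=(x_i)_{i\in\mathbb{Z}}$ of $\mathbb{R}^{\mathbb{Z}}$. For $k,l\in\mathbb{Z}$ the shift $\tau_{k,l}:\mathbb{R}^{\mathbb{Z}}\to\mathbb{R}^{\mathbb{Z}}$ is $(\tau_{k,l}x)_i:=x_{i-k}+l$. Write $x\le y$ if $x_i\le y_i$ for all $i$; ''totally ordered'' refers to this partial order. A family of local potentials is a family of functions $S_j:\mathbb{R}^{\mathbb{Z}}\to\mathbb{R}$, $j\in\mathbb{Z}$. Conditions A-E ($\partial_i=\partial/\partial x_i$, $\partial_{i,k}=\partial_i\partial_k$): A. There is an integer $r$ such that every $S_j(x)$ depends only on $x_{j-r},\dots,x_{j+r}$, and every $S_j$ is twice continuously differentiable. B. $S_j(x)=S_{j+k}(\tau_{k,l}x)$ for all $j,k,l\in\mathbb{Z}$ and all $x$. C. $S_j(x)\to\infty$ as $|x_k-x_j|\to\infty$, if $|k-j|=1$. D. $\partial_{i,k}S_j\le 0$ for all $j$ and all $i\ne k$, and $\partial_{j,k}S_j<0$ whenever $|j-k|=1$. E. There is a constant $C>0$ with $|\partial_iS_j(x)|\le C$ and $|\partial_{i,k}S_j(x)|\le C$ for all $i,j,k$ and all $x$. The estimate on $\|S_j^\varepsilon-S_j\|_{C^k}$ includes that the difference $S_j^\varepsilon-S_j$ is $C^k$. A sequence $x$ is a global minimizer for the $S_j$ if $\sum_{j\in\mathbb{Z}}(S_j(x+y)-S_j(x))\ge 0$ for every finitely supported $y\in\mathbb{R}^{\mathbb{Z}}$. It has rotation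 number $\Omega$ if $\lim_{n\to\pm\infty}x_n/n=\Omega$. A sequence $x$ of rotation number $\Omega$ whose translates $\{\tau_{m,l}x\}$ are totally ordered is called maximally periodic if $\tau_{m,l}x=x$ for all $m,l\in\mathbb{Z}$ with $-\Omega m+l=0$. For $\gamma>0$, $\sigma>2$: $\mathcal{L}_{\gamma,\sigma}$ is the set of $\omega\in\mathbb{R}\setminus\mathbb{Q}$ for which there is a sequence $(p_j,q_j)\in\mathbb{N}\times\mathbb{Z}$ (with $p_j\ge 1$) with $|\omega-q_j/p_j|<\gamma/p_j^{\sigma}$ and $\lim_{j\to\infty}p_j=\infty$. *)

(* Defs.v *)
From HB Require Import structures.
From mathcomp Require Import all_boot all_order all_algebra.
From mathcomp Require Import all_classical all_reals all_analysis.
Set Implicit Arguments.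
Unset Strict Implicit.
Unset Printing Implicit Defensive.
Import Order.TTheory GRing.Theory Num.Theory.
Import numFieldNormedType.Exports.
Local Open Scope classical_set_scope.
Local Open Scope ring_scope.

Section Defs.
Variable R : realType.

Definition shift_seq (k l : int) (x : int -> R) : int -> R :=
  fun i => x (i - k) + l%:~R.

Definition translates (x : int -> R) : set (int -> R) :=
  [set shift_seq m l x | m in [set: int] & l in [set: int]].

(* [<=%O] on [int -> R] is the library's pointwise order on functions. *)
Definition totally_ordered (A : set (int -> R)) : Prop :=
  total_on A (fun y z => (y <= z)%O).

(* [t |-> f x] with the coordinate [x i] replaced by [t]. *)
Definition section_at (i : int) (f : (int -> R) -> R) (x : int -> R) : R -> R :=
  fun t => f (dfwith x i t).

Definition partial (i : int) (f : (int -> R) -> R) : (int -> R) -> R :=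
  fun x => derive1 (section_at i f x) (x i).

(* [partials [:: i_1; ...; i_n] f] is [partial i_1 (... (partial i_n f))]. *)
Definition partials (s : seq int) (f : (int -> R) -> R) : (int -> R) -> R :=
  foldr partial f s.

(* Continuity refers to the product topology. For a function of finitely many
   coordinates, which is the only case in use, [Ck k] is the usual C^k. *)
Fixpoint Ck (k : nat) (f : (int -> R) -> R) : Prop :=
  continuous (f : {ptws int -> R} -> R) /\
  if k is k'.+1 then
    forall i, (forall x, derivable (section_at i f x) (x i) 1) /\
              Ck k' (partial i f)
  else True.

(* The C^k norm: it is [+oo] when some derivative of order at most [k] is
   unbounded. It is meaningful only for functions satisfying [Ck k], since
   [partial] takes junk values at points of non-differentiability. *)
Definition Ck_norm (k : nat) (f : (int -> R) -> R) : \bar R :=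
  ereal_sup [set `|partials s f x|%:E | s in [set s : seq int | (size s <= k)%N]
                                      & x in [set: int -> R]].

Definition condA (S : int -> (int -> R) -> R) : Prop :=
  (exists r : int, forall (j : int) (x y : int -> R),
     (forall i, j - r <= i <= j + r -> x i = y i) -> S j x = S j y) /\
  (forall j, Ck 2 (S j)).

Definition condB (S : int -> (int -> R) -> R) : Prop :=
  forall (j k l : int) (x : int -> R), S j x = S (j + k) (shift_seq k l x).

Definition condC (S : int -> (int -> R) -> R) : Prop :=
  forall j k : int, `|k - j| = 1 ->
  forall M : R, exists A : R, forall x : int -> R,
    A <= `|x k - x j| -> M <= S j x.

Definition condD (S : int -> (int -> R) -> R) : Prop :=
  (forall (j i k : int) (x : int -> R),
     i != k -> partials [:: i; k] (S j) x <= 0) /\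
  (forall (j k : int) (x : int -> R),
     `|j - k| = 1 -> partials [:: j; k] (S j) x < 0).

Definition condE (S : int -> (int -> R) -> R) : Prop :=
  exists2 C : R, 0 < C & forall (i j k : int) (x : int -> R),
    `|partial i (S j) x| <= C /\ `|partials [:: i; k] (S j) x| <= C.

Record conditions_AE (S : int -> (int -> R) -> R) : Prop := ConditionsAE {
  conditions_A : condA S;
  conditions_B : condB S;
  conditions_C : condC S;
  conditions_D : condD S;
  conditions_E : condE S }.

(* By [condA] only finitely many terms of the sum are nonzero, so that the
   library's sum over a finite support is the sum over all of [int]. *)
Definition global_minimizer (S : int -> (int -> R) -> R) (x : int -> R) : Prop :=
  forall y : int -> R, finite_set [set i | y i != 0] ->
    0 <= \sum_(j \in [set: int]) (S j (x + y) - S j x).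

Definition rotation_number (x : int -> R) (Omega : R) : Prop :=
  x n%:Z / n%:R @[n --> \oo] --> Omega /\
  x (- n%:Z) / (- n%:R) @[n --> \oo] --> Omega.

Definition maximally_periodic (x : int -> R) (Omega : R) : Prop :=
  forall m l : int, - Omega * m%:~R + l%:~R = 0 -> shift_seq m l x = x.

(* Used for [0 < gamma] and [2 < sigma]. *)
Definition Liouville_set (gamma sigma : R) : set R :=
  [set w | irrational w /\
    exists (p : nat -> nat) (q : nat -> int),
      [/\ forall j, (1 <= p j)%N,
          forall j, `|w - (q j)%:~R / (p j)%:R| < gamma / (p j)%:R `^ sigma &
          p j @[j --> \oo] --> \oo]].

End Defs.

(* Main.v *)
(** A minimizer [x] of period [(p, q)], with [q / p] very close to [omega], has a gap
    of length [1 / (p + 1)] modulo 1 that its orbit avoids. A first bump [V1] in this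
    gap keeps [x] minimal but charges every crossing from [x] to [x + 1], so that a
    near-minimal monotone crossing [z] visits the middle of the gap only [O(p ^ k)]
    times. There is room for a second bump [V2], of height of order
    [p ^ (- k (k + 1))], on an interval avoided by [z] altogether.

    Let [y] be a minimizer of rotation number [Omega], with
    [0 < beta = p * Omega - q], and suppose that [y 0] lies in the core of [V2], between
    [z 0] and its next translate. By exchange arguments [y] follows a translate of [z]
    on one side and another one on the other side, at a cost small compared to the
    height [W] of [V2]. Splicing the pieces gives a competitor in which [y] crosses
    without paying for [V2], the seam costing [O(beta / W)]. This is a contradiction
    as soon as [beta] is small compared to [W ^ 2], that is to [p ^ (- 2 k (k + 1))]:
    the Diophantine condition with [sigma > 1 + 2 k (k + 1)] provides it. The case
    [Omega < q / p] follows by reflection. *)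

(* The exponents come from one scaling rule: a bound on [k] derivatives allows a bump of width [g] a
   height of order [g ^ k]. The first bump has width about [1 / p], so a visit costs about
   [p ^ (- k)]; as a crossing has bounded energy whatever [p] is, it makes at most about [p ^ k]
   visits. Dividing the gap by this number leaves a width of about [p ^ (- (k + 1))] for the second
   bump, whose height is the [k]-th power of it. The additional 1 in the condition on [sigma] is the
   factor [p] between [beta] and the distance from [Omega] to [q / p]. The seam costs [beta / W]
   because the surgery spans about [1 / W] periods. Nothing forces the overlap of [y] with a
   translate of [z] to be small at a given place; but where it is large, the twist gains an energy
   proportional to its square. With a tolerated overlap of the order of the square root of [W],
   about [1 / W] places without a good cut gain together more than a cut at any place can cost. *)
From HB Require Import structures.
From mathcomp Require Import all_boot all_order all_algebra.
From mathcomp Require Import all_classical all_reals all_analysis.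
From mathcomp Require Import zify ring lra.
Require Import Defs.
Set Implicit Arguments.
Unset Strict Implicit.
Unset Printing Implicit Defensive.
Import Order.TTheory GRing.Theory Num.Theory.
Import numFieldNormedType.Exports.
Local Open Scope classical_set_scope.
Local Open Scope ring_scope.

(* Hypotheses about real numbers are discarded first: they only slow [lia] down. *)
Ltac ilia :=
  repeat match goal with R : realType |- _ =>
    match goal with H : ?T |- _ =>
      match T with context [R] => clear H end
    end
  end; lia.

Ltac inia :=
  repeat match goal with R : realType |- _ =>
    match goal with H : ?T |- _ =>
      match T with context [R] => clear H end
    end
  end; nia.

Ltac free_of_minmax a :=
  lazymatch a with
  | context [Order.min _ _] => fail
  | context [Order.max _ _] => fail
  | _ => idtac
  end.

Ltac minmax := repeat match goal with
  | |- context [Order.min ?a ?b] => free_of_minmax a; free_of_minmax b; case: (leP a b) => ?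
  | |- context [Order.max ?a ?b] => free_of_minmax a; free_of_minmax b; case: (leP a b) => ?
  end; try lra.

(** * Mixed second differences along several coordinates *)

Section Mixed.
Variable R : realType.
Implicit Types (u v w x h k : int -> R) (f : (int -> R) -> R).

Definition upd x (i : int) (t : R) : int -> R :=
  fun j => if j == i then x j + t else x j.

Definition mixd f x (i : int) s (k : int) t : R :=
  f (upd (upd x i s) k t) - f (upd x i s) - f (upd x k t) + f x.

Definition addon (s : seq int) h x : int -> R :=
  fun i => if i \in s then x i + h i else x i.

Lemma upd0 x i : upd x i 0 = x.
Proof. by apply/funext => j; rewrite /upd addr0 if_same. Qed.

Lemma updC x i s (k : int) t : upd (upd x i s) k t = upd (upd x k t) i s.
Proof. by apply/funext => j; rewrite /upd; case: eqP; case: eqP => // _ _; lra. Qed.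

Lemma upd_upd x i s t : upd (upd x i s) i t = upd x i (s + t).
Proof. by apply/funext => j; rewrite /upd; case: eqP => // _; lra. Qed.

Lemma addon_nil h x : addon [::] h x = x.
Proof. by []. Qed.

Lemma addon_cons a s h x : a \notin s ->
  addon (a :: s) h x = upd (addon s h x) a (h a).
Proof.
move=> aNs; apply/funext => i; rewrite /addon /upd inE.
by case: eqP => [->|_] //=; rewrite (negbTE aNs).
Qed.

Lemma addonC s1 s2 h k x : addon s1 h (addon s2 k x) = addon s2 k (addon s1 h x).
Proof. by apply/funext => i; rewrite /addon; do 2 case: ifP => // _; lra. Qed.

(** Telescoping over [s2]; [mixed_list] telescopes once more, over the first list. [mixd] is
    controlled only at configurations between the extreme corners, because the twist is uniform only
    on bounded sets. *)
Lemma mixed_single f (U : int -> R) a c (s2 : seq int) k x :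
  uniq s2 -> (forall i, 0 <= k i) ->
  (forall b w, b \in s2 -> (forall i, x i <= w i <= x i + k i) ->
     (forall i, upd w b (k b) i <= x i + k i) -> mixd f w a c b (k b) <= U b) ->
  f (upd (addon s2 k x) a c) - f (upd x a c) - f (addon s2 k x) + f x
    <= \sum_(b <- s2) U b.
Proof.
move=> us2 k0; elim: s2 us2 => [|b s IH] /=; first by rewrite big_nil !addon_nil; lra.
move=> /andP[bNs us] H; rewrite big_cons addon_cons//.
have := IH us (fun b' w b's => H b' w (mem_behead (s := b :: s) b's)).
have bdw i : x i <= addon s k x i <= x i + k i.
  by rewrite /addon; case: ifP => _; have := k0 i; lra.
have := H b (addon s k x) (mem_head _ _) bdw.
rewrite /mixd => H1 H2.
suff /H1 : forall i, upd (addon s k x) b (k b) i <= x i + k i.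
  rewrite [upd (upd _ b _) a _]updC; lra.
move=> i; rewrite /upd; case: eqP => [->|_]; last by have := bdw i; lra.
by rewrite /addon (negbTE bNs).
Qed.

Lemma mixed_list f (U : int -> int -> R) (s1 s2 : seq int) h k x :
  uniq s1 -> uniq s2 -> (forall i, 0 <= h i) -> (forall i, 0 <= k i) ->
  (forall a b w, a \in s1 -> b \in s2 ->
     (forall i, x i <= w i <= x i + h i + k i) ->
     (forall i, upd (upd w a (h a)) b (k b) i <= x i + h i + k i) ->
     mixd f w a (h a) b (k b) <= U a b) ->
  f (addon s1 h (addon s2 k x)) - f (addon s1 h x) - f (addon s2 k x) + f x
    <= \sum_(a <- s1) \sum_(b <- s2) U a b.
Proof.
move=> us1 us2 h0 k0; elim: s1 us1 => [|a s IH] /=.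
  by rewrite big_nil !addon_nil; lra.
move=> /andP[aNs us] H; rewrite big_cons !addon_cons//.
have := IH us (fun a' b w a's => H a' b w (mem_behead (s := a :: s) a's)).
have bdw i : x i <= addon s h x i <= x i + h i.
  by rewrite /addon; case: ifP => _; have := h0 i; lra.
have := @mixed_single f (U a) a (h a) s2 k (addon s h x) us2 k0.
rewrite -(addonC s s2) => H1 H2.
suff /H1 : forall b w, b \in s2 ->
    (forall i, addon s h x i <= w i <= addon s h x i + k i) ->
    (forall i, upd w b (k b) i <= addon s h x i + k i) ->
    mixd f w a (h a) b (k b) <= U a b by lra.
move=> b w bs2 Hw Hw2; apply: H => //; first exact: mem_head.
- by move=> i; have := bdw i; have := Hw i; lra.
- move=> i; rewrite updC /upd; have := Hw2 i; rewrite /upd.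
  case: (i =P a) => [->|_]; last by have := bdw i; lra.
  by rewrite /addon (negbTE aNs); have := h0 a; lra.
Qed.

End Mixed.

(** * Potentials in finite-difference form *)

Section Pot.
Variable R : realType.
Implicit Types (u v w x y h : int -> R) (f : (int -> R) -> R) (i k l : int).
Implicit Types (S : int -> (int -> R) -> R) (r : nat) (j : int).

(* Conditions A, B, D and E without derivatives, in a form preserved by bumps
   and reflections. The twist is uniform, with constant [al L], on configurations
   within [L] of a constant. *)
Record pot (r : nat) (C : R) (al : R -> R) S : Prop := Potential {
  pot_loc : forall j x y, (forall i, `|i - j| <= r%:Z -> x i = y i) -> S j x = S j y;
  pot_eqv : forall j k l x, S j x = S (j + k) (shift_seq k l x);
  pot_C0 : 0 < C;
  pot_lip : forall j x i t, `|S j (upd x i t) - S j x| <= C * `|t|;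
  pot_mix : forall j x i k s t, i != k -> 0 <= s -> 0 <= t ->
    - (C * (s * t)) <= mixd (S j) x i s k t <= 0;
  pot_sec : forall j x i s t, 0 <= s -> 0 <= t ->
    `|mixd (S j) x i s i t| <= C * (s * t);
  pot_al0 : forall L, 0 < al L;
  pot_str : forall L j k c x s t, `|k - j| = 1 -> 0 <= s -> 0 <= t ->
    (forall i, `|i - j| <= r%:Z ->
       `|x i - c| <= L /\ `|upd (upd x j s) k t i - c| <= L) ->
    mixd (S j) x j s k t <= - (al L * (s * t)) }.

Definition win j r : seq int := [seq j - r%:Z + n%:Z | n <- iota 0 (2 * r + 1)].

Lemma mem_win j r i : (i \in win j r) = (`|i - j| <= r%:Z).
Proof.
apply/mapP/idP => [[n]|ij]; first by rewrite mem_iota => nr ->; lia.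
by exists (absz (i - j + r%:Z)); [rewrite mem_iota; lia|lia].
Qed.

Lemma uniq_win j r : uniq (win j r).
Proof. by rewrite map_inj_uniq ?iota_uniq// => a b; lia. Qed.

Lemma upd_at x i t : upd x i t i = x i + t. Proof. by rewrite /upd eqxx. Qed.

Lemma mixd_h0 f x (i : int) (k : int) t : mixd f x i 0 k t = 0.
Proof. by rewrite /mixd upd0; lra. Qed.

Lemma mixd_k0 f x (i : int) (k : int) s : mixd f x i s k 0 = 0.
Proof. by rewrite /mixd !upd0; lra. Qed.

Lemma lip_list f C (s : seq int) h x : uniq s ->
  (forall y i t, `|f (upd y i t) - f y| <= C * `|t|) ->
  `|f (addon s h x) - f x| <= C * \sum_(i <- s) `|h i|.
Proof.
move=> us H; elim: s us => [|a s IH] /=.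
  by rewrite addon_nil subrr normr0 big_nil mulr0.
move=> /andP[aNs us]; rewrite addon_cons// big_cons.
have := H (addon s h x) a (h a); have := IH us.
move=> H1 H2; rewrite mulrDr; apply: le_trans (lerD H2 H1).
exact: ler_distD.
Qed.

Context r C al S (HS : pot r C al S).

Lemma pot_lipw j u v : `|S j u - S j v| <= C * \sum_(i <- win j r) `|u i - v i|.
Proof.
rewrite (pot_loc HS (y := addon (win j r) (fun i => u i - v i) v)); last first.
  by move=> i; rewrite -mem_win /addon => -> /=; lra.
by apply: lip_list; [exact: uniq_win|move=> y i t; exact: pot_lip HS _ _ _ _].
Qed.

Section fourpoint.
Variables (j : int) (a b c d : int -> R).
Hypothesis H : forall i, `|i - j| <= r%:Z ->
  [/\ d i <= b i, d i <= c i, a i + d i = b i + c i & b i = d i \/ c i = d i].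

Let h i := if i \in win j r then b i - d i else 0.
Let k i := if i \in win j r then c i - d i else 0.

Let h0 i : 0 <= h i.
Proof. by rewrite /h mem_win; case: ifP => // /H []; lra. Qed.

Let k0 i : 0 <= k i.
Proof. by rewrite /k mem_win; case: ifP => // /H []; lra. Qed.

Let hk i : h i = 0 \/ k i = 0.
Proof.
by rewrite /h /k mem_win; case: ifP => [/H [_ _ _] [->|->]|]; rewrite ?subrr; auto.
Qed.

Let Eb : S j b = S j (addon (win j r) h d).
Proof. by apply: pot_loc HS _ _ _ _ => i; rewrite -mem_win /addon /h => -> /=; lra. Qed.

Let Ec : S j c = S j (addon (win j r) k d).
Proof. by apply: pot_loc HS _ _ _ _ => i; rewrite -mem_win /addon /k => -> /=; lra. Qed.

Let Ea : S j a = S j (addon (win j r) h (addon (win j r) k d)).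
Proof.
apply: pot_loc HS _ _ _ _ => i ij; have [_ _ + _] := H ij.
by move: ij; rewrite -mem_win /addon /h /k => -> /=; lra.
Qed.

(** The increments [b - d] and [c - d] have disjoint supports: second differences in a repeated
    coordinate vanish and the mixed ones are nonpositive. This submodularity is behind every
    exchange. *)
Lemma pot_sub : S j a - S j b - S j c + S j d <= 0.
Proof.
rewrite Ea Eb Ec.
have := @mixed_list R (S j) (fun _ _ => 0) (win j r) (win j r) h k d
  (uniq_win _ _) (uniq_win _ _) h0 k0.
rewrite big1 => [|? _]; last by rewrite big1.
apply => i i' w _ _ _ _; have [<-|ii] := eqVneq i i'.
  by have [->|->] := hk i; rewrite ?mixd_h0 ?mixd_k0.
by have /andP[] := pot_mix HS j w ii (h0 i) (k0 i').
Qed.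

(** The reverse estimate comes from the lower bound in [pot_mix], by applying [mixed_list] to
    [- S j]. *)
Lemma pot_subC : - (C * ((\sum_(i <- win j r) (b i - d i)) *
                         (\sum_(i <- win j r) (c i - d i))))
  <= S j a - S j b - S j c + S j d.
Proof.
rewrite Ea Eb Ec.
have := @mixed_list R (fun x => - S j x) (fun i i' => C * (h i * k i'))
  (win j r) (win j r) h k d (uniq_win _ _) (uniq_win _ _) h0 k0.
under eq_bigr do rewrite -mulr_sumr.
rewrite -mulr_sumr -big_distrlr /=.
have -> : \sum_(i <- win j r) h i = \sum_(i <- win j r) (b i - d i).
  by apply: eq_big_seq => i iw; rewrite /h iw.
have -> : \sum_(i <- win j r) k i = \sum_(i <- win j r) (c i - d i).
  by apply: eq_big_seq => i iw; rewrite /k iw.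
set X := C * _ => HH; suff : forall i i' w, mixd (fun x => - S j x) w i (h i) i' (k i') <= C * (h i * k i').
  by move=> H2; have := HH (fun a b w _ _ _ _ => H2 a b w); lra.
move=> i i' w; have [<-|ii] := eqVneq i i'.
  by have [->|->] := hk i; rewrite ?mixd_h0 ?mixd_k0 ?mul0r ?mulr0.
by have /andP[] := pot_mix HS j w ii (h0 i) (k0 i'); rewrite /mixd; lra.
Qed.

(** All pairs of coordinates contribute nonpositively; only the neighbouring pair [(j, m)] is kept,
    with its twist. Intermediate configurations lie between [d] and [a], hence within [L] of
    [ct]. *)
Lemma pot_str4 L (m : int) ct : `|m - j| = 1 -> (0 < r)%N ->
  (forall i, `|i - j| <= r%:Z -> `|a i - ct| <= L /\ `|d i - ct| <= L) ->
  S j a - S j b - S j c + S j d <= - (al L * ((b j - d j) * (c m - d m))).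
Proof.
move=> mj r0 HL; rewrite Ea Eb Ec.
have jw : j \in win j r by rewrite mem_win subrr normr0; lia.
have mw : m \in win j r by rewrite mem_win mj; lia.
pose U i i' := if (i == j) && (i' == m) then - (al L * (h j * k m)) else 0.
have EU : \sum_(i <- win j r) \sum_(i' <- win j r) U i i' =
    - (al L * ((b j - d j) * (c m - d m))).
  rewrite (bigD1_seq j)//= ?uniq_win// (bigD1_seq m)//= ?uniq_win//.
  rewrite big1 => [|i /negbTE im]; last by rewrite /U im andbF.
  rewrite big1 => [|i /negbTE ij]; last by rewrite big1// => i' _; rewrite /U ij.
  by rewrite /U !eqxx /= !addr0 /h /k jw mw.
rewrite -EU; apply: mixed_list => //; rewrite ?uniq_win//.
move=> i i' w _ _ w1 w2; rewrite /U.
have hE n : `|n - j| <= r%:Z -> h n = b n - d n by rewrite /h mem_win => ->.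
have kE n : `|n - j| <= r%:Z -> k n = c n - d n by rewrite /k mem_win => ->.
have wi n : `|n - j| <= r%:Z -> - L <= w n - ct <= L /\ d n <= w n <= a n.
  move=> nj; have [] := HL n nj; rewrite !ler_norml.
  by have := w1 n; rewrite hE// kE//; have [_ _ + _] := H nj; lra.
case: ifPn => [/andP[/eqP ij /eqP im]|].
  rewrite ij im; apply: (@pot_str r C al S HS L j m ct w _ _ mj (h0 _) (k0 _)) => n nj.
  have := w2 n; rewrite ij im (hE n nj) (kE n nj) => w2n.
  have w3 : w n <= upd (upd w j (h j)) m (k m) n.
    by rewrite /upd; do 2 case: eqP => // _; have := h0 j; have := k0 m; lra.
  have [_ _ + _] := H nj; have [] := HL n nj; have [] := wi n nj.
  rewrite !ler_norml; lra.
move=> _; have [<-|ii] := eqVneq i i'.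
  by have [->|->] := hk i; rewrite ?mixd_h0 ?mixd_k0.
by have /andP[] := pot_mix HS j w ii (h0 i) (k0 i').
Qed.

End fourpoint.

Lemma pot_minmax j u v :
  S j (fun i => Num.min (u i) (v i)) + S j (fun i => Num.max (u i) (v i))
    <= S j u + S j v.
Proof.
set m := (fun i => Num.min _ _); set M := (fun i => Num.max _ _).
suff : S j M - S j u - S j v + S j m <= 0 by lra.
apply: pot_sub => i _; rewrite /M /m.
by have [uv|uv] := leP (u i) (v i); split; rewrite ?lexx ?(ltW uv)//; try lra; auto.
Qed.

End Pot.

(** * Sums over windows of consecutive sites *)

Section Sums.
Variable R : realType.
Implicit Types (d : int -> R) (A : int) (n m : nat).

Definition Ds A n d : R := \sum_(i < n) d (A + i%:Z).

Lemma Ds_cat A m n d : Ds A (m + n) d = Ds A m d + Ds (A + m%:Z) n d.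
Proof.
rewrite /Ds big_split_ord /=; congr (_ + _).
by apply: eq_bigr => i _; congr d; lia.
Qed.

Lemma Ds0 A d : Ds A 0 d = 0. Proof. by rewrite /Ds big_ord0. Qed.

Lemma Ds_le A n d d' : (forall i, A <= i < A + n%:Z -> d i <= d' i) ->
  Ds A n d <= Ds A n d'.
Proof. by move=> H; apply: ler_sum => i _; apply: H; have := ltn_ord i; lia. Qed.

Lemma Ds_eq A n d d' : (forall i, A <= i < A + n%:Z -> d i = d' i) ->
  Ds A n d = Ds A n d'.
Proof. by move=> H; apply: eq_bigr => i _; apply: H; have := ltn_ord i; lia. Qed.

Lemma Ds_0 A n d : (forall i, A <= i < A + n%:Z -> d i = 0) -> Ds A n d = 0.
Proof. by move=> H; apply: big1 => i _; apply: H; have := ltn_ord i; lia. Qed.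

Lemma Ds_ge0 A n d : (forall i, A <= i < A + n%:Z -> 0 <= d i) -> 0 <= Ds A n d.
Proof. by move=> H; apply: sumr_ge0 => i _; apply: H; have := ltn_ord i; lia. Qed.

Lemma DsD A n d d' : Ds A n (fun i => d i + d' i) = Ds A n d + Ds A n d'.
Proof. exact: big_split. Qed.

Lemma DsN A n d : Ds A n (fun i => - d i) = - Ds A n d.
Proof. exact: sumrN. Qed.

Lemma DsZ A n d c : Ds A n (fun i => c * d i) = c * Ds A n d.
Proof. by rewrite /Ds mulr_sumr. Qed.

Lemma Ds_cst A n c : Ds A n (fun=> c) = n%:R * c.
Proof. by rewrite /Ds sumr_const card_ord mulr_natl. Qed.

Lemma Ds_shift A n d (k : int) : Ds A n (fun j => d (j + k)) = Ds (A + k) n d.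
Proof. by apply: eq_bigr => i _; congr d; lia. Qed.

Lemma Ds_split A n d A' n' : A' <= A -> A + n%:Z <= A' + n'%:Z ->
  Ds A' n' d = Ds A' (absz (A - A')%R) d + Ds A n d
    + Ds (A + n%:Z) (absz (A' + n'%:Z - A - n%:Z)%R) d.
Proof.
move=> H1 H2.
have E : n' = (absz (A - A')%R + n + absz (A' + n'%:Z - A - n%:Z)%R)%N by lia.
have E1 : A' + (absz (A - A')%R)%:Z = A by lia.
have E2 : A' + (absz (A - A')%R + n)%:Z = A + n%:Z by lia.
by rewrite {1}E !Ds_cat E1 E2.
Qed.

Lemma Ds_sub A n d A' n' : (forall i, 0 <= d i) -> A' <= A ->
  A + n%:Z <= A' + n'%:Z -> Ds A n d <= Ds A' n' d.
Proof.
move=> d0 H1 H2; rewrite (Ds_split d H1 H2).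
by have := Ds_ge0 (A := A') (n := absz (A - A')%R) (fun i _ => d0 i);
  have := Ds_ge0 (A := A + n%:Z) (n := absz (A' + n'%:Z - A - n%:Z)%R) (fun i _ => d0 i);
  lra.
Qed.

Lemma Ds_ge1 A n d i : (forall i, 0 <= d i) -> A <= i < A + n%:Z -> d i <= Ds A n d.
Proof.
move=> d0 H; have -> : d i = Ds i 1 d by rewrite /Ds big_ord1 addr0.
by apply: Ds_sub => //; lia.
Qed.

Lemma sum_win j r d : \sum_(i <- win j r) d i = Ds (j - r%:Z) (2 * r + 1) d.
Proof. rewrite big_map -{1}[(2 * r + 1)%N]subn0 -/(index_iota 0 _) big_mkord.
by apply: eq_bigr. Qed.

Lemma Ds_win A n r d : (forall i, 0 <= d i) ->
  Ds A n (fun j => \sum_(i <- win j r) d i) <=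
  (2 * r + 1)%:R * Ds (A - r%:Z) (n + 2 * r) d.
Proof.
move=> d0; under [X in X <= _]eq_bigr do rewrite sum_win.
rewrite /Ds exchange_big /=.
apply: (@le_trans _ _ (\sum_(k < 2 * r + 1) Ds (A - r%:Z) (n + 2 * r) d)).
  apply: ler_sum => k _.
  apply: (@le_trans _ _ (Ds (A - r%:Z + k%:Z) n d)).
    by rewrite le_eqVlt; apply/orP; left; apply/eqP/eq_bigr => i _; congr d; lia.
  by apply: Ds_sub => //; have := ltn_ord k; lia.
by rewrite sumr_const card_ord mulr_natl.
Qed.

End Sums.

(** * Energies of finite windows *)

Section Energy.
Variable R : realType.
Implicit Types (u v w x y : int -> R) (d : int -> R) (A i j : int) (n m : nat).
Implicit Types S : int -> (int -> R) -> R.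

Definition En S A n u : R := Ds A n (fun j => S j u).

Definition sh (P Q : int) u : int -> R := fun i => u (i + P) - Q%:~R.

Lemma En_cat S A m n u : En S A (m + n) u = En S A m u + En S (A + m%:Z) n u.
Proof. exact: Ds_cat. Qed.

Section withpot.
Context r C al S (HS : pot r C al S).

Definition C1 : R := C * (2 * r + 1)%:R.

Lemma C1_gt0 : 0 < C1.
Proof. by rewrite mulr_gt0 ?(pot_C0 HS)// ltr0n; lia. Qed.

Lemma pot_sh j P Q u : S j (sh P Q u) = S (j + P) u.
Proof.
rewrite (pot_eqv HS (j + P) (- P) (- Q)) addrK; congr S; apply/funext => i.
by rewrite /sh /shift_seq opprK mulrNz.
Qed.

Lemma En_sh A n P Q u : En S A n (sh P Q u) = En S (A + P) n u.
Proof. by rewrite /En -Ds_shift; apply: Ds_eq => j _; rewrite pot_sh. Qed.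

Lemma En_loc A n u v : (forall i, A - r%:Z <= i < A + n%:Z + r%:Z -> u i = v i) ->
  En S A n u = En S A n v.
Proof.
by move=> H; apply: Ds_eq => j jA; apply: pot_loc HS _ _ _ _ => i ij; apply: H; lia.
Qed.

Lemma En_lip A n u v : `|En S A n u - En S A n v| <=
  C1 * Ds (A - r%:Z) (n + 2 * r) (fun i => `|u i - v i|).
Proof.
rewrite /En -DsN -DsD /C1 -mulrA; apply: le_trans (ler_norm_sum _ _ _) _.
apply: (@le_trans _ _ (Ds A n (fun j => C * \sum_(i <- win j r) `|u i - v i|))).
  by apply: ler_sum => j _; exact: pot_lipw HS _ _ _.
rewrite DsZ ler_pM2l ?(pot_C0 HS)//.
exact: (@Ds_win R A n r (fun i => `|u i - v i|)).
Qed.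

Lemma En_minmax A n u v :
  En S A n (fun i => Num.min (u i) (v i)) + En S A n (fun i => Num.max (u i) (v i))
    <= En S A n u + En S A n v.
Proof. by rewrite /En -!DsD; apply: Ds_le => j _; exact: pot_minmax HS _ _ _. Qed.

(* [a], [b], [c], [d] play the roles of maximum, the two entries and minimum;
   the differences [b - d] and [c - d] are nonnegative with disjoint supports. *)
Definition fourpt a b c (d : int -> R) i : Prop :=
  [/\ d i <= b i, d i <= c i, a i + d i = b i + c i & b i = d i \/ c i = d i].

Lemma En4 A n a b c d : En S A n a - En S A n b - En S A n c + En S A n d =
  Ds A n (fun j => S j a - S j b - S j c + S j d).
Proof. by rewrite /En -!DsN -!DsD. Qed.

Lemma En_sub4 A n a b c d :
  (forall i, A - r%:Z <= i < A + n%:Z + r%:Z -> fourpt a b c d i) ->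
  En S A n a - En S A n b - En S A n c + En S A n d <= 0.
Proof.
move=> H; rewrite En4 -oppr_ge0 -DsN; apply: Ds_ge0 => j jA; rewrite oppr_ge0.
by apply: (pot_sub HS) => i ij; apply: H; lia.
Qed.

Lemma En_str4 A n a b c d L (j k : int) ct :
  (forall i, A - r%:Z <= i < A + n%:Z + r%:Z -> fourpt a b c d i) ->
  `|k - j| = 1 -> (0 < r)%N -> A <= j < A + n%:Z ->
  (forall i, `|i - j| <= r%:Z -> `|a i - ct| <= L /\ `|d i - ct| <= L) ->
  En S A n a - En S A n b - En S A n c + En S A n d
   <= - (al L * ((b j - d j) * (c k - d k))).
Proof.
move=> H kj r0 jA HL; rewrite En4.
set F := (fun j => _); have F0 i : A <= i < A + n%:Z -> F i <= 0.
  by move=> iA; apply: (pot_sub HS) => l il; apply: H; lia.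
have Fj : F j <= - (al L * ((b j - d j) * (c k - d k))).
  by apply: (@pot_str4 _ _ _ _ _ HS _ _ _ _ _ _ _ _ ct) => // i ij; apply: H; lia.
rewrite lerNr -DsN.
have F1 i : 0 <= Num.max 0 (- F i) by rewrite le_max lexx.
have H1 := @Ds_ge1 R A n (fun i => Num.max 0 (- F i)) j F1 jA.
apply: le_trans (_ : _ <= Ds A n (fun i => Num.max 0 (- F i))) _.
  by apply: le_trans H1; rewrite le_max; apply/orP; right; lra.
by apply: Ds_le => i iA; rewrite ge_max lexx oppr_ge0 F0.
Qed.

(** Only the [2 * r + 1] potentials around [i] read this site, so the bound does not depend on
    [n]. *)
Lemma En_sec A n u i s t : 0 <= s -> 0 <= t ->
  `|mixd (En S A n) u i s i t| <= C1 * (s * t).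
Proof.
move=> s0 t0; rewrite /mixd En4; apply: le_trans (ler_norm_sum _ _ _) _.
have st0 : 0 <= s * t by rewrite mulr_ge0.
have C0 := ltW (pot_C0 HS).
apply: (@le_trans _ _ (Ds A n (fun j => \sum_(l <- win j r) (C * (s * t) *+ (l == i))))).
  apply: ler_sum => j _; have [ij|ij] := boolP (i \in win (A + j%:Z) r).
    rewrite (bigD1_seq i)//= ?uniq_win// eqxx big1 ?addr0; last first.
      by move=> l /negbTE ->.
    by rewrite mulr1n; exact: (pot_sec HS _ _ _ s0 t0).
  rewrite big_seq big1 => [|l]; last first.
    by case: eqP => [->|//]; rewrite (negbTE ij).
  rewrite normr_le0; move: ij; rewrite mem_win => ij.
  have E t' v : S (A + j%:Z) (upd v i t') = S (A + j%:Z) v.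
    by apply: pot_loc HS _ _ _ _ => l lj; rewrite /upd; case: eqP => // li; lia.
  by rewrite !E; apply/eqP; lra.
apply: le_trans (@Ds_win R A n r (fun l => C * (s * t) *+ (l == i)) _) _.
  by move=> l; rewrite mulrn_wge0// mulr_ge0.
rewrite /C1 [X in _ <= X](_ : _ = (2 * r + 1)%:R * (C * (s * t))); last by ring.
rewrite ler_wpM2l ?ler0n//.
set m := (n + 2 * r)%N; set B := A - r%:Z.
have [iB|iB] := boolP (B <= i < B + m%:Z); last first.
  rewrite Ds_0 ?mulr_ge0// => l lB; case: eqP => // li; move: lB; rewrite li => lB.
  by rewrite lB in iB.
have iBm : (absz (i - B)%R < m)%N by lia.
rewrite /Ds (bigD1 (Ordinal iBm))//= big1 ?addr0.
  by case: eqP => _; rewrite ?mulr1n ?mulr0n ?mulr_ge0.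
move=> l; rewrite -val_eqE /= => li; case: eqP => // E.
by move/eqP: li => []; lia.
Qed.

(** As [b - d] lives to the left of [c0] and [c - d] to its right, only potentials whose range
    straddles [c0] see both. The interaction is thus bounded by the increments within [2 * r] sites
    of the seam. *)
Lemma En_cut A n a b c d c0 :
  (forall i, A - r%:Z <= i < A + n%:Z + r%:Z -> fourpt a b c d i) ->
  (forall i, i >= c0 -> b i = d i) -> (forall i, i < c0 -> c i = d i) ->
  - (C1 * (Ds (c0 - (2 * r)%:Z) (4 * r) (fun i => `|b i - d i|) *
           Ds (c0 - (2 * r)%:Z) (4 * r) (fun i => `|c i - d i|)))
  <= En S A n a - En S A n b - En S A n c + En S A n d.
Proof.
move=> H Hb Hc; rewrite En4.
set sb := Ds _ _ (fun i => `|b i - d i|); set sc := Ds _ _ (fun i => `|c i - d i|).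
have sc0 : 0 <= sc by exact: Ds_ge0.
have C0 := ltW (pot_C0 HS).
(* Truncating [b - d] to the seam first allows [Ds_win] to be applied to the sum over all [j]. *)
pose bb i := if c0 - (2 * r)%:Z <= i < c0 then `|b i - d i| else 0.
have bb0 i : 0 <= bb i by rewrite /bb; case: ifP.
apply: (@le_trans _ _ (Ds A n (fun j => - (C * sc * \sum_(i <- win j r) bb i)))); last first.
  apply: Ds_le => j jA.
  have Hj i : `|i - j| <= r%:Z -> fourpt a b c d i by move=> ij; apply: H; lia.
  apply: le_trans (pot_subC HS Hj); rewrite lerN2 -mulrA ler_wpM2l// mulrC.
  have sb_ge : 0 <= \sum_(i <- win j r) (b i - d i).
    by rewrite big_seq sumr_ge0// => i; rewrite mem_win => /Hj []; lra.
  have [cj|cj] := ltP (j + r%:Z) c0.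
    rewrite big_seq big1 ?mul0r.
      by rewrite mulr_ge0// sumr_ge0.
    by move=> i; rewrite mem_win => ij; rewrite Hc ?subrr//; lia.
  have [cj2|cj2] := leP c0 (j - r%:Z).
    rewrite [X in _ * X <= _]big_seq [X in _ * X <= _]big1 ?mulr0.
      by rewrite mulr_ge0// sumr_ge0.
    by move=> i; rewrite mem_win => ij; rewrite Hb ?subrr//; lia.
  apply: ler_pM => //.
  - by rewrite big_seq sumr_ge0// => i; rewrite mem_win => /Hj []; lra.
  - rewrite /sc.
    apply: le_trans (_ : _ <= Ds (j - r%:Z) (2 * r + 1)
        (fun i => if i < c0 + (2 * r)%:Z then `|c i - d i| else `|c i - d i|)) _.
      by rewrite sum_win; apply: Ds_le => i _; rewrite if_same ler_norm.
    have [E|E] := leP (j + r%:Z + 1) (c0 + (2 * r)%:Z).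
      by rewrite (Ds_eq (d' := fun i => `|c i - d i|)) => [|i _];
        rewrite ?if_same//; apply: Ds_sub => //; lia.
    lia.
  - rewrite big_seq [leRHS]big_seq; apply: ler_sum => i; rewrite mem_win => ij.
    rewrite /bb; case: ifPn => [_|iN]; first exact: ler_norm.
    by rewrite Hb ?subrr//; lia.
rewrite DsN lerN2 DsZ /C1.
apply: le_trans (ler_wpM2l _ (@Ds_win R A n r bb bb0)) _; first by rewrite mulr_ge0.
have sbb : Ds (A - r%:Z) (n + 2 * r) bb <= sb.
  pose B := Num.min (A - r%:Z) (c0 - (2 * r)%:Z).
  pose T := Num.max (A - r%:Z + (n + 2 * r)%:Z) (c0 + (2 * r)%:Z).
  apply: le_trans (@Ds_sub _ _ _ _ B (absz (T - B)%R) bb0 _ _) _; [lia|lia|].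
  rewrite (@Ds_split R (c0 - (2 * r)%:Z) (4 * r) bb B (absz (T - B)%R)); [|lia|lia].
  rewrite Ds_0 ?add0r; last by move=> i iB; rewrite /bb; case: ifP => //; lia.
  rewrite [X in _ + X]Ds_0 ?addr0; last by move=> i iB; rewrite /bb; case: ifP => //; lia.
  by apply: Ds_le => i _; rewrite /bb; case: ifP.
rewrite [leRHS](_ : _ = C * sc * ((2 * r + 1)%:R * sb)); last by ring.
by rewrite ler_wpM2l ?mulr_ge0// ler_wpM2l.
Qed.

End withpot.
End Energy.

(** * Periodic minimizers *)

Lemma int_two_sided_ind (P : int -> Prop) (i0 : int) :
  P i0 -> (forall i, P i -> P (i + 1)) -> (forall i, P i -> P (i - 1)) ->
  forall i, P i.
Proof.
move=> P0 Pp Pm i.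
suff [H1 H2] : (forall n : nat, P (i0 + n%:Z)) /\ (forall n : nat, P (i0 - n%:Z)).
  have [ii|ii] := leP i0 i.
    by have := H1 (absz (i - i0)%R); congr P; lia.
  by have := H2 (absz (i - i0)%R); congr P; lia.
split; elim=> [|n IH]; rewrite ?addr0 ?subr0//.
  by have := Pp _ IH; congr P; lia.
by have := Pm _ IH; congr P; lia.
Qed.

Section Birkhoff.
Variable R : realType.
Implicit Types (u v w x y : int -> R) (A i j k l P Q : int) (n m M : nat).

Definition per P Q u : Prop := forall i, u (i + P) = u i + Q%:~R.

Lemma per_mul P Q u n : per P Q u -> per (n%:Z * P) (n%:Z * Q) u.
Proof.
move=> H; elim: n => [|n IH] i; first by rewrite !mul0r !addr0.
have -> : i + n.+1%:Z * P = i + n%:Z * P + P by lia.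
rewrite H IH -addrA -intrD; congr (_ + _%:~R); lia.
Qed.

Lemma per_sh P Q u k l : per P Q u -> per P Q (sh k l u).
Proof. by move=> H i; rewrite /sh addrAC H addrAC. Qed.

Lemma per_div P Q u A i : per P Q u -> P != 0 ->
  u i = u (A + ((i - A) %% P)%Z) + ((i - A) %/ P)%Z%:~R * Q%:~R.
Proof.
move=> H P0; set d := divz _ _.
have E : forall k : int, forall i, u (i + k * P) = u i + k%:~R * Q%:~R.
  apply: (@int_two_sided_ind (fun k => forall i, u (i + k * P) = u i + k%:~R * Q%:~R) 0)
    => [i'|k IH i'|k IH i'].
  - by rewrite !mul0r !addr0.
  - have -> : i' + (k + 1) * P = (i' + k * P) + P by lia.
    by rewrite H IH intrD; ring.
  - have := H (i' + (k - 1) * P).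
    have -> : i' + (k - 1) * P + P = i' + k * P by lia.
    by rewrite IH intrB; lra.
rewrite -E; congr u; have := divz_eq (i - A) P; rewrite -/d; lia.
Qed.

(** Comparing the displacement with an integer [m] at the single site [i] decides, by the total
    ordering, how [x] and [sh k m x] compare everywhere, hence how [m] compares with [k * rho]. So
    no integer lies strictly between the displacement and [k * rho]. *)
Lemma birkhoff_bound x (rho : R) :
  (forall k l, (forall i, x i <= sh k l x i) \/ (forall i, sh k l x i <= x i)) ->
  (forall k l, (forall i, x i <= sh k l x i) -> l%:~R <= k%:~R * rho) ->
  (forall k l, (forall i, sh k l x i <= x i) -> k%:~R * rho <= l%:~R) ->
  forall i k, `|x (i + k) - x i - k%:~R * rho| <= 1.
Proof.
move=> tot Hge Hle i k; set D := x (i + k) - x i.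
have Hlow (m : int) : (m%:~R < D -> m%:~R <= k%:~R * rho).
  move=> mD; have [H|H] := tot k m; first exact: Hge.
  by have := H i; rewrite /sh; move: mD; rewrite /D; lra.
have Hup (m : int) : (D < m%:~R -> k%:~R * rho <= m%:~R).
  move=> mD; have [H|H] := tot k m; last exact: Hle.
  by have := H i; rewrite /sh; move: mD; rewrite /D; lra.
have f1 := floor_le_tmp D; have f2 := floorD1_gt D.
have := Hup _ f2; rewrite ler_norml intrD => H2.
have H1 : (Num.floor D - 1)%:~R <= k%:~R * rho by apply: Hlow; rewrite intrB; lra.
rewrite intrB in H1.
have H3 : D - 1 <= k%:~R * rho.
  have [E|E] := ltrP (Num.floor D)%:~R D; first by have := Hlow _ E; move: f2; rewrite intrD; lra.
  by lra.
lra.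
Qed.

(** After [p] iterations of the inequality both sides are known exactly, since
    [x (p * k) = x 0 + k * q]. *)
Lemma per_ge_rate x (p : nat) (q : int) : (0 < p)%N -> per p q x ->
  forall k l, (forall i, x i <= sh k l x i) -> l%:~R <= k%:~R * (q%:~R / p%:R) :> R.
Proof.
move=> p0 px k l H.
have it n : x 0 + n%:R * l%:~R <= x (n%:Z * k).
  elim: n => [|n IH]; first by rewrite !mul0r addr0.
  have := H (n%:Z * k); rewrite /sh (_ : n%:Z * k + k = n.+1%:Z * k); last by lia.
  by rewrite -natr1; lra.
have pn : 0 < p%:R :> R by rewrite ltr0n.
have := it p; rewrite mulrA ler_pdivlMr//.
have E k' : x (p%:Z * k') = x 0 + k'%:~R * q%:~R.
  have := per_div 0 (p%:Z * k') px; rewrite subr0 => ->; last by lia.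
  by rewrite mulrC modzMl mulzK ?addr0//; lia.
by rewrite E; lra.
Qed.

Lemma per_le_rate x (p : nat) (q : int) : (0 < p)%N -> per p q x ->
  forall k l, (forall i, sh k l x i <= x i) -> k%:~R * (q%:~R / p%:R) <= l%:~R :> R.
Proof.
move=> p0 px k l H.
have px' : per p (- q) (fun i => - x i) by move=> i; rewrite px intrN; lra.
have := @per_ge_rate (fun i => - x i) p (- q) p0 px' k (- l).
rewrite !intrN mulNr mulrN lerN2; apply=> i.
by have := H i; rewrite /sh intrN; lra.
Qed.

End Birkhoff.

Section Minimizers.
Variable R : realType.
Implicit Types (u v w x y : int -> R) (A i j k l P Q : int) (n m M : nat).
Implicit Types S : int -> (int -> R) -> R.

Definition isMin S (P : nat) (Q : int) x : Prop :=
  per P Q x /\ forall u, per P Q u -> En S 0 P x <= En S 0 P u.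

Definition minEx S : Prop :=
  forall P : nat, (0 < P)%N -> forall Q, exists x, isMin S P Q x.

Context r C al S (HS : pot r C al S).

Lemma pot_per j (P : int) Q u : per P Q u -> S (j + P) u = S j u.
Proof.
move=> H; rewrite -(pot_sh HS j P Q); congr S; apply/funext => i.
by rewrite /sh H addrK.
Qed.

Lemma En_per A (P : nat) Q u : per P Q u -> En S A P u = En S 0 P u.
Proof.
move=> H; have step B : En S (B + 1) P u = En S B P u.
  have := Ds_cat B 1 P (fun j => S j u); rewrite addnC Ds_cat /En => E.
  have : Ds B 1 (S^~ u) = Ds (B + P) 1 (S^~ u).
    by rewrite -Ds_shift; apply: Ds_eq => j _; rewrite (pot_per _ H).
  by move: E; lra.
apply: (@int_two_sided_ind (fun A => En S A P u = En S 0 P u) 0) => // B.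
  by rewrite step.
by move=> <-; rewrite -(step (B - 1)) subrK.
Qed.

Lemma En_per_mul A M (P : nat) Q u : per P Q u ->
  En S A (M * P) u = M%:R * En S 0 P u.
Proof.
move=> H; elim: M A => [|M IH] A; first by rewrite mul0r /En Ds0.
by rewrite mulSn En_cat (En_per _ H) IH -natr1; lra.
Qed.

Lemma isMin_min (P : nat) Q u w : isMin S P Q u -> isMin S P Q w ->
  isMin S P Q (fun i => Num.min (u i) (w i)).
Proof.
move=> [pu Hu] [pw Hw]; split=> [i|v pv]; first by rewrite pu pw addr_minl.
have pM : per P Q (fun i => Num.max (u i) (w i)) by move=> i; rewrite pu pw addr_maxl.
by have := En_minmax HS 0 P u w; have := Hw _ pM; have := Hu _ pv; lra.
Qed.

(* Strict comparison: if the two minimizers touch at [i], lowering the smaller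
   one at [i] would gain to first order unless they also agree at [i +- 1]. *)
Lemma isMin_touch (P : nat) Q u w i k : (2 * r < P)%N -> (0 < r)%N -> `|k - i| = 1 ->
  isMin S P Q u -> isMin S P Q w -> (forall i, w i <= u i) ->
  u i = w i -> u k = w k.
Proof.
move=> rP r0 ki [pu Hu] [pw Hw] wu ui; apply/eqP; rewrite eq_le wu andbT leNgt.
apply/negP => wk; have P0 : P%:Z != 0 by lia.
pose L := Ds (i - r%:Z) (2 * r + 1) (fun l => `|u l| + `|w l|) + 1.
have L0 l : `|l - i| <= r%:Z -> `|u l| + 1 <= L /\ `|w l| + 1 <= L.
  move=> li; have := @Ds_ge1 R (i - r%:Z) (2 * r + 1) (fun l => `|u l| + `|w l|) l.
  have H0 (l' : int) : 0 <= `|u l'| + `|w l'| by rewrite addr_ge0.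
  move=> /(_ H0); rewrite -/L.
  have lr : i - r%:Z <= l < i - r%:Z + (2 * r + 1)%:Z by lia.
  move=> /(_ lr); have := normr_ge0 (u l); have := normr_ge0 (w l).
  by rewrite /L; lra.
have a0 := pot_al0 HS L; have C10 := C1_gt0 HS.
pose del := u k - w k; have d0 : 0 < del by rewrite subr_gt0.
(* Lowering by [t] gains [al L * t * del] by the twist and costs at most [C1 * t ^ 2] to second
   order; this [t] makes the gain prevail, and [t <= 1] stays in the box of size [L]. *)
pose t := Num.min 1 (al L * del / (2 * C1 r C)).
have t0 : 0 < t.
  rewrite lt_min ltr01 /=; apply: divr_gt0; first exact: mulr_gt0.
  by apply: mulr_gt0 => //; rewrite ltr0n.
have t1 : t <= 1 by rewrite ge_min lexx.
have tC : C1 r C * t < al L * del.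
  have : t <= al L * del / (2 * C1 r C) by rewrite ge_min lexx orbT.
  rewrite ler_pdivlMr; last by apply: mulr_gt0 => //; rewrite ltr0n.
  have : 0 < al L * del by rewrite mulr_gt0.
  lra.
have dn_ok (s : R) v : per P Q v ->
    exists v', per P Q v' /\ En S (i - r%:Z) P v' = En S (i - r%:Z) P (upd v i s).
  move=> pv; exists (fun l => if ((l - i) %% P == 0)%Z then v l + s else v l); split.
    move=> l /=; rewrite (_ : l + P - i = (l - i) + P); last by lia.
    by rewrite modzDr pv; case: ifP => // _; lra.
  apply: (En_loc HS) => l lB; rewrite /upd; have [->|li] := eqVneq l i.
    by rewrite subrr mod0z.
  case: eqP => // /dvdz_mod0P/dvdzP[z E].
  have : z = 0 \/ z <= -1 \/ 1 <= z by lia.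
  by case=> [z0|[z0|z0]]; move: li; rewrite -subr_eq0 E ?z0 ?mul0r ?eqxx// => _; nia.
have [v1 [pv1 E1]] := dn_ok (- t) w pw.
have [v2 [pv2 E2]] := dn_ok t u pu.
have := Hw _ pv1; have := Hu _ pv2.
rewrite -(En_per (i - r%:Z) pv1) -(En_per (i - r%:Z) pv2) E1 E2.
rewrite -(En_per (i - r%:Z) pw) -(En_per (i - r%:Z) pu) => H2 H1.
set F := En S (i - r%:Z) P in H1 H2.
have H3 : `|mixd F (upd u i (- t)) i t i t| <= C1 r C * (t * t).
  by apply: (En_sec HS); exact: ltW.
have Et : - t + (t + t) = t by lra.
rewrite /mixd !upd_upd ?Et addNr upd0 ?add0r ler_norml in H3.
have H4 : F u - F w - F (upd u i (- t)) + F (upd w i (- t)) <=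
    - (al L * ((w i - upd w i (- t) i) * (upd u i (- t) k - upd w i (- t) k))).
  apply: (@En_str4 _ _ _ _ _ HS _ _ _ _ _ _ _ _ _ 0) => //.
  - move=> l _; rewrite /fourpt /upd; case: eqP => [->|_]; rewrite ?ui.
      by split; try lra; right.
    by have := wu l; split; try lra; left.
  - by clear -rP; lia.
  - move=> l li; rewrite !subr0; have [h1 h2] := L0 l li; split; first lra.
    by rewrite /upd; case: eqP => _; move: h2; [|lra]; rewrite !ler_norml;
       have := ler_norm (w l); have := ler_norm (- w l); rewrite normrN; lra.
have ki' : (k == i) = false by clear -ki; apply/negP => /eqP; lia.
have Ek v (s : R) : upd v i s k = v k by rewrite /upd ki'.
rewrite !upd_at !Ek -/del opprD addrA subrr opprK add0r in H4.
have : t * (C1 r C * t) < t * (al L * del) by rewrite ltr_pM2l.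
lra.
Qed.

(** Aubry's ordering. The minimum of [u] and [w] is again a minimizer, and contact of [u] with it
    propagates to the neighbouring sites by [isMin_touch]: a single contact gives [u <= w]
    everywhere. *)
Lemma isMin_order (P : nat) Q u w : (2 * r < P)%N -> (0 < r)%N ->
  isMin S P Q u -> isMin S P Q w ->
  (forall i, u i <= w i) \/ (forall i, w i <= u i).
Proof.
move=> rP r0 Hu Hw; have Hm := isMin_min Hu Hw.
set m := (fun i => Num.min _ _) in Hm.
have mu i : m i <= u i by rewrite ge_min lexx.
have touch i k : `|k - i| = 1 -> u i = m i -> u k = m k.
  by move=> ki; exact: isMin_touch rP r0 ki Hu Hm mu.
have [[i ui]|H] := pselect (exists i, u i = m i).
  have um : forall l, u l = m l.
    apply: (@int_two_sided_ind (fun l => u l = m l) i) => // l ul.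
      by apply: (touch l) => //; lia.
    by apply: (touch l) => //; lia.
  by left=> l; rewrite um ge_min lexx orbT.
right=> l; have [ul|/ltW//] := leP (u l) (w l); exfalso; apply: H; exists l.
by rewrite /m; apply/esym/min_idPl.
Qed.

Lemma isMin_sh (P : nat) Q u k l : isMin S P Q u -> isMin S P Q (sh k l u).
Proof.
move=> [pu Hu]; split; first exact: per_sh.
by move=> v pv; rewrite (En_sh HS) (En_per _ pu); exact: Hu.
Qed.

Lemma isMin_bound (p : nat) q x : (2 * r < p)%N -> (0 < r)%N -> isMin S p q x ->
  forall i k, `|x (i + k) - x i - k%:~R * (q%:~R / p%:R)| <= 1.
Proof.
move=> rp r0 Hx; have p0 : (0 < p)%N by lia.
apply: birkhoff_bound.
- by move=> k l; exact: isMin_order rp r0 Hx (isMin_sh k l Hx).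
- exact: per_ge_rate p0 Hx.1.
- exact: per_le_rate p0 Hx.1.
Qed.

(** A minimizer [y] of the long period is comparable with [sh p q y]. Iterating this order [M] times
    leads back to [y], so both are equal: [y] already has period [(p, q)], where [x] is minimal. *)
Lemma isMin_mul (p : nat) q x M u A : minEx S -> (2 * r < p)%N -> (0 < r)%N ->
  (0 < M)%N -> isMin S p q x -> per (M * p)%N (M%:Z * q) u ->
  En S A (M * p) x <= En S A (M * p) u.
Proof.
move=> mE rp r0 M0 Hx pu.
have rMp : (2 * r < M * p)%N by nia.
have [y Hy] := mE (M * p)%N (leq_ltn_trans (leq0n _) rMp) (M%:Z * q).
have Eit n i : sh (n%:Z * p) (n%:Z * q) y i = iter n (sh p q) y i.
  elim: n i => [|n IH] i; first by rewrite /sh !mul0r addr0 subr0.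
  rewrite iterS [RHS]/sh -IH /sh -[RHS]addrA -opprD -intrD.
  by congr (y _ - _%:~R); lia.
have yM i : iter M (sh p q) y i = y i.
  by rewrite -Eit /sh -PoszM (Hy.1 i) addrK.
have mon : forall v w, (forall i, v i <= w i) -> forall i, sh p q v i <= sh p q w i.
  by move=> v w vw i; rewrite /sh lerD2r.
have pyq : per p q y.
  move=> i; suff : sh p q y i = y i by rewrite /sh; lra.
  have [H|H] := isMin_order rMp r0 Hy (isMin_sh p q Hy).
    have it n : (0 < n)%N -> forall i, sh p q y i <= iter n (sh p q) y i.
      elim: n => // -[|n] IH _ l //=; apply: mon => l'.
      exact: le_trans (H l') (IH isT l').
    by apply/eqP; rewrite eq_le H andbT -[X in _ <= X]yM it.
  have it n : (0 < n)%N -> forall i, iter n (sh p q) y i <= sh p q y i.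
    elim: n => // -[|n] IH _ l //=; apply: mon => l'.
    exact: le_trans (IH isT l') (H l').
  by apply/eqP; rewrite eq_le H /= -[X in X <= _]yM it.
rewrite (En_per_mul _ _ Hx.1) (En_per A pu).
apply: (@le_trans _ _ (En S 0 (M * p) y)); last exact: Hy.2.
by rewrite (En_per_mul _ _ pyq) ler_wpM2l ?ler0n//; exact: Hx.2.
Qed.

(** The [(P, Q)]-periodic configuration that agrees with [u] on the [P] sites from [A] on. *)
Definition closing A (P : nat) Q u : int -> R :=
  fun i => u (A + ((i - A) %% P)%Z) + ((i - A) %/ P)%Z%:~R * Q%:~R.

Lemma closing_per A (P : nat) Q u : (0 < P)%N -> per P Q (closing A P Q u).
Proof.
move=> P0 i; rewrite /closing (_ : i + P - A = (i - A) + P); last by lia.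
rewrite modzDr divzDr ?dvdzz// divzz (_ : (P%:Z != 0) = true); last by lia.
by rewrite intrD /= mulrDl mul1r addrA.
Qed.

(** Among the sites read by the window, the closed-up configuration departs from [u] only at the [r]
    outer ones on either side, by the failure of [u] to be periodic there. *)
Lemma closing_energy (p : nat) q x M u A : minEx S -> (2 * r < p)%N -> (0 < r)%N ->
  (0 < M)%N -> isMin S p q x ->
  En S A (M * p) x - C1 r C * Ds (A - r%:Z) (2 * r)
      (fun i => `|sh (M * p)%N (M%:Z * q) u i - u i|)
  <= En S A (M * p) u.
Proof.
move=> mE rp r0 M0 Hx; set P := (M * p)%N; set Q := M%:Z * q.
have rP : (2 * r < P)%N by rewrite /P; nia.
have P0 : (0 < P)%N by lia.
have pc : per P Q (closing A P Q u) by exact: closing_per.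
have := isMin_mul A mE rp r0 M0 Hx pc; rewrite -/P => H1.
have := En_lip HS A P (closing A P Q u) u; rewrite ler_norml.
suff -> : Ds (A - r%:Z) (P + 2 * r) (fun i => `|closing A P Q u i - u i|) =
    Ds (A - r%:Z) (2 * r) (fun i => `|sh P Q u i - u i|) by move: H1; lra.
have clE (d : int) i : 0 <= i - A - d * P < P -> closing A P Q u i = u (i - d * P) + d%:~R * Q%:~R.
  move=> H; have E : i - A = d * P + (i - A - d * P) by lia.
  rewrite /closing E modzMDl divzMDl ?modz_small ?divz_small ?addr0; try lia.
  by congr (u _ + _); lia.
have -> : (P + 2 * r)%N = (r + (P + r))%N by lia.
have -> : (2 * r)%N = (r + r)%N by lia.
rewrite !Ds_cat subrK [Ds A P _]Ds_0 ?add0r; last first.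
  by move=> i iA; rewrite (clE 0) ?mul0r ?subr0 ?addr0 ?subrr ?normr0//; lia.
congr (_ + _).
  apply: Ds_eq => i iA; rewrite (clE (-1)) ?mulN1r; last by lia.
  by rewrite /sh opprK.
rewrite -Ds_shift; apply: Ds_eq => i iA; rewrite (clE 1); last by lia.
by rewrite /sh !mul1r addrK distrC; congr `|_|; lra.
Qed.

End Minimizers.

(** * Exchanging two configurations *)

Section Exchange.
Variable R : realType.
Implicit Types (u v w x y z : int -> R) (A i j k l P Q : int) (n m M N : nat).

(** Either the last step already grows by the factor [K], or [f] exceeds [d / K] just before it and
    the search continues there. *)
Lemma growth_step (f : nat -> R) (K d : R) n : 1 <= K -> 0 < d -> f 0 <= 0 ->
  d <= f n -> exists m, [/\ (m < n)%N, K * f m <= f m.+1 & d / K ^+ n <= f m.+1].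
Proof.
move=> K1 d0 f0; have K0 : 0 < K by lra.
elim: n d d0 => [|n IH] d d0 dn; first lra.
have [H|H] := leP (K * f n) (f n.+1).
  exists n; split => //; apply: le_trans dn.
  rewrite ler_pdivrMr ?exprn_gt0//.
  by apply: ler_peMr; [exact: ltW|exact: exprn_ege1].
have [||m [mn H1 H2]] := IH (d / K).
- by rewrite divr_gt0.
- by rewrite ler_pdivrMr// mulrC; lra.
exists m; split => //; first ilia.
by apply: le_trans H2; rewrite exprS invfM mulrA.
Qed.

Context r C al (S : int -> (int -> R) -> R) (HS : pot r C al S).

(* [4 * C1 / alpha] is the growth between neighbouring sites that the Harnack
   argument tolerates, compounded over at most [2 * r] steps. *)
Definition alpha (L : R) : R := Num.min (al (3 * L)) (C1 r C).
Definition gain (L : R) : R :=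
  alpha L ^+ 2 / (8 * C1 r C) / ((4 * C1 r C / alpha L) ^+ (2 * r)) ^+ 2.

Lemma alpha_gt0 L : 0 < alpha L.
Proof. by rewrite lt_min (pot_al0 HS) (C1_gt0 HS). Qed.

Lemma gain_gt0 L : 0 < gain L.
Proof.
have a0 := alpha_gt0 L; have C0 := C1_gt0 HS.
have K0 : 0 < 4 * C1 r C / alpha L by apply: divr_gt0 => //; apply: mulr_gt0.
rewrite /gain; apply: divr_gt0; last by do 2 apply: exprn_gt0.
by apply: divr_gt0; [exact: exprn_gt0|exact: mulr_gt0].
Qed.

(* Discrete Harnack: [ze - w] touches the near-minimizer [ze] at [b] and is far below
   it at a nearby site, so by the twist it is far from stationary somewhere in between. *)
Lemma harnack_gain A N (ze w : int -> R) e L d (b s : int) n ct :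
  (0 < r)%N -> `|s| = 1 -> 0 < d -> (n <= 2 * r)%N ->
  (forall i t, 0 <= t -> `|i - b| <= 2 * r%:Z ->
     En S A N ze - e <= En S A N (upd ze i t)) ->
  (forall i, 0 <= w i) -> w b = 0 -> d <= w (b + s * n%:Z) ->
  (forall i, `|i - b| <= 3 * r%:Z -> `|ze i - ct| <= L /\ w i <= L) ->
  A <= b - 2 * r%:Z -> b + 2 * r%:Z < A + N%:Z ->
  exists i t, [/\ `|i - b| <= 2 * r%:Z, 0 <= t &
    En S A N (upd (fun i => ze i - w i) i (- t)) <=
    En S A N (fun i => ze i - w i) - gain L * d ^+ 2 + e].
Proof.
move=> r0 s1 d0 n2r near w0 wb wd bd bA bN.
have a0 := alpha_gt0 L; have C0 := C1_gt0 HS.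
set a1 := alpha L in a0; set D := C1 r C in C0.
have aD : a1 <= D by rewrite /a1 /alpha ge_min lexx orbT.
pose K := 4 * D / a1.
have K1 : 1 <= K by rewrite /K ler_pdivlMr// mul1r; lra.
have K0 : 0 < K by lra.
have f0 : w (b + s * 0%:Z) <= 0 by rewrite mulr0 addr0 wb.
have [m [mn H1 H2]] := @growth_step (fun m => w (b + s * m%:Z)) K d n K1 d0 f0 wd.
set i := b + s * m%:Z in H1; set i' := b + s * m.+1%:Z in H1 H2.
have s12 : s = 1 \/ s = -1 by clear -s1; ilia.
have bdi : `|i - b| <= 2 * r%:Z by rewrite /i; clear -s12 mn n2r; case: s12 => ->; ilia.
have bdi' : `|i' - b| <= 2 * r%:Z by rewrite /i'; clear -s12 mn n2r; case: s12 => ->; ilia.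
have iAN : A <= i < A + N%:Z by clear -bdi bA bN; ilia.
have ii' : `|i' - i| = 1 by rewrite /i /i'; clear -s12; case: s12 => ->; ilia.
have w'L : w i' <= L by have [] := bd i' ltac:(ilia).
have w'0 : 0 <= w i' by [].
(* The twist between [i] and [i'] gains [a1 * t * w i']. Each of the costs [D * t ^ 2] and
   [D * w i * t] is at most a quarter of this, the latter because [w i'] is at least [K] times
   [w i]. *)
pose t := a1 * w i' / (4 * D).
have D4 : 0 < 4 * D by apply: mulr_gt0.
have t0 : 0 <= t by apply: divr_ge0; [apply: mulr_ge0 => //; exact: ltW|exact: ltW].
have tw : t <= w i'.
  by rewrite /t ler_pdivrMr// mulrC ler_wpM2l//; lra.
have tE : D * t = a1 * w i' / 4.
  rewrite /t; field; exact: lt0r_neq0.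
have wiE : D * w i <= a1 * w i' / 4.
  have DK : D = K * a1 / 4 by rewrite /K; field; exact: lt0r_neq0.
  have H1' : K * w i <= w i' := H1.
  by have := ler_wpM2r (ltW a0) H1'; rewrite DK; lra.
exists i, t; split => //; set G := En S A N.
have st : G (upd ze i (- w i)) - G (fun i => ze i - w i) - G (upd ze i (- (w i + t)))
    + G (upd (fun i => ze i - w i) i (- t)) <= - (al (3 * L) * (t * w i')).
  have -> : t * w i' = ((ze i - w i) - upd (fun i => ze i - w i) i (- t) i) *
      (upd ze i (- (w i + t)) i' - upd (fun i => ze i - w i) i (- t) i').
    rewrite upd_at /upd (_ : (i' == i) = false); last first.
      by apply/negP => /eqP E; move: ii'; rewrite E subrr normr0.
    by congr (_ * _); lra.
  apply: (@En_str4 _ _ _ _ _ HS _ _ _ _ _ _ _ _ _ ct) => //.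
  - move=> l _; rewrite /fourpt /upd; clear -t0 w0; case: eqP => [->|_].
      by split; try lra; right.
    by have := w0 l; split; try lra; left.
  - move=> l li; have [h1 h2] := bd l ltac:(ilia); have := w0 l.
    have := w0 i; have := w0 i'; move: h1; rewrite !ler_norml /upd => h1 q1 q2 q3.
    have [h3 h4] := bd i ltac:(ilia); move: h3; rewrite ler_norml => h3.
    by clear -h1 h2 h3 h4 q1 q2 q3 t0 tw w'L; case: eqP => [->|_]; split; lra.
(* The hypothesis [near] controls only upward changes of [ze]; the second difference along [i]
   converts the downward change into an upward one by [t]. *)
have sec : `|mixd G (upd ze i (- (w i + t))) i (w i + t) i t| <= D * ((w i + t) * t).
  by apply: (En_sec HS) => //; rewrite addr_ge0.
rewrite /mixd !upd_upd in sec.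
have E1 : - (w i + t) + (w i + t + t) = t by lra.
have E2 : - (w i + t) + (w i + t) = 0 by lra.
have E3 : - (w i + t) + t = - w i by lra.
have E4 : - (w i + t) + (w i + t) + t = t by lra.
rewrite ?E1 ?E4 ?E2 ?E3 upd0 ler_norml in sec.
have nr := near i t t0 bdi; rewrite -/G in nr.
have al1 : a1 * (t * w i') <= al (3 * L) * (t * w i').
  apply: ler_wpM2r; first exact: mulr_ge0.
  by rewrite /a1 /alpha ge_min lexx.
have gE : gain L * d ^+ 2 <= a1 * (t * w i') / 2.
  have -> : a1 * (t * w i') / 2 = a1 ^+ 2 / (8 * D) * (w i') ^+ 2.
    by rewrite /t; field; exact: lt0r_neq0.
  rewrite /gain -/a1 -/D -/K -mulrA ler_wpM2l//.
    apply: divr_ge0; first exact/exprn_ge0/ltW.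
    by apply: mulr_ge0 => //; exact: ltW.
  rewrite mulrC -expr_div_n ler_sqr ?nnegrE//; last first.
    by apply: divr_ge0; [exact: ltW|apply/exprn_ge0/ltW].
  apply: le_trans H2; apply: ler_wpM2l; first exact: ltW.
  rewrite lef_pV2 ?posrE ?exprn_gt0//.
  by rewrite ler_weXn2l.
have P1 : D * t * t = a1 * (t * w i') / 4 by rewrite tE; lra.
have P2 : D * w i * t <= a1 * (t * w i') / 4.
  have := ler_wpM2r t0 wiE; lra.
have : D * ((w i + t) * t) = D * w i * t + D * t * t by ring.
lra.
Qed.

(** The intermediate configuration [mL] splits the exchange into an exactly submodular one and an
    interaction across the seam at [c]. The latter falls under [En_cut], which makes the cost
    quadratic in the overlap. *)
Lemma cut_exchange A N (y ze : int -> R) (c : int) :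
  En S A N (fun i => if i < c then Num.min (y i) (ze i) else ze i) +
  En S A N (fun i => if i < c then Num.max (y i) (ze i) else y i) <=
  En S A N y + En S A N ze +
  C1 r C * (Ds (c - (2 * r)%:Z) (4 * r) (fun i => Num.max 0 (ze i - y i))) ^+ 2.
Proof.
pose v i := Num.max 0 (ze i - y i); rewrite -/v.
set yA := (fun i => if _ then Num.min _ _ else _).
set yB := (fun i => if _ then Num.max _ _ else _).
pose m i := Num.min (y i) (ze i).
pose mL i := if i < c then ze i else m i.
set G := En S A N.
have s1 : G yB - G y - G mL + G m <= 0.
  apply: (En_sub4 HS) => i _; rewrite /fourpt /yB /mL /m.
  by case: ltP => _; have [h|h] := leP (y i) (ze i); split; try lra; auto.
have s2 := @En_cut _ _ _ _ _ HS A N ze mL yA m c.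
have {}s2 : - (C1 r C * (Ds (c - (2 * r)%:Z) (4 * r) (fun i => `|mL i - m i|) *
    Ds (c - (2 * r)%:Z) (4 * r) (fun i => `|yA i - m i|))) <= G ze - G mL - G yA + G m.
  apply: s2.
  - move=> i _; rewrite /fourpt /yA /mL /m.
    by case: ltP => _; have [h|h] := leP (y i) (ze i); split; try lra; auto.
  - by move=> i ic; rewrite /mL ltNge ic.
  - by move=> i ic; rewrite /yA ic.
have D1 : Ds (c - (2 * r)%:Z) (4 * r) (fun i => `|mL i - m i|) <=
    Ds (c - (2 * r)%:Z) (4 * r) v.
  by apply: Ds_le => i _; rewrite /mL /v /m ler_norml; case: ltP => _; minmax.
have D2 : Ds (c - (2 * r)%:Z) (4 * r) (fun i => `|yA i - m i|) <=
    Ds (c - (2 * r)%:Z) (4 * r) v.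
  by apply: Ds_le => i _; rewrite /yA /v /m ler_norml; case: ltP => _; minmax.
have : C1 r C * (Ds (c - (2 * r)%:Z) (4 * r) (fun i => `|mL i - m i|) *
    Ds (c - (2 * r)%:Z) (4 * r) (fun i => `|yA i - m i|)) <=
    C1 r C * (Ds (c - (2 * r)%:Z) (4 * r) v) ^+ 2.
  rewrite ler_wpM2l ?(ltW (C1_gt0 HS))// expr2 ler_pM//; exact: Ds_ge0.
lra.
Qed.

(* Either [ze - y] is small in one of the windows around [n * p], and one may cut
   there, or the gains of the [a] windows together pay for a cut anywhere. *)
Lemma left_exchange A N (y ze : int -> R) (p a : nat) e L d0 kap :
  (0 < r)%N -> (5 * r < p)%N -> 0 < d0 ->
  (forall i t, 0 <= t -> A + r%:Z <= i < A + N%:Z - r%:Z ->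
     En S A N ze - e <= En S A N (upd ze i t)) ->
  (forall n, (n <= a)%N -> ze (n * p)%N <= y (n * p)%N) ->
  (forall n, (n <= a)%N -> forall i, `|i - (n * p)%N%:Z| <= 3 * r%:Z ->
     `|ze i - ze (n * p)%N| <= L /\ ze i - y i <= L) ->
  A <= - (3 * r%:Z) -> (a * p)%N%:Z + 3 * r%:Z < A + N%:Z ->
  C1 r C * d0 ^+ 2 <= kap ->
  e <= gain L * (d0 / (4 * r)%:R) ^+ 2 / 2 ->
  C1 r C * ((4 * r)%:R * L) ^+ 2 <= a%:R * (gain L * (d0 / (4 * r)%:R) ^+ 2 / 2) ->
  exists yA yB : int -> R,
   [/\ (forall i, i < - (2 * r%:Z) -> yA i = Num.min (y i) (ze i)),
       (forall i, (a * p)%N%:Z <= i -> yA i = ze i),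
       (forall i, i < 0 -> yB i = Num.max (y i) (ze i)),
       (forall i, y i <= yB i <= Num.max (y i) (ze i)) &
       (forall i, (a * p)%N%:Z <= i -> yB i = y i) /\
       En S A N yA + En S A N yB <= En S A N y + En S A N ze + kap].
Proof.
move=> r0 rp d00 near ord bd bA bN Hkap He Ha.
pose v i := Num.max 0 (ze i - y i).
have v0 i : 0 <= v i by rewrite le_max lexx.
set G := En S A N in near *.
have C0 := C1_gt0 HS.
have r40 : 0 < (4 * r)%:R :> R by rewrite ltr0n; ilia.
have [[n [na Hn]]|Hall] := pselect (exists n, (n <= a)%N /\
    Ds ((n * p)%N%:Z - (2 * r)%:Z) (4 * r) v <= d0).
  exists (fun i => if i < (n * p)%N then Num.min (y i) (ze i) else ze i).
  exists (fun i => if i < (n * p)%N then Num.max (y i) (ze i) else y i).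
  have nap : (n * p <= a * p)%N by rewrite leq_mul2r na orbT.
  split.
  - by move=> i ir; rewrite ifT//; ilia.
  - by move=> i ir; rewrite ifF//; ilia.
  - by move=> i ir; rewrite ifT//; ilia.
  - by move=> i; case: ifP => _; clear; minmax.
  split; first by move=> i ir; rewrite ifF//; ilia.
  apply: le_trans (cut_exchange A N y ze (n * p)%N) _; rewrite lerD2l.
  apply: le_trans Hkap; rewrite ler_wpM2l ?(ltW C0)// ler_sqr ?nnegrE//; last exact: ltW.
  by apply: Ds_ge0 => i _; exact: v0.
have {}Hall n : (n <= a)%N -> d0 < Ds ((n * p)%N%:Z - (2 * r)%:Z) (4 * r) v.
  by move=> na; rewrite ltNge; apply/negP => H; apply: Hall; exists n.
set c : int := (a * p)%N.
pose v1 i := if i < c then v i else 0.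
pose yB i := if i < c then Num.max (y i) (ze i) else y i.
have cut := cut_exchange A N y ze c; rewrite -/v -/yB -/G in cut.
have yAE : (fun i => if i < c then Num.min (y i) (ze i) else ze i) =
    (fun i => ze i - v1 i).
  apply/funext => i; rewrite /v1 /v; case: ifP => _; last by lra.
  by minmax.
rewrite yAE in cut.
have L0 : 0 <= L by have [] := bd 0%N (leq0n _) 0 ltac:(ilia); have := normr_ge0 (ze 0 - ze (0 * p)%N); lra.
have cutL : Ds (c - (2 * r)%:Z) (4 * r) v <= (4 * r)%:R * L.
  rewrite -(Ds_cst (c - (2 * r)%:Z)); apply: Ds_le => i ic.
  have [_ h] := bd a (leqnn _) i ltac:(rewrite -/c; ilia).
  by rewrite /v ge_max L0 h.
(* Window [a] is reserved for the cut, and each of the others receives one lowering. Since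
   [5 * r < p], changes within [2 * r] of one centre do not reach within [3 * r] of the next, so the
   gains add up. *)
have iter n : (n <= a)%N -> exists w, [/\ forall i, v1 i <= w i,
    (forall i, w i != v1 i -> exists2 m, (m < n)%N & `|i - (m * p)%N%:Z| <= 2 * r%:Z) &
    G (fun i => ze i - w i) <= G (fun i => ze i - v1 i) -
       n%:R * (gain L * (d0 / (4 * r)%:R) ^+ 2 / 2)].
  elim: n => [_|n IH na].
    exists v1; split => // [i|]; first by rewrite eqxx.
    by rewrite mul0r subr0.
  have [w [w1 w2 w3]] := IH (ltnW na).
  have nap : ((n + 1) * p <= a * p)%N by rewrite leq_mul2r; ilia.
  have wv i : `|i - (n * p)%N%:Z| <= 3 * r%:Z -> w i = v i.
    move=> inp; have v1i : v1 i = v i by rewrite /v1 /c ifT//; ilia.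
    rewrite -v1i; apply/eqP/negPn/negP => /w2[m mn imp].
    have : ((m + 1) * p <= n * p)%N by rewrite leq_mul2r; ilia.
    by ilia.
  have [i [inp vi]] : exists i, `|i - (n * p)%N%:Z| <= 2 * r%:Z /\ d0 / (4 * r)%:R <= v i.
    apply: contrapT => H; have := Hall n (ltnW na); apply/negP; rewrite -leNgt.
    have -> : d0 = (4 * r)%:R * (d0 / (4 * r)%:R) by rewrite mulrCA divff ?mulr1// lt0r_neq0.
    rewrite -(Ds_cst ((n * p)%N%:Z - (2 * r)%:Z)); apply: Ds_le => i iw; apply/ltW.
    by rewrite ltNge; apply/negP => Hi; apply: H; exists i; split => //; ilia.
  have [s [k [s1 k2 Ei]]] : exists (s : int) (k : nat),
      [/\ `|s| = 1, (k <= 2 * r)%N & i = (n * p)%N%:Z + s * k%:Z].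
    have [h|h] := leP (n * p)%N%:Z i.
      by exists 1, (absz (i - (n * p)%N%:Z)%R); split => //; ilia.
    by exists (-1), (absz ((n * p)%N%:Z - i)%R); split => //; ilia.
  have wi0 j : 0 <= w j by apply: le_trans (w1 j); rewrite /v1; case: ifP.
  have [|||||||j [t [jn t0 Hg]]] := @harnack_gain A N ze w e L (d0 / (4 * r)%:R)
     (n * p)%N s k (ze (n * p)%N) r0 s1 _ k2 _ wi0.
  - by rewrite divr_gt0.
  - by move=> l t t0 ln; apply: near => //; ilia.
  - rewrite wv; last by ilia.
    by rewrite /v; apply/max_idPl; have := ord n (ltnW na); lra.
  - by rewrite -Ei wv//; ilia.
  - move=> l ln; have [h1 h2] := bd n (ltnW na) l ln; split => //.
    by rewrite wv// /v ge_max L0 h2.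
  - ilia.
  - by move: nap; ilia.
  exists (fun l => if l == j then w l + t else w l); split.
  - by move=> l; case: eqP => _; have := w1 l; lra.
  - move=> l; case: (l =P j) => [->|_]; first by exists n.
    by move=> /w2[m mn lm]; exists m => //; ilia.
  - have -> : (fun l => ze l - (if l == j then w l + t else w l)) =
        upd (fun i => ze i - w i) j (- t).
      by apply/funext => l; rewrite /upd; case: eqP => _; lra.
    by apply: le_trans Hg _; rewrite -/G -natr1; lra.
have [w [w1 w2 w3]] := iter a (leqnn _).
exists (fun i => ze i - w i), yB; split.
- move=> i ir; suff -> : w i = v1 i.
    by rewrite -[LHS]/((fun i => ze i - v1 i) i) -yAE ifT//; ilia.
  by apply/eqP/negPn/negP => /w2[m mn im]; ilia.
- move=> i ir; suff -> : w i = v1 i by rewrite /v1 ifF ?subr0//; ilia.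
  apply/eqP/negPn/negP => /w2[m mn im].
  have : ((m + 1) * p <= a * p)%N by rewrite leq_mul2r; ilia.
  by move: ir; rewrite /c; ilia.
- by move=> i i0; rewrite /yB ifT//; ilia.
- by move=> i; rewrite /yB; case: ifP => _; clear; minmax.
split; first by move=> i ic; rewrite /yB ifF//; ilia.
have : C1 r C * (Ds (c - (2 * r)%:Z) (4 * r) v) ^+ 2 <= C1 r C * ((4 * r)%:R * L) ^+ 2.
  rewrite ler_wpM2l ?(ltW C0)// ler_sqr ?nnegrE//; first by apply: Ds_ge0 => i _; exact: v0.
  by rewrite mulr_ge0// ltW.
have : 0 <= kap by apply: le_trans Hkap; rewrite mulr_ge0 ?exprn_ge0 ?ltW.
rewrite -/G; lra.
Qed.

End Exchange.

(** * Crossings from [x] to [x + 1] *)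

Section SitePotential.
Variable R : realType.
Implicit Types (u v w x y z : int -> R) (A i j k l P Q : int) (n m M N : nat).
Implicit Types (S : int -> (int -> R) -> R) (V : R -> R).

Record sitepot V : Prop := SitePotential {
  site_ge0 : forall t, 0 <= V t;
  site_per : forall t, V (t + 1) = V t;
  site_lip : forall s t, `|V s - V t| <= `|s - t|;
  site_sec : forall t a b, 0 <= a -> 0 <= b ->
    `|V (t + a + b) - V (t + a) - V (t + b) + V t| <= a * b }.

Definition addV V S : int -> (int -> R) -> R := fun j u => S j u + V (u j).

Lemma site_perz V t (l : int) : sitepot V -> V (t + l%:~R) = V t.
Proof.
move=> HV; apply: (@int_two_sided_ind (fun l => V (t + l%:~R) = V t) 0).
- by rewrite addr0.
- by move=> i <-; rewrite -[RHS](site_per HV) intrD addrA.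
- by move=> i <-; rewrite -[LHS](site_per HV) -addrA -(intrD _ (i - 1) 1) subrK.
Qed.

Lemma pot_addV r C al S V : pot r C al S -> sitepot V -> pot r (C + 1) al (addV V S).
Proof.
move=> HS HV; have C0 := pot_C0 HS; rewrite /addV; split.
- by move=> j x y H; rewrite (pot_loc HS H) H// subrr normr0.
- move=> j k l x; rewrite -(pot_eqv HS) /shift_seq addrK.
  by rewrite (site_perz (x j) l HV).
- lra.
- move=> j x i t; rewrite opprD addrACA mulrDl mul1r.
  apply: le_trans (ler_normD _ _) _; rewrite lerD ?(pot_lip HS)//.
  apply: le_trans (site_lip HV _ _) _; rewrite /upd; case: eqP => _; last by rewrite subrr normr0.
  by rewrite addrAC subrr add0r.
- move=> j x i k s t ik s0 t0; have := pot_mix HS j x ik s0 t0; rewrite /mixd.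
  have : V (upd (upd x i s) k t j) - V (upd x i s j) - V (upd x k t j) + V (x j) = 0.
    rewrite /upd; case: (j =P k) => [->|_]; case: eqP => [ki|_]; try lra.
    by rewrite ki eqxx in ik.
  have : 0 <= s * t by rewrite mulr_ge0.
  lra.
- move=> j x i s t s0 t0; have := pot_sec HS j x i s0 t0; rewrite /mixd.
  have : `|V (upd (upd x i s) i t j) - V (upd x i s j) - V (upd x i t j) + V (x j)| <= s * t.
    rewrite /upd; case: eqP => [->|_]; first exact: site_sec.
    by rewrite (_ : _ + V (x j) = 0) ?normr0 ?mulr_ge0//; lra.
  rewrite !ler_norml; lra.
- exact: pot_al0 HS.
- move=> L j k c x s t kj s0 t0 H; have := pot_str HS kj s0 t0 H; rewrite /mixd.
  have kj' : (k == j) = false by apply/negP => /eqP; ilia.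
  have : V (upd (upd x j s) k t j) - V (upd x j s j) - V (upd x k t j) + V (x j) = 0.
    by rewrite /upd eq_sym kj' eqxx; lra.
  lra.
Qed.

Lemma En_addV S V A N u :
  En (addV V S) A N u = En S A N u + Ds A N (fun i => V (u i)).
Proof. exact: DsD. Qed.

Lemma En_addV_ge S V A N u : sitepot V -> En S A N u <= En (addV V S) A N u.
Proof.
by move=> HV; rewrite En_addV lerDl; apply: Ds_ge0 => i _; exact: site_ge0.
Qed.

End SitePotential.

Section Crossing.
Variable R : realType.
Implicit Types (u v w x y z : int -> R) (A i j k l P Q : int) (n m M N : nat).

Context r C al (S : int -> (int -> R) -> R) (HS : pot r C al S) (mE : minEx S).
Context (r0 : (0 < r)%N) (p : nat) (q : int) (x : int -> R).
Context (rp : (2 * r < p)%N) (Hx : isMin S p q x).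
Context (V : R -> R) (HV : sitepot V) (Vx : forall i, V (x i) = 0).

Let S1 := addV V S.
Let HS1 : pot r (C + 1) al S1 := pot_addV HS HV.
Let px : per p q x := Hx.1.

(** The transition ends [r] sites inside the window, so that every potential outside it reads [x] or
    [x + 1] only; by [crossing_ext] the relative energy [Fe] does not change when the window
    grows. *)
Definition crossing A M u : Prop :=
  (forall i, i < A + r%:Z -> u i = x i) /\
  (forall i, A + (M * p)%N%:Z - r%:Z <= i -> u i = x i + 1).

Definition Fe (T : int -> (int -> R) -> R) A M u : R :=
  En T A (M * p) u - En T A (M * p) x.

Lemma En_addVx A N : En (addV V S) A N x = En S A N x.
Proof. by rewrite En_addV Ds_0 ?addr0. Qed.

Lemma pot_x1 T C' j : pot r C' al T -> T j (fun i => x i + 1) = T j x.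
Proof.
move=> HT; have := pot_sh HT j 0 (-1) x; rewrite addr0 => <-.
by congr (T j _); apply/funext => i; rewrite /sh addr0 opprK.
Qed.

Lemma crossing_ext T C' A M A' M' u : pot r C' al T -> crossing A M u -> A' <= A ->
  A + (M * p)%N%:Z <= A' + (M' * p)%N%:Z ->
  crossing A' M' u /\ Fe T A' M' u = Fe T A M u.
Proof.
move=> HT [c1 c2] h1 h2; split.
  by split=> i ii; [apply: c1|apply: c2]; ilia.
rewrite /Fe /En !(Ds_split _ h1 h2); set n1 := absz _; set n := absz _.
have -> : Ds A' n1 (T^~ u) = Ds A' n1 (T^~ x).
  apply: Ds_eq => j jA; apply: pot_loc HT _ _ _ _ => i ij; apply: c1.
  by move: jA; rewrite /n1; ilia.
set B := A + (M * p)%N%:Z.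
have -> : Ds B n (T^~ u) = Ds B n (T^~ x); last by lra.
apply: Ds_eq => j jA; rewrite -(pot_x1 j HT); apply: pot_loc HT _ _ _ _ => i ij.
by apply: c2; move: jA; rewrite /B; ilia.
Qed.

Lemma sh_iter_x n i : sh (n%:Z * p) (n%:Z * q) x i = x i.
Proof. by rewrite /sh (per_mul n px) addrK. Qed.

Lemma sh_mul_x M i : sh (M * p)%N (M%:Z * q) x i = x i.
Proof. by rewrite -[RHS](sh_iter_x M) -PoszM. Qed.

Lemma periodic_ge A M u : (0 < M)%N ->
  (forall i, A - r%:Z <= i < A + r%:Z -> sh (M * p)%N (M%:Z * q) u i = u i) ->
  En S1 A (M * p) x <= En S1 A (M * p) u.
Proof.
move=> M0 H; rewrite {1}/S1 En_addVx; apply: le_trans (En_addV_ge _ _ _ _ HV).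
have := closing_energy HS u A mE rp r0 M0 Hx; rewrite Ds_0 ?mulr0 ?subr0//.
by move=> i ii; rewrite H ?subrr ?normr0//; ilia.
Qed.

(** Closing [u] up is off by exactly 1 at each of the [2 * r] seam sites, as [u] has risen from [x]
    to [x + 1]. One period is added to the window because [closing_energy] asks for a positive
    number of them. *)
Lemma crossing_ge T C' A M u : pot r C' al T -> (forall A N v, En S A N v <= En T A N v) ->
  (forall A N, En T A N x = En S A N x) ->
  crossing A M u -> - (C1 r C * (2 * r)%:R) <= Fe T A M u.
Proof.
move=> HT ST Tx c.
have [c' <-] := @crossing_ext T C' A M A M.+1 u HT c (lexx _) ltac:(ilia).
rewrite /Fe Tx; have := closing_energy HS u A mE rp r0 (ltn0Sn M) Hx.
have -> : Ds (A - r%:Z) (2 * r)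
    (fun i => `|sh (M.+1 * p)%N (M.+1%:Z * q) u i - u i|) = (2 * r)%:R.
  rewrite -[RHS]mulr1 -(Ds_cst (A - r%:Z)); apply: Ds_eq => i ii.
  rewrite {1}/sh c'.2; last by ilia.
  rewrite c'.1; last by ilia.
  have := sh_mul_x M.+1 i; rewrite /sh => E.
  rewrite (_ : _ - x i = 1) ?normr1//; lra.
by have := ST A (M.+1 * p)%N u; lra.
Qed.

Definition crossvals : set R :=
  [set v | exists A M u, crossing A M u /\ v = Fe S1 A M u].

(* Near-minimal crossings play the role of the heteroclinic minimizers: only
   infima are used, so no compactness at infinity is needed. *)
Definition Estar : R := inf crossvals.

Definition jump : int -> R := fun i => if i < 0 then x i else x i + 1.

Lemma crossing_jump : crossing (- p%:Z) 2 jump.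
Proof.
split=> i ii; rewrite /jump; first by rewrite ifT//; ilia.
by rewrite ifF//; ilia.
Qed.

Lemma Fe_jump : Fe S1 (- p%:Z) 2 jump <= C1 r (C + 1) * (6 * r)%:R.
Proof.
have -> : Fe S1 (- p%:Z) 2 jump = En S1 (- (2 * r)%:Z) (4 * r) jump - En S1 (- (2 * r)%:Z) (4 * r) x.
  have h1 : - p%:Z <= - (2 * r)%:Z by ilia.
  have h2 : - (2 * r)%:Z + (4 * r)%:Z <= - p%:Z + (2 * p)%N%:Z by ilia.
  rewrite /Fe /En !(Ds_split _ h1 h2); set n1 := absz _; set n2 := absz _.
  have -> : Ds (- p%:Z) n1 (S1^~ jump) = Ds (- p%:Z) n1 (S1^~ x).
    apply: Ds_eq => j jA; apply: pot_loc HS1 _ _ _ _ => i ij; rewrite /jump ifT//.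
    by move: jA; rewrite /n1; ilia.
  set B := - (2 * r)%:Z + _.
  have -> : Ds B n2 (S1^~ jump) = Ds B n2 (S1^~ x); last by lra.
  apply: Ds_eq => j jA; rewrite -(pot_x1 j HS1); apply: pot_loc HS1 _ _ _ _ => i ij.
  by rewrite /jump ifF//; move: jA; rewrite /B; ilia.
apply: le_trans (ler_norm _) _; apply: le_trans (En_lip HS1 _ _ _ _) _.
rewrite ler_wpM2l ?(ltW (C1_gt0 HS1))//.
have -> : (6 * r)%N = (4 * r + 2 * r)%N by ilia.
rewrite -[leRHS]mulr1 -(Ds_cst (- (2 * r)%:Z - r%:Z)); apply: Ds_le => i _.
rewrite /jump; case: ifP => _; rewrite ?subrr ?normr0//.
by rewrite addrAC subrr add0r normr1.
Qed.

Lemma has_inf_crossvals : has_inf crossvals.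
Proof.
split; first by exists (Fe S1 (- p%:Z) 2 jump), (- p%:Z), 2%N, jump; split => //; exact: crossing_jump.
exists (- (C1 r C * (2 * r)%:R)) => _ [A [M [u [c ->]]]].
apply: crossing_ge HS1 _ _ c => [? ? ?|]; first exact: En_addV_ge.
exact: En_addVx.
Qed.

Lemma Estar_le A M u : crossing A M u -> Estar <= Fe S1 A M u.
Proof. by move=> c; apply: (ge_inf has_inf_crossvals.2); exists A, M, u. Qed.

Lemma Estar_ub : Estar <= C1 r (C + 1) * (6 * r)%:R.
Proof. exact: le_trans (Estar_le crossing_jump) Fe_jump. Qed.

Definition clamped u : Prop := forall i, x i <= u i <= x i + 1.

(** The parts cut off, [max u (x + 1)] and [min v x], agree with a translate of [x] at both ends, so
    [periodic_ge] shows that they do no better than [x]. By submodularity the clamped crossing does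
    no worse than [u]. *)
Lemma clamp_exists A M u : (0 < M)%N -> crossing A M u ->
  exists v, [/\ crossing A M v, clamped v & Fe S1 A M v <= Fe S1 A M u].
Proof.
move=> M0 [c1 c2].
pose v i := Num.min (u i) (x i + 1).
exists (fun i => Num.max (v i) (x i)); split.
- split=> i ii; rewrite /v.
    by rewrite c1//; minmax.
  by rewrite c2//; minmax.
- by move=> i; rewrite /v; minmax.
have m1 := En_minmax HS1 A (M * p) u (fun i => x i + 1).
have m2 := En_minmax HS1 A (M * p) v x.
have x1 : En S1 A (M * p) (fun i => x i + 1) = En S1 A (M * p) x.
  by apply: Ds_eq => j _; exact: pot_x1 HS1.
have h i : x i = x (i + (M * p)%N) - (M%:Z * q)%:~R by rewrite -[LHS](sh_mul_x M).
have g1 : En S1 A (M * p) x <= En S1 A (M * p) (fun i => Num.max (u i) (x i + 1)).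
  apply: periodic_ge => // i ii; rewrite /sh c2; last by ilia.
  rewrite c1; last by ilia.
  by have := h i; minmax.
have g2 : En S1 A (M * p) x <= En S1 A (M * p) (fun i => Num.min (v i) (x i)).
  apply: periodic_ge => // i ii; rewrite /sh /v c2; last by ilia.
  rewrite c1; last by ilia.
  by have := h i; minmax.
rewrite /Fe; move: m1 m2; rewrite -/v; lra.
Qed.

(** The minimum of [w] and its shifts by up to [M'] periods is monotone, since one more shift has
    left the window. Each minimum loses at most [e']: the maximum set aside is, once shifted back,
    again a crossing of the same window. *)
Lemma crossing_monotone e : 0 < e -> exists A M z,
  [/\ crossing A M z, clamped z, forall i, z i <= sh p q z i &
      Fe S1 A M z <= Estar + e].
Proof.
move=> e0; have e2 : 0 < e / 2 by lra.
have [_ [A [M [u [c ->]]]]] := inf_adherent e2 has_inf_crossvals.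
rewrite -/Estar => Hu.
have [c' Ee] := @crossing_ext S1 _ A M A M.+1 u HS1 c (lexx _) ltac:(ilia).
rewrite -Ee in Hu; move: c' Hu; set M' := M.+1 => {c Ee}c Hu.
have [v [cv bv Hv]] := clamp_exists (ltn0Sn M) c.
(* The window comes before the tolerance: [e'] depends on the number of shifts, that is on [M'], so
   [w] is taken nearly optimal among the crossings of this fixed window. *)
pose K := [set t | exists u, [/\ crossing A M' u, clamped u & t = Fe S1 A M' u]].
have KI : has_inf K.
  split; first by exists (Fe S1 A M' v), v.
  by exists Estar => _ [w [cw bw ->]]; exact: Estar_le.
pose e' := e / 2 / M'.+1%:R.
have e'0 : 0 < e' by rewrite divr_gt0 ?ltr0n.
have [_ [w [cw bw ->]] Hw] := inf_adherent e'0 KI.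
have infK : inf K <= Estar + e / 2.
  by apply: le_trans (ge_inf KI.2 (ex_intro _ v (And3 cv bv erefl))) _; lra.
pose sw n := sh (n%:Z * p) (n%:Z * q) w.
have sw_bd n i : x i <= sw n i <= x i + 1.
  have := bw (i + n%:Z * p); have := sh_iter_x n i; rewrite /sw /sh; lra.
pose W := fix W n := if n is n'.+1 then fun i => Num.min (W n' i) (sw n'.+1 i) else w.
have W_le n m i : (m <= n)%N -> W n i <= sw m i.
  elim: n => [|n IH].
    rewrite leqn0 => /eqP ->; rewrite /sw /sh !mul0r addr0 subr0//.
  rewrite leq_eqVlt => /orP[/eqP ->|mn] /=; rewrite ge_min ?lexx ?orbT//.
  by rewrite IH.
have W_ge n i t : (forall m, (m <= n)%N -> t <= sw m i) -> t <= W n i.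
  elim: n => [|n IH] H.
    by have := H 0%N (leqnn _); rewrite /sw /sh !mul0r addr0 subr0.
  by rewrite /= le_min H// andbT; apply: IH => m mn; apply: H; ilia.
have W_bd n i : x i <= W n i <= x i + 1.
  apply/andP; split; first by apply: W_ge => m _; have := sw_bd m i; lra.
  by have := W_le n 0%N i (leq0n _); have := sw_bd 0%N i; lra.
have W_cross n : crossing A M' (W n).
  split=> i ii.
    apply/eqP; rewrite eq_le; have /andP[-> _] := W_bd n i; rewrite andbT.
    apply: le_trans (W_le n 0%N i (leq0n _)) _.
    by rewrite /sw /sh !mul0r addr0 subr0 cw.1.
  apply/eqP; rewrite eq_le; have /andP[_ ->] /= := W_bd n i.
  apply: W_ge => m _; have := sh_iter_x m i; rewrite /sw /sh cw.2; last by ilia.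
  lra.
have W_Fe n : Fe S1 A M' (W n) <= inf K + n.+1%:R * e'.
  elim: n => [|n IH]; first by rewrite mul1r; exact: ltW.
  pose A' := A - n.+1%:Z * p; pose N' := (M' + n.+1)%N.
  have NE : (N' * p)%N%:Z = (M' * p)%N%:Z + n.+1%:Z * p by rewrite /N'; ilia.
  have ext u' : crossing A M' u' -> Fe S1 A' N' u' = Fe S1 A M' u'.
    move=> cu; have [] := @crossing_ext S1 _ A M' A' N' u' HS1 cu => //; rewrite /A'; ilia.
  have shx : sh (n.+1%:Z * p) (n.+1%:Z * q) x = x by apply/funext => i; exact: sh_iter_x.
  have extr u' : crossing A M' u' -> Fe S1 A' N' (sh (n.+1%:Z * p) (n.+1%:Z * q) u') = Fe S1 A M' u'.
    move=> cu; rewrite /Fe -[in X in _ - X]shx !(En_sh HS1).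
    rewrite (_ : A' + n.+1%:Z * p = A); last by rewrite /A'; ilia.
    by have [_] := @crossing_ext S1 _ A M' A N' u' HS1 cu (lexx _) ltac:(ilia).
  have mm := En_minmax HS1 A' (N' * p) (W n) (sw n.+1).
  pose mx i := Num.max (W n i) (sw n.+1 i).
  pose mx' := sh (- (n.+1%:Z * p)) (- (n.+1%:Z * q)) mx.
  have mxE : mx = sh (n.+1%:Z * p) (n.+1%:Z * q) mx'.
    by apply/funext => i; rewrite /mx' /sh addrK intrN; lra.
  have xm i : sh (- (n.+1%:Z * p)) (- (n.+1%:Z * q)) x i = x i.
    by have := sh_iter_x n.+1 (i - n.+1%:Z * p); rewrite /sh subrK intrN; lra.
  have bmx i : x i <= mx i <= x i + 1.
    by rewrite /mx le_max ge_max; have /andP[-> ->] := W_bd n i; have /andP[_ ->] := sw_bd n.+1 i.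
  have mcross : crossing A M' mx'.
    split=> i ii; rewrite -(xm i) /mx' /sh; set i' := i - _.
      congr (_ - _); rewrite /mx (W_cross n).1; last by rewrite /i'; ilia.
      apply/max_idPl; rewrite /sw /sh /i' subrK cw.1//.
      by have := xm i; rewrite /sh intrN; lra.
    suff : mx i' = x i' + 1 by lra.
    apply/eqP; rewrite eq_le; have /andP[_ ->] /= := bmx i'.
    rewrite /mx le_max; apply/orP; right; rewrite /sw /sh /i' subrK cw.2//.
    by have := xm i; rewrite /sh intrN; lra.
  have mclamp : clamped mx'.
    move=> i; have := bmx (i - n.+1%:Z * p); have := xm i; rewrite /mx' /sh intrN; lra.
  have Kmx : inf K <= Fe S1 A M' mx' by apply: (ge_inf KI.2); exists mx'.
  have := ext _ (W_cross n.+1); have := ext _ (W_cross n); have := extr _ mcross.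
  have := extr _ cw; rewrite -mxE -/(sw n.+1) /Fe => h1 h2 h3 h4.
  move: mm IH Hw Kmx; rewrite -/mx -[X in En S1 A' _ X + _]/(W n.+1) /Fe.
  rewrite -[n.+2%:R]natr1; lra.
exists A, M', (W M'); split => //.
  move=> i; rewrite [X in _ <= X]/sh.
  have E m : sw m (i + p) - q%:~R = sw m.+1 i.
    rewrite /sw /sh (_ : i + p + m%:Z * p = i + m.+1%:Z * p); last by ilia.
    by rewrite -addrA -opprD -intrD; congr (_ - _%:~R); ilia.
  suff : W M' i + q%:~R <= W M' (i + p) by lra.
  apply: W_ge => m mM; suff : W M' i <= sw m.+1 i by rewrite -E; lra.
  have [mM'|mM'] := leqP m.+1 M'; first exact: W_le.
  have {mM mM'}-> : m = M' by ilia.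
  have [iA|iA] := leP (A + (M' * p)%N%:Z - r%:Z) (i + M'.+1%:Z * p).
    have := sh_iter_x M'.+1 i; rewrite /sw {2}/sh cw.2// /sh; have := W_bd M' i; lra.
  rewrite (W_cross M').1; first by have := sw_bd M'.+1 i; lra.
  by move: iA; ilia.
have := W_Fe M'; rewrite (_ : M'.+1%:R * e' = e / 2); first by lra.
by rewrite /e' mulrC divfK// pnatr_eq0.
Qed.

(** [Estar_ub] bounds the energy with [V] from above and [crossing_ge] the one without [V] from
    below; the difference is the total charge, bounded independently of [p]. *)
Lemma crossing_visits A M z e : crossing A M z -> Fe S1 A M z <= Estar + e ->
  Ds A (M * p) (fun i => V (z i)) <= C1 r (C + 1) * (8 * r)%:R + e.
Proof.
move=> c H; have := Estar_ub.
have := crossing_ge HS (fun _ _ _ => lexx _) (fun _ _ => erefl) c.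
move: H; rewrite /Fe /S1 En_addVx En_addV.
have : C1 r C * (2 * r)%:R <= C1 r (C + 1) * (2 * r)%:R.
  by rewrite ler_wpM2r ?ler0n// /C1 ler_wpM2r ?ler0n//; lra.
rewrite (_ : (8 * r)%:R = (6 * r)%:R + (2 * r)%:R :> R); last by rewrite -natrD; congr _%:R; ilia.
lra.
Qed.

End Crossing.

(** * Reflections *)

Section Flip.
Variable R : realType.
Implicit Types (u v w x y z : int -> R) (A i j k l P Q : int) (n m M N : nat).

(** For [s = -1] the rotation number is kept, while left and right as well as minimum and maximum
    change roles; for [s = 1] the rotation number changes sign. *)
Definition flip (s : int) u : int -> R := fun i => - u (s * i).
Definition flipS (s : int) (S : int -> (int -> R) -> R) : int -> (int -> R) -> R :=
  fun j u => S (s * j) (flip s u).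

Lemma flipK (s : int) u : s * s = 1 -> flip s (flip s u) = u.
Proof. by move=> ss; apply/funext => i; rewrite /flip mulrA ss mul1r opprK. Qed.

Lemma flip_upd (s : int) u i t : s * s = 1 ->
  flip s (upd u i t) = upd (flip s u) (s * i) (- t).
Proof.
move=> ss; apply/funext => j; rewrite /flip /upd.
have -> : (s * j == i) = (j == s * i).
  by apply/eqP/eqP => [<-|->]; rewrite mulrA ss mul1r.
by case: eqP => _; rewrite ?opprD.
Qed.

Lemma pot_flip (s : int) r C al S : s * s = 1 -> pot r C al S -> pot r C al (flipS s S).
Proof.
move=> ss HS.
have s12 : s = 1 \/ s = -1 by nia.
have sd i j : `|s * i - s * j| = `|i - j| by clear -s12; case: s12 => ->; lia.
have e1 u i j (a b : R) : upd (upd (upd u i (- a)) j (- b)) i a = upd u j (- b).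
  by rewrite (updC u) upd_upd addNr upd0.
have e2 u i j (a b : R) : upd (upd (upd u i (- a)) j (- b)) j b = upd u i (- a).
  by rewrite upd_upd addNr upd0.
have e3 u j (b : R) : upd (upd u j (- b)) j b = u by rewrite upd_upd addNr upd0.
split.
- move=> j x y H; apply: (pot_loc HS) => i ij; rewrite /flip H//.
  by rewrite -sd mulrA ss mul1r.
- move=> j k l x; rewrite /flipS (pot_eqv HS _ (s * k) (- l)) -mulrDr.
  congr (S _ _); apply/funext => i; rewrite /flip /shift_seq mulrBr mulrA ss mul1r.
  by rewrite opprD intrN.
- exact: pot_C0 HS.
- move=> j x i t; rewrite /flipS flip_upd//.
  by have := pot_lip HS (s * j) (flip s x) (s * i) (- t); rewrite normrN.
- move=> j x i k a b ik a0 b0.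
  have sik : s * i != s * k by apply: contra ik => /eqP E; apply/eqP; case: s12 E => ->; lia.
  have := pot_mix HS (s * j) (upd (upd (flip s x) (s * i) (- a)) (s * k) (- b)) sik a0 b0.
  by rewrite /mixd /flipS !flip_upd// e1 e2 e3; lra.
- move=> j x i a b a0 b0.
  have := pot_sec HS (s * j) (upd (flip s x) (s * i) (- a - b)) (s * i) a0 b0.
  rewrite /mixd /flipS !flip_upd// !upd_upd.
  have E1 : - a - b + (a + b) = 0 by lra.
  have E2 : - a - b + a + b = 0 by lra.
  have E3 : - a - b + a = - b by lra.
  have E4 : - a - b + b = - a by lra.
  by rewrite ?E1 ?E2 ?E3 ?E4 ?upd0 !ler_norml; lra.
- exact: pot_al0 HS.
- move=> L j k c x a b kj a0 b0 H.
  have skj : `|s * k - s * j| = 1 by rewrite sd.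
  have := @pot_str _ _ _ _ _ HS L (s * j) (s * k) (- c)
    (upd (upd (flip s x) (s * j) (- a)) (s * k) (- b)) a b skj a0 b0.
  rewrite e1 e3.
  have E : upd (upd (flip s x) (s * j) (- a)) (s * k) (- b) = flip s (upd (upd x j a) k b).
    by rewrite !flip_upd.
  have H' i : `|i - s * j| <= r%:Z ->
     `|upd (upd (flip s x) (s * j) (- a)) (s * k) (- b) i - - c| <= L /\ `|flip s x i - - c| <= L.
    move=> ij; rewrite E /flip -!opprD !normrN.
    have /H[] : `|s * i - j| <= r%:Z by rewrite -sd mulrA ss mul1r.
    by split.
  by move=> /(_ H'); rewrite /mixd /flipS !flip_upd// e1 e2 e3; lra.
Qed.

Lemma Ds_rev A N (f : int -> R) : Ds A N (fun j => f (- j)) = Ds (1 - A - N%:Z) N f.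
Proof.
rewrite /Ds (reindex_inj rev_ord_inj) /=; apply: eq_bigr => i _; congr f.
have := ltn_ord i; lia.
Qed.

Lemma En_flip1 S A N u : En (flipS 1 S) A N u = En S A N (flip 1 u).
Proof. by apply: Ds_eq => j _; rewrite /flipS mul1r. Qed.

Lemma En_flipN1 S A N u : En (flipS (-1) S) A N u = En S (1 - A - N%:Z) N (flip (-1) u).
Proof.
by rewrite -[RHS]Ds_rev; apply: Ds_eq => j _; rewrite /flipS mulN1r.
Qed.

Lemma minEx_flip1 S : minEx S -> minEx (flipS 1 S).
Proof.
move=> mE P P0 Q; have [x [px Hx]] := mE P P0 (- Q).
exists (flip 1 x); split.
  by move=> i; rewrite /flip !mul1r px opprD intrN opprK.
move=> u pu; rewrite !En_flip1 flipK//; apply: Hx => i.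
by rewrite /flip !mul1r pu opprD intrN.
Qed.

Lemma right_exchange r C al S (HS : pot r C al S) A N (y ze : int -> R) (p a : nat) e L d0 kap :
  (0 < r)%N -> (5 * r < p)%N -> 0 < d0 ->
  (forall i t, 0 <= t -> A + r%:Z <= i < A + N%:Z - r%:Z ->
     En S A N ze - e <= En S A N (upd ze i (- t))) ->
  (forall n, (n <= a)%N -> y (- (n * p)%N%:Z) <= ze (- (n * p)%N%:Z)) ->
  (forall n, (n <= a)%N -> forall i, `|i + (n * p)%N%:Z| <= 3 * r%:Z ->
     `|ze i - ze (- (n * p)%N%:Z)| <= L /\ y i - ze i <= L) ->
  (a * p)%N%:Z + 3 * r%:Z < 1 - A -> 1 - A - N%:Z <= - (3 * r%:Z) ->
  C1 r C * d0 ^+ 2 <= kap ->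
  e <= gain r C al L * (d0 / (4 * r)%:R) ^+ 2 / 2 ->
  C1 r C * ((4 * r)%:R * L) ^+ 2 <= a%:R * (gain r C al L * (d0 / (4 * r)%:R) ^+ 2 / 2) ->
  exists yC yD : int -> R,
   [/\ (forall i, 2 * r%:Z < i -> yC i = Num.max (y i) (ze i)),
       (forall i, i <= - (a * p)%N%:Z -> yC i = ze i),
       (forall i, 0 < i -> yD i = Num.min (y i) (ze i)),
       (forall i, Num.min (y i) (ze i) <= yD i <= y i) &
       (forall i, i <= - (a * p)%N%:Z -> yD i = y i) /\
       En S A N yC + En S A N yD <= En S A N y + En S A N ze + kap].
Proof.
move=> r0 rp d00 near ord bd bA bN Hkap He Ha.
have HSf := @pot_flip (-1) _ _ _ _ erefl HS.
pose A' := 1 - A - N%:Z.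
have EA u : En (flipS (-1) S) A' N u = En S A N (flip (-1) u).
  by rewrite En_flipN1; congr (En S _ N _); rewrite /A'; ilia.
have [|||||yA [yB [h1 h2 h3 h4 [h5 h6]]]] := @left_exchange _ _ _ _ _ HSf A' N (flip (-1) y)
  (flip (-1) ze) p a e L d0 kap r0 rp d00 _ _ _ _ _ Hkap He Ha.
- move=> i t t0 ii; rewrite !EA flipK// flip_upd// flipK//.
  by apply: near => //; move: ii; rewrite /A'; ilia.
- by move=> n na; rewrite /flip mulN1r lerN2 ord.
- move=> n na i ni; rewrite /flip !mulN1r -opprD normrN opprK [X in _ /\ X <= _]addrC.
  by apply: bd => //; ilia.
- by [].
- by rewrite /A'; ilia.
have fE u i : flip (-1) u i = - u (- i) by rewrite /flip mulN1r.
exists (flip (-1) yA), (flip (-1) yB); split.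
- move=> i ii; rewrite fE h1; last by ilia.
  by rewrite !fE !opprK -oppr_max opprK.
- by move=> i ii; rewrite fE h2 ?fE ?opprK//; ilia.
- move=> i ii; rewrite fE h3; last by ilia.
  by rewrite !fE !opprK -oppr_min opprK.
- by move=> i; have := h4 (- i); rewrite !fE !opprK -oppr_min; lra.
split; first by move=> i ii; rewrite fE h5 ?fE ?opprK//; ilia.
by move: h6; rewrite !EA !flipK.
Qed.

End Flip.

(** * Minimizers near the core of a crossing *)

Section Splice.
Variable R : realType.
Implicit Types (u v w x y z : int -> R) (A i j k l P Q : int) (n m M N a : nat).

Definition locally_minimal r (S : int -> (int -> R) -> R) y : Prop :=
  forall A N v, (forall i, i < A + r%:Z -> v i = y i) ->
    (forall i, A + N%:Z - r%:Z <= i -> v i = y i) -> En S A N y <= En S A N v.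

Context r C al (S : int -> (int -> R) -> R) (HS : pot r C al S).
Context (p : nat) (q : int) (rp : (5 * r < p)%N).

(* The competitor [y | yA shifted back by 2a+2 periods | yC] for [y]: since
   [yA] and [yC] follow [z] shifted by -(a+1) and a+1 periods, the second seam is exact. *)
Lemma splice_energy (y z yA yC : int -> R) n a theta :
  (2 * a + 4 < n)%N -> locally_minimal r S y ->
  (forall i, i < - (n * p)%N%:Z + ((2 * a + 2) * p)%N%:Z + r%:Z -> yA i = y i) ->
  (forall i, (a * p)%N%:Z <= i ->
     yA i = sh (- (a.+1 * p)%N%:Z) (- (a.+1%:Z * q)) z i) ->
  (forall i, i <= - (a * p)%N%:Z -> yC i = sh (a.+1 * p)%N%:Z (a.+1%:Z * q) z i) ->
  (forall i, (n * p)%N%:Z - r%:Z <= i -> yC i = y i) ->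
  Ds (- (n * p)%N%:Z - r%:Z) (2 * r) (fun i =>
    `|sh ((2 * a + 2) * p)%N ((2 * a + 2)%N%:Z * q) y i - y i|) <= theta ->
  En S (- (n * p)%N%:Z) (2 * n * p) y + En S (- (n * p)%N%:Z) ((2 * a + 2) * p) y +
  En S (- ((n - a.+1) * p)%N%:Z) (2 * (n - a.+1) * p) z
  <= En S (- (n * p)%N%:Z) (2 * n * p) yA + En S (- (n * p)%N%:Z) (2 * n * p) yC +
     2 * (C1 r C * theta).
Proof.
move=> an ymin hA1 hA2 hC1 hC2 hth.
set A : int := - (n * p)%N%:Z in hA1 hth *.
set M := (2 * a + 2)%N in hA1 hth *.
set P := (M * p)%N in hA1 hth *; set Q := M%:Z * q in hth *.
set N := (2 * n * p)%N.
pose ap := (a * p)%N.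
pose n1 := ((n - a.+1) * p)%N; pose n2 := ((n + a.+1) * p)%N.
pose c : int := - (a.+1 * p)%N%:Z.
have PE : P%:Z = 2 * ap%:Z + 2 * p%:Z by rewrite /P /M /ap; ilia.
have cE : c = - ap%:Z - p%:Z by rewrite /c /ap; ilia.
have n1E : n1%:Z = - A - ap%:Z - p%:Z by rewrite /n1 /A /ap; nia.
have n2E : n2%:Z = - A + ap%:Z + p%:Z by rewrite /n2 /A /ap; nia.
have NE : N%:Z = - A - A by rewrite /N /A; ilia.
have nbig : ap%:Z + ap%:Z + 4 * p%:Z < - A by rewrite /A /ap; nia.
have apE : (a.+1 * p)%N%:Z = ap%:Z + p%:Z by rewrite /ap; ilia.
have hA1' i : i < A + P%:Z + r%:Z -> yA i = y i by exact: hA1.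
have hA2' i : ap%:Z <= i -> yA i = z (i - (ap%:Z + p%:Z)) + (a.+1%:Z * q)%:~R.
  by move=> ii; rewrite hA2// /sh apE intrN opprK.
have hC1' i : i <= - ap%:Z -> yC i = z (i + (ap%:Z + p%:Z)) - (a.+1%:Z * q)%:~R.
  by move=> ii; rewrite hC1// /sh apE.
have hC2' i : - A - r%:Z <= i -> yC i = y i by move=> ii; apply: hC2; move: ii; rewrite /A; ilia.
pose Y' i := if i < c then sh P Q yA i else yC i.
pose Y'' i := if i < A then y i else Y' i.
have rp' : 5 * r%:Z < p%:Z by ilia.
clearbody ap n1 n2 N P.
have shyA i : ap%:Z - P%:Z <= i <= - ap%:Z -> sh P Q yA i = yC i.
  move=> ii; rewrite /sh hA2'; last by ilia.
  rewrite hC1'; last by ilia.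
  rewrite (_ : i + P%:Z - (ap%:Z + p%:Z) = i + (ap%:Z + p%:Z)); last by ilia.
  rewrite /Q /M (_ : (2 * a + 2)%N%:Z * q = a.+1%:Z * q + a.+1%:Z * q) ?intrD; last by ilia.
  lra.
have shy i : i < A + r%:Z -> sh P Q yA i = sh P Q y i.
  by move=> ii; rewrite /sh hA1'//; ilia.
have dn0 i : 0 <= `|sh P Q y i - y i| by [].
have C10 := ltW (C1_gt0 HS).
have g : En S (A - p%:Z) (p + N) y <= En S (A - p%:Z) (p + N) Y''.
  apply: ymin => i ii; rewrite /Y''; first by rewrite ifT//; ilia.
  rewrite /Y' !ifF; [|by ilia|by ilia].
  by apply: hC2'; move: ii; ilia.
rewrite !En_cat subrK in g.
have l1 : En S (A - p%:Z) p Y'' <= En S (A - p%:Z) p y + C1 r C * theta.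
  have := En_lip HS (A - p%:Z) p Y'' y; rewrite ler_norml => /andP[_ h].
  suff : C1 r C * Ds (A - p%:Z - r%:Z) (p + 2 * r) (fun i => `|Y'' i - y i|) <= C1 r C * theta by lra.
  rewrite ler_wpM2l//; apply: le_trans hth.
  have -> : (p + 2 * r)%N = (p + r + r)%N by ilia.
  rewrite Ds_cat Ds_0 ?add0r; last first.
    by move=> i ii; rewrite /Y'' ifT ?subrr ?normr0//; ilia.
  apply: le_trans (_ : Ds (A - p%:Z - r%:Z + (p + r)%N%:Z) r (fun i => `|sh P Q y i - y i|) <= _).
    apply: Ds_le => i ii; rewrite /Y'' /Y' ifF; last by ilia.
    by rewrite ifT ?shy//; ilia.
  by apply: Ds_sub => //; ilia.
have l2 : En S A N Y'' <= En S A N Y' + C1 r C * theta.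
  have := En_lip HS A N Y'' Y'; rewrite ler_norml => /andP[_ h].
  suff : C1 r C * Ds (A - r%:Z) (N + 2 * r) (fun i => `|Y'' i - Y' i|) <= C1 r C * theta by lra.
  rewrite ler_wpM2l//; apply: le_trans hth.
  have -> : (N + 2 * r)%N = (r + (N + r))%N by ilia.
  rewrite Ds_cat [X in _ + X]Ds_0 ?addr0; last first.
    by move=> i ii; rewrite /Y'' ifF ?subrr ?normr0//; ilia.
  apply: le_trans (_ : Ds (A - r%:Z) r (fun i => `|sh P Q y i - y i|) <= _).
    apply: Ds_le => i ii; rewrite /Y'' /Y' ifT; last by ilia.
    by rewrite ifT ?shy 1?distrC//; ilia.
  by apply: Ds_sub => //; ilia.
(* The bookkeeping from here on: [Y'] has the energy of [yA] plus that of [yC], less a block of [M]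
   periods of [y] and less two pieces which together are the energy of one copy of [z]. *)
have e1 : En S A N Y' = En S (A + P%:Z) n1 yA + En S c n2 yC.
  have -> : N = (n1 + n2)%N by ilia.
  rewrite En_cat -(En_sh HS A n1 P Q) (_ : A + n1%:Z = c); last by ilia.
  congr (_ + _); apply: (En_loc HS) => i ii; rewrite /Y'.
    by case: ifP => // ic; rewrite shyA//; ilia.
  by case: ifP => // ic; rewrite shyA//; ilia.
have e2 : En S A N yA = En S A P y + En S (A + P%:Z) n1 yA + En S 0 n1 z.
  have -> : N = (P + n1 + n1)%N by ilia.
  rewrite !En_cat; congr (_ + _ + _).
    by apply: (En_loc HS) => i ii; apply: hA1'; ilia.
  have -> : En S 0 n1 z = En S (A + (P + n1)%N%:Z) n1 (sh (- (ap%:Z + p%:Z)) (- (a.+1%:Z * q)) z).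
    by rewrite (En_sh HS); congr (En S _ _ _); ilia.
  apply: (En_loc HS) => i ii; rewrite hA2'; last by ilia.
  by rewrite /sh intrN opprK.
have e3 : En S A N yC = En S (A + (ap%:Z + p%:Z)) n1 z + En S c n2 yC.
  have -> : N = (n1 + n2)%N by ilia.
  rewrite En_cat (_ : A + n1%:Z = c); last by ilia.
  congr (_ + _); rewrite -(En_sh HS A n1 (ap%:Z + p%:Z) (a.+1%:Z * q)).
  by apply: (En_loc HS) => i ii; rewrite hC1'//; ilia.
have e4 : En S (- ((n - a.+1) * p)%N%:Z) (2 * (n - a.+1) * p) z =
    En S (A + (ap%:Z + p%:Z)) n1 z + En S 0 n1 z.
  have E1 : - ((n - a.+1) * p)%N%:Z = A + (ap%:Z + p%:Z) by move: apE; rewrite /A; nia.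
  have E2 : (2 * (n - a.+1) * p)%N = (n1 + n1)%N by move: apE n1E; rewrite /A; nia.
  rewrite E1 E2 En_cat; congr (_ + En S _ _ _); ilia.
rewrite e4; lra.
Qed.

Lemma monotone_sh (z : int -> R) n i : (forall i, z i <= sh p q z i) ->
  z i <= sh (n * p)%N%:Z (n%:Z * q) z i.
Proof.
move=> mz; elim: n => [|n IH]; first by rewrite /sh mul0n mul0r addr0 subr0.
apply: le_trans IH _; have := mz (i + (n * p)%N%:Z).
rewrite /sh (_ : i + (n.+1 * p)%N%:Z = i + (n * p)%N%:Z + p%:Z); last by ilia.
rewrite (_ : n.+1%:Z * q = n%:Z * q + q) ?intrD; last by ilia.
lra.
Qed.

(* The displacements over consecutive windows of [M] periods telescope, and their
   mean is [M * beta]; so some window far to the left has at most twice the mean. *)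
Lemma slow_window (y : int -> R) (Om : R) X M :
  let beta := p%:R * Om - q%:~R in
  (0 < M)%N -> 0 < beta -> (0 < r)%N ->
  (forall i, y i <= sh p q y i) ->
  (forall i k, `|y (i + k) - y i - k%:~R * Om| <= 1) ->
  exists2 n, (X < n)%N & Ds (- (n * p)%N%:Z - r%:Z) (2 * r)
    (fun i => `|sh (M * p)%N (M%:Z * q) y i - y i|) <= (4 * r)%:R * (M%:R * beta).
Proof.
move=> beta M0 b0 r0 ym yb.
have Mb : 0 < M%:R * beta by rewrite mulr_gt0 ?ltr0n.
have := truncnS_gt (M%:R * beta)^-1; set K := (_.+1) => HK.
pose g n := Ds (- (n * p)%N%:Z - r%:Z) (2 * r)
  (fun i => `|sh (M * p)%N (M%:Z * q) y i - y i|).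
apply: contrapT => H.
have Hg (k : nat) : (4 * r)%:R * (M%:R * beta) < g (X + k.+1 * M)%N.
  by rewrite ltNge; apply/negP => h; apply: H; exists (X + k.+1 * M)%N => //; nia.
have S1 : K%:R * ((4 * r)%:R * (M%:R * beta)) <= \sum_(k < K) g (X + k.+1 * M)%N.
  rewrite -[X in X%:R * _]card_ord mulr_natl -sumr_const; apply: ler_sum => k _; exact: ltW.
have S2 : \sum_(k < K) g (X + k.+1 * M)%N <= (2 * r)%:R * (1 + K%:R * (M%:R * beta)).
  rewrite /g /Ds exchange_big /= -[X in X%:R * (1 + _)]card_ord mulr_natl -sumr_const.
  apply: ler_sum => j _.
  pose f (k : nat) := - y (- ((X + k * M) * p)%N%:Z - r%:Z + j%:Z) - (k%:Z * (M%:Z * q))%:~R.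
  have Ef (k : nat) : `|sh (M * p)%N (M%:Z * q) y (- ((X + k.+1 * M) * p)%N%:Z - r%:Z + j%:Z)
      - y (- ((X + k.+1 * M) * p)%N%:Z - r%:Z + j%:Z)| = f k.+1 - f k.
    have := monotone_sh M (- ((X + k.+1 * M) * p)%N%:Z - r%:Z + j%:Z) ym.
    rewrite /sh /f => h; rewrite ger0_norm ?subr_ge0//.
    rewrite (_ : - ((X + k.+1 * M) * p)%N%:Z - r%:Z + j%:Z + (M * p)%N =
       - ((X + k * M) * p)%N%:Z - r%:Z + j%:Z); last by nia.
    rewrite (_ : k.+1%:Z * (M%:Z * q) = k%:Z * (M%:Z * q) + M%:Z * q) ?intrD; last by ilia.
    lra.
  under eq_bigr do rewrite Ef.
  rewrite -(big_mkord xpredT (fun k : nat => f k.+1 - f k)) telescope_sumr// /f.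
  have := yb (- ((X + K * M) * p)%N%:Z - r%:Z + j%:Z) (K * M * p)%N%:Z.
  rewrite (_ : _ + (K * M * p)%N%:Z = - ((X + 0 * M) * p)%N%:Z - r%:Z + j%:Z); last by nia.
  rewrite ler_norml mul0r subr0 => /andP[_].
  rewrite (_ : (K * M * p)%N%:Z%:~R = K%:R * M%:R * p%:R :> R); last by rewrite -!natrM.
  rewrite (_ : (K%:Z * (M%:Z * q))%:~R = K%:R * M%:R * q%:~R :> R); last by rewrite !intrM mulrA.
  by rewrite /beta; lra.
have K1 : 1 < K%:R * (M%:R * beta) by rewrite -ltr_pdivrMr// mul1r.
have r0' : 0 < r%:R :> R by rewrite ltr0n.
have : (2 * r)%:R * (1 + K%:R * (M%:R * beta)) < (2 * r)%:R * (2 * (K%:R * (M%:R * beta))).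
  by rewrite ltr_pM2l ?ltr0n; [lra|ilia].
move: S1 S2; rewrite !natrM; lra.
Qed.

End Splice.

Section Barrier.
Variable R : realType.
Implicit Types (u v w x y z : int -> R) (A i j k l P Q : int) (n m M N a : nat).

Lemma per_mulz P Q u k i : per P Q u -> u (i + k * P) = u i + (k * Q)%:~R.
Proof.
move=> H; move: k i.
apply: (@int_two_sided_ind (fun k => forall i, u (i + k * P) = u i + (k * Q)%:~R) 0) => [i|k IH i|k IH i].
- by rewrite !mul0r !addr0.
- rewrite (_ : i + (k + 1) * P = i + k * P + P); last by lia.
  by rewrite H IH (_ : (k + 1) * Q = k * Q + Q) ?intrD ?addrA//; lia.
- have := H (i + (k - 1) * P).
  rewrite (_ : i + (k - 1) * P + P = i + k * P); last by lia.
  by rewrite IH (_ : k * Q = (k - 1) * Q + Q) ?intrD; [lra|lia].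
Qed.

Context r C al (S : int -> (int -> R) -> R) (HS : pot r C al S) (mE : minEx S).
Context (r0 : (0 < r)%N) (p : nat) (q : int) (x : int -> R).
Context (rp5 : (5 * r < p)%N) (Hx : isMin S p q x).
Context (V1 V2 : R -> R) (HV1 : sitepot V1) (V1x : forall i, V1 (x i) = 0) (HV2 : sitepot V2).

(* Shrinks the context before [lra]; the section variables must stay. *)
Ltac only_goal := clear - HS mE r0 rp5 Hx V1x HV1 HV2; intros.

Local Notation S1 := (addV V1 S).
Local Notation S2 := (addV V2 (addV V1 S)).
Local Notation HS1 := (pot_addV HS HV1).
Local Notation HS2 := (pot_addV (pot_addV HS HV1) HV2).
Local Notation px := (proj1 Hx).
Local Notation E0 := (Estar r S p x V1).

Lemma crossing_sh T C' A M z k : pot r C' al T -> crossing r p x A M z ->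
  crossing r p x (A - k * p%:Z) M (sh (k * p) (k * q) z) /\
  Fe p x T (A - k * p%:Z) M (sh (k * p) (k * q) z) = Fe p x T A M z.
Proof.
move=> HT [c1 c2].
have xk i : x (i + k * p%:Z) - (k * q)%:~R = x i by rewrite (per_mulz _ _ px) addrK.
split.
  split=> i ii; rewrite /sh.
    by rewrite c1 ?xk//; lia.
  by rewrite c2; [have := xk i; lra|lia].
have -> : Fe p x T (A - k * p%:Z) M (sh (k * p) (k * q) z) =
    En T (A - k * p%:Z) (M * p) (sh (k * p) (k * q) z) -
    En T (A - k * p%:Z) (M * p) (sh (k * p) (k * q) x).
  by congr (_ - En _ _ _ _); apply/funext => i; rewrite /sh xk.
by rewrite !(En_sh HT) subrK.
Qed.

(** Changing an inner site leaves a crossing, whose energy is at least the infimum [Estar]; [V2]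
    vanishes along [w] and can only add to the energy of the changed configuration. *)
Lemma crossing_near A M w e i t : crossing r p x A M w ->
  Fe p x S1 A M w <= E0 + e -> (forall i, V2 (w i) = 0) ->
  A + r%:Z <= i < A + (M * p)%N%:Z - r%:Z ->
  En S2 A (M * p) w - e <= En S2 A (M * p) (upd w i t).
Proof.
move=> [c1 c2] Hw Vw ii; have rp : (2 * r < p)%N by ilia.
have cu : crossing r p x A M (upd w i t).
  split=> l ll; rewrite /upd.
    by rewrite (_ : (l == i) = false) ?c1//; apply/eqP; ilia.
  by rewrite (_ : (l == i) = false) ?c2//; apply/eqP; ilia.
have := Estar_le HS mE r0 rp Hx HV1 V1x cu; move=> h.
have := En_addV_ge S1 A (M * p) (upd w i t) HV2.
have -> : En S2 A (M * p) w = En S1 A (M * p) w by rewrite En_addV Ds_0 ?addr0.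
by move: h Hw; rewrite /Fe; lra.
Qed.

Lemma crossing_site0 A M z i : crossing r p x A M z -> (forall i, V2 (z i) = 0) ->
  V2 (x i) = 0.
Proof.
move=> [c1 _] Vz; pose k : int := (absz i)%:Z + (absz A)%:Z + 1.
rewrite -(site_perz _ (- k * q) HV2) -(per_mulz (- k) i px) -c1 ?Vz//.
by rewrite /k; nia.
Qed.

(** Exchanging [y] with [zm], then the result [yB] with [zp], bounds the energies of [yA], [yC] and
    [yD] together by those of [y], [zm] and [zp], up to [2 * kap]. Now [yD] is a crossing through
    [y 0], so its relative energy is at least [E0 + W], whereas [zm] and [zp] have at most [E0 + e]
    each. By [splice_energy], [yA] and [yC] together cost at least [y], one copy of [z] and a block
    of [M] periods. All [E0] cancel, and [W] is left below [2 * e + 2 * kap] plus three seam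
    terms. *)
Lemma no_minimizer_near_core (y z : int -> R) (Om B W d0 kap e : R) A0 M0 a :
  let beta := p%:R * Om - q%:~R in
  let L := (6 * r)%:R * B + 3 in
  let C2 := C1 r (C + 1 + 1) in
  crossing r p x A0 M0 z -> clamped x z -> (forall i, z i <= sh p q z i) ->
  Fe p x S1 A0 M0 z <= E0 + e -> (forall i, V2 (z i) = 0) ->
  0 < beta -> `|Om| <= B -> `|q%:~R / p%:R| <= B ->
  locally_minimal r S2 y -> (forall i, y i <= sh p q y i) ->
  (forall i k, `|y (i + k) - y i - k%:~R * Om| <= 1) ->
  z 0 <= y 0 -> y 0 <= sh p q z 0 -> W <= V2 (y 0) ->
  0 < d0 -> C2 * d0 ^+ 2 <= kap ->
  e <= gain r (C + 1 + 1) al L * (d0 / (4 * r)%:R) ^+ 2 / 2 ->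
  C2 * ((4 * r)%:R * L) ^+ 2 <=
    a%:R * (gain r (C + 1 + 1) al L * (d0 / (4 * r)%:R) ^+ 2 / 2) ->
  3 * (C2 * ((4 * r)%:R * ((2 * a + 2)%:R * beta))) + 2 * e + 2 * kap < W -> False.
Proof.
move=> beta L C2 cz bz mz Hz Vz b0 OmB qB ymin ym yb zy yz Wy d00 Hkap He Ha Hfin.
have p0 : 0 < p%:R :> R by rewrite ltr0n; ilia.
have rp : (2 * r < p)%N by ilia.
have B0 : 0 <= B by apply: le_trans OmB.
have xb := isMin_bound HS rp r0 Hx.
have drift i k (n : nat) : `|k| <= n%:Z -> `|x (i + k) - x i| <= n%:R * B + 1 /\
    `|y (i + k) - y i| <= n%:R * B + 1.
  move=> kn; have kB (t : R) : `|t| <= B -> `|k%:~R * t| <= n%:R * B.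
    move=> tB; rewrite normrM ler_pM// -intr_norm -[n%:R]/(n%:Z%:~R) ler_int.
    exact: kn.
  have := kB _ OmB; have := kB _ qB; have := xb i k; have := yb i k.
  by rewrite !ler_norml; lra.
have slope : Om - q%:~R / p%:R = beta / p%:R by rewrite /beta; field; exact: lt0r_neq0.
have [X0 far_l far_r] : exists2 X0 : nat,
    (forall i, i <= - X0%:Z -> y i <= x i) & (forall i, X0%:Z <= i -> x i + 1 <= y i).
  (* Of the three units, two are for the deviations of [x] and [y] from linear growth, one for the
     target [x + 1]. *)
  pose D := `|y 0 - x 0| + 3.
  have := truncnS_gt (D * p%:R / beta); set X0 := (_.+1) => HX.
  have HX' : D <= X0%:R * (beta / p%:R).
    by rewrite mulrA ler_pdivlMr// -ler_pdivrMr// ltW.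
  have bp0 : 0 < beta / p%:R by rewrite divr_gt0.
  exists X0 => i ii.
    have iR : i%:~R <= - X0%:R :> R by rewrite -[X0%:R]/(X0%:Z%:~R) -intrN ler_int.
    have : i%:~R * (beta / p%:R) <= - X0%:R * (beta / p%:R) by rewrite ler_wpM2r// ltW.
    have := yb 0 i; have := xb 0 i; rewrite add0r -slope !ler_norml.
    have := ler_norm (y 0 - x 0); move: HX'; rewrite -slope /D; lra.
  have iR : X0%:R <= i%:~R :> R by rewrite -[X0%:R]/(X0%:Z%:~R) ler_int.
  have : X0%:R * (beta / p%:R) <= i%:~R * (beta / p%:R) by rewrite ler_wpM2r// ltW.
  have := yb 0 i; have := xb 0 i; rewrite add0r -slope !ler_norml.
  have := ler_norm (x 0 - y 0); rewrite distrC; move: HX'; rewrite -slope /D; lra.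
pose M := (2 * a + 2)%N.
have [n nX hth] := @slow_window _ r p q rp5 y Om (X0 + M0 + absz A0 + 2 * a + 10)%N M
  ltac:(rewrite /M; ilia) b0 r0 ym yb.
pose A : int := - (n * p)%N%:Z.
pose N := (2 * n * p)%N.
have np : (X0 + M0 + absz A0 + 2 * a + 10)%N%:Z * p%:Z < n%:Z * p%:Z by rewrite ltr_pM2r//; ilia.
have Anp : A = - (n%:Z * p%:Z) by rewrite /A; ilia.
have Np : N%:Z = n%:Z * p%:Z + n%:Z * p%:Z by rewrite /N; ilia.
have zsb k i : x i <= sh (k * p%:Z) (k * q) z i <= x i + 1.
  have := bz (i + k * p%:Z); have := per_mulz k i px; rewrite /sh; lra.
have zcross k : `|k| <= a.+1%:Z ->
   crossing r p x A (2 * n) (sh (k * p%:Z) (k * q) z) /\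
   Fe p x S1 A (2 * n) (sh (k * p%:Z) (k * q) z) <= E0 + e.
  move=> ka; have [ck Fk] := crossing_sh k HS1 cz.
  have kp : `|k * p%:Z| <= a.+1%:Z * p%:Z by rewrite normrM ler_pM//; ilia.
  have A0p : `|A0| <= (absz A0)%:Z * p%:Z by inia.
  have M0p : (M0 * p)%N%:Z = M0%:Z * p%:Z by ilia.
  have n2p : (2 * n * p)%N%:Z = 2 * (n%:Z * p%:Z) by ilia.
  have X0p : 0 <= X0%:Z * p%:Z by ilia.
  have ap : 0 <= a%:Z * p%:Z by ilia.
  have [|| ck2 Fk2] := @crossing_ext _ r al r0 p x rp S1 _ _ _ A (2 * n) _ HS1 ck.
  - by rewrite Anp; move: np; ilia.
  - by rewrite Anp n2p M0p; move: np; ilia.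
  by split=> //; rewrite Fk2 Fk.
(* With [a.+1] periods, the monotonicity of [y] and [z] puts [zm] below [y] at [0, p, ..., a * p],
   and [y] below [zp] at the opposite sites, as the two exchanges require. *)
pose zm := sh (- (a.+1 * p)%N%:Z) (- (a.+1%:Z * q)) z.
pose zp := sh (a.+1 * p)%N%:Z (a.+1%:Z * q) z.
have zmE : zm = sh (- a.+1%:Z * p%:Z) (- a.+1%:Z * q) z by congr (sh _ _ z); ilia.
have zpE : zp = sh (a.+1%:Z * p%:Z) (a.+1%:Z * q) z by congr (sh _ _ z); ilia.
have [czm Fzm] : crossing r p x A (2 * n) zm /\ Fe p x S1 A (2 * n) zm <= E0 + e.
  by rewrite zmE; apply: zcross; ilia.
have [czp Fzp] : crossing r p x A (2 * n) zp /\ Fe p x S1 A (2 * n) zp <= E0 + e.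
  by rewrite zpE; apply: zcross; ilia.
have zmb i : x i <= zm i <= x i + 1 by rewrite zmE.
have zpb i : x i <= zp i <= x i + 1 by rewrite zpE.
have Vzm i : V2 (zm i) = 0 by rewrite /zm /sh -intrN (site_perz _ _ HV2).
have Vzp i : V2 (zp i) = 0 by rewrite /zp /sh -intrN (site_perz _ _ HV2).
have zmp i : zm i <= zp i.
  have := monotone_sh rp5 (2 * a + 2)%N (i - (a.+1 * p)%N%:Z) mz; rewrite /zm /zp /sh.
  rewrite (_ : i - (a.+1 * p)%N%:Z + ((2 * a + 2) * p)%N%:Z = i + (a.+1 * p)%N%:Z); last by ilia.
  rewrite (_ : (2 * a + 2)%N%:Z * q = a.+1%:Z * q + a.+1%:Z * q) ?intrD ?intrN; last by ilia.
  lra.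
have ordm (m : nat) : (m <= a)%N -> zm (m * p)%N%:Z <= y (m * p)%N%:Z.
  move=> ma; have := monotone_sh rp5 m 0 ym.
  have := monotone_sh rp5 (a.+1 - m)%N ((m * p)%N%:Z - (a.+1 * p)%N%:Z) mz; rewrite /zm /sh add0r.
  rewrite (_ : _ + ((a.+1 - m) * p)%N%:Z = 0); last first.
    have : ((a.+1 - m) * p + m * p = a.+1 * p)%N by rewrite -mulnDl subnK//; ilia.
    ilia.
  rewrite (_ : (a.+1 - m)%N%:Z * q = a.+1%:Z * q - m%:Z * q) ?intrB ?intrN; last first.
    by rewrite -mulrBl; congr (_ * _); ilia.
  by move: zy; only_goal; lra.
have ordp (m : nat) : (m <= a)%N -> y (- (m * p)%N%:Z) <= zp (- (m * p)%N%:Z).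
  move=> ma; have := monotone_sh rp5 m (- (m * p)%N%:Z) ym.
  have := monotone_sh rp5 (a - m)%N p%:Z mz; move: zy yz; rewrite /zp /sh addNr add0r.
  rewrite (_ : p%:Z + ((a - m) * p)%N%:Z = - (m * p)%N%:Z + (a.+1 * p)%N%:Z); last first.
    have : ((a - m) * p + m * p = a * p)%N by rewrite -mulnDl subnK.
    ilia.
  rewrite (_ : (a - m)%N%:Z * q = a.+1%:Z * q - m%:Z * q - q) ?intrB; last first.
    by rewrite -subzn//; ring.
  lra.
have rB : 0 <= r%:R * B by rewrite mulr_ge0 ?ler0n.
have LE : L = 6 * (r%:R * B) + 3 by rewrite /L natrM mulrA.
have zdrift (w : int -> R) i k : (forall i, x i <= w i <= x i + 1) -> `|k| <= 3 * r%:Z ->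
    [/\ `|w (i + k) - w i| <= L, w (i + k) - w i <= y (i + k) - y i + L &
        y (i + k) - y i <= w (i + k) - w i + L ].
  move=> wb k3; have := wb i; have := wb (i + k).
  have [] := drift i k (3 * r)%N; first by move: k3; ilia.
  by rewrite LE natrM !ler_norml; move: rB; only_goal; split; lra.
have ap_n : (a * p)%N%:Z + 10 * p%:Z < n%:Z * p%:Z.
  have X0p : 0 <= X0%:Z * p%:Z by ilia.
  have A0p : 0 <= (absz A0)%:Z * p%:Z by ilia.
  have M0p : 0 <= M0%:Z * p%:Z by ilia.
  have apE : (a * p)%N%:Z = a%:Z * p%:Z by ilia.
  have app : 0 <= a%:Z * p%:Z by ilia.
  by move: np; ilia.
have AN : A + N%:Z = n%:Z * p%:Z by rewrite Anp Np; ilia.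
have aE : (a * p)%N%:Z = a%:Z * p%:Z by ilia.
have [|||||yA [yB [a1 a2 a3 a4 [a5 a6]]]] := @left_exchange _ _ _ _ _ HS2 A N y zm p a e L d0 kap
  r0 rp5 d00 _ _ _ _ _ Hkap He Ha.
- by move=> i t _ ii; exact: crossing_near czm Fzm Vzm ii.
- exact: ordm.
- move=> m ma i im; have := zdrift zm (m * p)%N%:Z (i - (m * p)%N%:Z) zmb im.
  rewrite [_ + (i - _)]addrC subrK => -[h1 h2 _]; split=> //.
  by have := ordm m ma; move: h1 h2; only_goal; lra.
- by rewrite Anp; move: ap_n; ilia.
- by rewrite AN; move: ap_n; ilia.
have yBp (m : nat) : (m <= a)%N -> yB (- (m * p)%N%:Z) <= zp (- (m * p)%N%:Z).
  move=> ma; have /andP[_ h] := a4 (- (m * p)%N%:Z); apply: le_trans h _.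
  by rewrite ge_max ordp// zmp.
have [||||yC [yD [b1 b2 b3 b4 [b5 b6]]]] := @right_exchange _ _ _ _ _ HS2 A N yB zp p a e L d0 kap
  r0 rp5 d00 _ yBp _ _ _ Hkap He Ha.
- by move=> i t _ ii; exact: crossing_near czp Fzp Vzp ii.
- move=> m ma i im; have := zdrift zp (- (m * p)%N%:Z) (i + (m * p)%N%:Z) zpb im.
  rewrite [_ + (i + _)]addrC addrK => -[h1 _ h3]; split=> //.
  have /andP[_ h] := a4 i.
  have : Num.max (y i) (zm i) <= zp i + L.
    rewrite ge_max; apply/andP; split; first by have := ordp m ma; move: h1 h3; only_goal; lra.
    by have := zmp i; rewrite LE; move: rB; only_goal; lra.
  by move: h; only_goal; lra.
- by rewrite Anp; move: ap_n; ilia.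
- by rewrite (_ : 1 - A - N%:Z = 1 - (A + N%:Z)) ?AN; move: ap_n; ilia.
have spl := @splice_energy _ _ _ _ _ HS2 p q rp5 y z yA yC n a ((4 * r)%:R * (M%:R * beta))
  ltac:(move: nX; ilia) ymin.
have {}spl : En S2 A N y + En S2 A (M * p) y +
    En S2 (- ((n - a.+1) * p)%N%:Z) (2 * (n - a.+1) * p) z <=
    En S2 A N yA + En S2 A N yC + 2 * (C2 * ((4 * r)%:R * (M%:R * beta))).
  have Mp : (M * p)%N%:Z = 2 * (a%:Z * p%:Z) + 2 * p%:Z by rewrite /M; ilia.
  have far : (a%:Z * p%:Z) + (a%:Z * p%:Z) + X0%:Z + 4 * p%:Z < n%:Z * p%:Z.
    have X0p : X0%:Z <= X0%:Z * p%:Z by inia.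
    have A0p : 0 <= (absz A0)%:Z * p%:Z by ilia.
    have M0p : 0 <= M0%:Z * p%:Z by ilia.
    by move: np; ilia.
  apply: spl => [i ii|i ii|i ii|i ii|]; last exact: hth.
  - have ii' : i < - (n%:Z * p%:Z) + 2 * (a%:Z * p%:Z) + 2 * p%:Z + r%:Z.
      by move: ii; rewrite -/M Mp; move: Anp; rewrite /A; ilia.
    have ap0 : 0 <= a%:Z * p%:Z by ilia.
    rewrite a1; last by ilia.
    apply/min_idPl; apply: le_trans (far_l i _) _; first by ilia.
    by have /andP[] := zmb i.
  - exact: a2.
  - exact: b2.
  - have ap0 : 0 <= a%:Z * p%:Z by ilia.
    have ii' : n%:Z * p%:Z - r%:Z <= i by move: ii; ilia.
    rewrite b1; last by ilia.
    rewrite a5; last by ilia.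
    apply/max_idPl; have /andP[_ h] := zpb i; apply: le_trans h _.
    by apply: far_r; ilia.
have ap0 : 0 <= a%:Z * p%:Z by ilia.
have V2x i : V2 (x i) = 0 by exact: crossing_site0 cz Vz.
have Ex1 A' N' : En S1 A' N' x = En S A' N' x by rewrite En_addV Ds_0 ?addr0.
have Ex2 A' N' : En S2 A' N' x = En S A' N' x by rewrite En_addV Ds_0 ?addr0.
have ES2 (w : int -> R) A' N' : (forall i, V2 (w i) = 0) -> En S2 A' N' w = En S1 A' N' w.
  by move=> Vw; rewrite En_addV Ds_0 ?addr0.
pose Lam := En S 0 p x.
have ExM (k : nat) A' : En S A' (k * p) x = k%:R * Lam by rewrite (En_per_mul HS _ _ px).
have fzm : En S2 A N zm <= (2 * n)%:R * Lam + E0 + e.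
  by rewrite ES2//; move: Fzm; rewrite /Fe Ex1 ExM; only_goal; lra.
have fzp : En S2 A N zp <= (2 * n)%:R * Lam + E0 + e.
  by rewrite ES2//; move: Fzp; rewrite /Fe Ex1 ExM; only_goal; lra.
have gz : (2 * (n - a.+1))%:R * Lam + E0 <= En S2 (- ((n - a.+1) * p)%N%:Z) (2 * (n - a.+1) * p) z.
  have A0p : `|A0| <= (absz A0)%:Z * p%:Z by inia.
  have M0p : (M0 * p)%N%:Z = M0%:Z * p%:Z by ilia.
  have X0p : 0 <= X0%:Z * p%:Z by ilia.
  have w1 : ((n - a.+1) * p)%N%:Z = n%:Z * p%:Z - a%:Z * p%:Z - p%:Z.
    by rewrite mulnBl -subzn ?leq_mul2r; [ilia|apply/orP; right; move: nX; ilia].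
  have w2 : (2 * (n - a.+1) * p)%N%:Z = 2 * ((n - a.+1) * p)%N%:Z by ilia.
  have [||ck Fk] := @crossing_ext _ r al r0 p x rp S1 _ _ _ (- ((n - a.+1) * p)%N%:Z)
      (2 * (n - a.+1)) _ HS1 cz.
  - by rewrite w1; move: np; ilia.
  - by rewrite w2 w1 M0p; move: np; ilia.
  have := Estar_le HS mE r0 rp Hx HV1 V1x ck; rewrite /Fe Ex1 ExM ES2//; only_goal; lra.
have zy0 : zm 0 <= y 0 by have := ordm 0%N (leq0n _); rewrite mul0n.
have yz0 : y 0 <= zp 0 by have := ordp 0%N (leq0n _); rewrite mul0n oppr0.
have yB0 : yB 0 = y 0.
  by apply/eqP; rewrite eq_le; have := a4 0; rewrite (max_idPl zy0) => /andP[-> ->].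
have yD0 : yD 0 = y 0.
  by apply/eqP; rewrite eq_le; have := b4 0; rewrite yB0 (min_idPl yz0) => /andP[-> ->].
have farL i : i < A + r%:Z -> y i <= x i.
  move=> ii; apply: far_l; have X0p : X0%:Z <= X0%:Z * p%:Z by inia.
  have A0p : 0 <= (absz A0)%:Z * p%:Z by ilia.
  have M0p : 0 <= M0%:Z * p%:Z by ilia.
  by move: np; ilia.
have farR i : A + N%:Z - r%:Z <= i -> x i + 1 <= y i.
  move=> ii; apply: far_r; have X0p : X0%:Z <= X0%:Z * p%:Z by inia.
  have A0p : 0 <= (absz A0)%:Z * p%:Z by ilia.
  have M0p : 0 <= M0%:Z * p%:Z by ilia.
  by move: np ii; rewrite AN; ilia.
have cD : crossing r p x A (2 * n) yD.
  split=> i ii.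
    rewrite b5; last by move: ii ap_n; ilia.
    rewrite a3; last by move: ii ap_n; ilia.
    rewrite (czm.1 i ii); apply/max_idPr; exact: farL.
  have iN : A + N%:Z - r%:Z <= i by [].
  have iN' : n%:Z * p%:Z - r%:Z <= i by move: iN; rewrite AN.
  rewrite b3; last by move: iN' ap_n; ilia.
  rewrite a5; last by move: iN' ap_n; ilia.
  rewrite (czp.2 i ii); apply/min_idPr; exact: farR.
have gD : (2 * n)%:R * Lam + E0 + W <= En S2 A N yD.
  have := Estar_le HS mE r0 rp Hx HV1 V1x cD; rewrite /Fe Ex1 ExM => h.
  have -> : En S2 A N yD = En S1 A N yD + Ds A N (fun i => V2 (yD i)) by rewrite En_addV.
  have : V2 (yD 0) <= Ds A N (fun i => V2 (yD i)).
    apply: (@Ds_ge1 _ A N (fun i => V2 (yD i))) => [i|]; first exact: site_ge0.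
    by rewrite AN Anp; move: ap_n; ilia.
  by rewrite yD0 -/N; move: h Wy; rewrite -/N; only_goal; lra.
have blk : M%:R * Lam - C2 * ((4 * r)%:R * (M%:R * beta)) <= En S2 A (M * p) y.
  have := closing_energy HS (M := M) y A mE rp r0 ltac:(rewrite /M; ilia) Hx; rewrite ExM.
  have := En_addV_ge S A (M * p) y HV1; have := En_addV_ge S1 A (M * p) y HV2.
  have := ler_wpM2l (ltW (C1_gt0 HS2)) hth; rewrite -/C2 -/A -/beta.
  set D := Ds _ _ _; have D0 : 0 <= D by apply: Ds_ge0.
  have : C1 r C * D <= C2 * D.
    by rewrite ler_wpM2r// /C2 /C1 ler_wpM2r ?ler0n//; only_goal; lra.
  by move: (C1 r C * D) (C2 * D); rewrite /Lam; only_goal; lra.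
have nE : (2 * (n - a.+1))%:R = (2 * n)%:R - M%:R :> R.
  by rewrite -natrB; [congr _%:R; rewrite /M; move: nX; ilia|rewrite /M; move: nX; ilia].
rewrite nE in gz; move: Hfin; rewrite -/M.
have gz' : (2 * n)%:R * Lam - M%:R * Lam + E0 <=
   En S2 (- ((n - a.+1) * p)%N%:Z) (2 * (n - a.+1) * p) z by move: gz; rewrite mulrBl.
move: gz' blk gD fzm fzp a6 b6 spl.
set t1 := (2 * n)%:R * Lam; set t2 := M%:R * Lam; set t3 := C2 * _; set t4 := En S2 A N y.
move: (En S2 A N yA) (En S2 A N yB) (En S2 A N yC) (En S2 A N yD) (En S2 A N zm) (En S2 A N zp)
  (En S2 A (M * p) y) (En S2 _ _ z) => f1 f2 f3 f4 f5 f6 f7 f8.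
move: (E0) t1 t2 t3 t4; clear -R => *; lra.
Qed.

End Barrier.

(** * Placing the bumps *)

Section Construction.
Variable R : realType.
Implicit Types (u v w x y z : int -> R) (A i j k l P Q : int) (n m M N a : nat).

(** Pigeonhole modulo 1: [n.+1] disjoint intervals fit in one period, and [h] gives for each point
    the index of the only one it can lie in. *)
Lemma free_interval (pts : seq R) (c len : R) n :
  0 < len -> (n.+1)%:R * len <= 1 -> (size pts <= n)%N ->
  exists j : nat, (j <= n)%N /\ forall t, t \in pts -> forall l : int,
    ~ (c + j%:R * len < t + l%:~R < c + j.+1%:R * len).
Proof.
move=> len0 nlen sz.
pose h t := absz (Num.floor ((t - (Num.floor (t - c))%:~R - c) / len)).
have [j jn jN] : exists2 j, (j <= n)%N & j \notin map h pts.
  apply: contrapT => H.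
  have sub : {subset iota 0 n.+1 <= map h pts}.
    move=> j; rewrite mem_iota add0n ltnS /= => jn.
    by apply/negPn/negP => jN; apply: H; exists j.
  have := uniq_leq_size (iota_uniq 0 n.+1) sub; rewrite size_iota size_map.
  by move=> /leq_trans/(_ sz); rewrite ltnn.
exists j; split=> // t tp l /andP[h1 h2]; move/negP: jN; apply.
apply/mapP; exists t => //; rewrite /h.
have j0 : 0 <= j%:R * len by rewrite mulr_ge0// ltW.
have j1 : j.+1%:R * len <= 1.
  by apply: le_trans nlen; apply: ler_wpM2r; [exact: ltW|rewrite ler_nat; lia].
have -> : Num.floor (t - c) = - l.
  by apply: floor_def; rewrite intrD !intrN; lra.
have -> : Num.floor ((t - (- l)%:~R - c) / len) = j%:Z; last by [].
apply: floor_def; rewrite intrN ler_pdivlMr// ltr_pdivrMr// intrD.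
by rewrite -natr1 in h2; rewrite -[j%:Z%:~R]/(j%:R); apply/andP; split; lra.
Qed.

(** The order [g ^ k] is what a bound on [k] derivatives allows for the height of a bump of width
    [g]. The height is guaranteed on the middle third only. *)
Definition bump_family (Reg : (R -> R) -> Prop) (k : nat) (w0 : R) : Prop :=
  forall c g, 0 < g -> g <= 1 -> exists V, [/\ sitepot V, Reg V,
    (forall t, (forall l : int, ~ (c < t + l%:~R < c + g)) -> V t = 0) &
    (forall t, c + g / 3 <= t <= c + 2 * g / 3 -> w0 * g ^+ k <= V t)].

(** Chebyshev's inequality, with the visits returned as a list. *)
Lemma count_visits (W K : R) (f : int -> R) A N :
  0 < W -> (forall i, 0 <= f i) -> Ds A N f <= K ->
  exists s : seq int, (size s <= Num.truncn (K / W))%N /\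
    forall i, A <= i < A + N%:Z -> W <= f i -> i \in s.
Proof.
move=> W0 f0 H; pose t := [seq A + n%:Z | n <- iota 0 N].
exists [seq i <- t | W <= f i]; split; last first.
  move=> i iA Wi; rewrite mem_filter Wi; apply/mapP; exists (absz (i - A)%R); last by lia.
  by rewrite mem_iota; lia.
have tE : \sum_(i <- t) f i = Ds A N f.
  rewrite big_map -{1}[N]subn0 -/(index_iota 0 _) big_mkord.
  by apply: eq_bigr.
have : (size [seq i <- t | W <= f i])%:R * W <= K.
  apply: le_trans H; rewrite -tE.
  have -> (s : seq int) : (size s)%:R * W = \sum_(i <- s) W.
    by rewrite (big_nth 0) sumr_const_nat subn0 mulr_natl.
  rewrite big_filter [leRHS](bigID (fun i => W <= f i)) /= -[leLHS]addr0 lerD//.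
    exact: ler_sum.
  exact: sumr_ge0.
rewrite -ler_pdivlMr// => h; rewrite truncn_ge_nat//.
by apply: le_trans h.
Qed.

(* The core bump lives on a fraction of the gap inversely proportional to the number
   of visits allowed by the first bump; hence the exponent [k * (k + 1)]. *)
Lemma core_height (w0 K g : R) (k : nat) :
  0 < w0 -> w0 <= 1 -> 0 < K -> 0 < g -> g <= 1 ->
  let n := Num.truncn (K / (w0 * g ^+ k)) in
  w0 * (w0 / (3 * (K + 1))) ^+ k * g ^+ (k * k.+1) <=
  w0 * (g / (3 * n.+1%:R)) ^+ k.
Proof.
move=> w00 w01 K0 g0 g1 /=; set n := Num.truncn _.
have W0 : 0 < w0 * g ^+ k by rewrite mulr_gt0// exprn_gt0.
have W1 : w0 * g ^+ k <= 1.
  apply: mulr_ile1 => //; [exact: ltW|exact/exprn_ge0/ltW|].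
  by apply: exprn_ile1 => //; exact: ltW.
have n1 : n.+1%:R * (w0 * g ^+ k) <= K + 1.
  have : n%:R <= K / (w0 * g ^+ k) by rewrite truncn_le; apply: divr_ge0; exact: ltW.
  by rewrite ler_pdivlMr// -natr1; lra.
have n0 : 0 < n.+1%:R :> R by rewrite ltr0n.
have K10 : 0 < 3 * (K + 1) by lra.
have H : w0 / (3 * (K + 1)) * g ^+ k.+1 <= g / (3 * n.+1%:R).
  rewrite ler_pdivlMr; last by rewrite mulr_gt0.
  have -> : w0 / (3 * (K + 1)) * g ^+ k.+1 * (3 * n.+1%:R) =
      g * ((n.+1%:R * (w0 * g ^+ k)) / (K + 1)).
    by rewrite exprS; field; apply: lt0r_neq0; lra.
  apply: ler_piMr; first exact: ltW.
  by rewrite ler_pdivrMr; lra.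
rewrite -mulrA ler_wpM2l ?(ltW w00)// mulnC exprM -exprMn lerXn2r// nnegrE.
  by rewrite mulr_ge0 ?exprn_ge0 ?(ltW g0)// divr_ge0 ?(ltW w00) ?(ltW K10).
by rewrite divr_ge0 ?(ltW g0)// mulr_ge0// ltW.
Qed.

(** With [a] of order [1 / W], the seams cost a constant times [beta / W], which is at most [W / 2]
    once [beta] is of order [W ^ 2]. Near-minimality takes another [W / 8] and the two exchanges
    [W / 4]. *)
Lemma surgery_budget (C2 r4 Ka W beta e : R) :
  let a := (Num.truncn (Ka / W)).+1 in
  0 < C2 -> 0 < r4 -> 0 < Ka -> 0 < W -> W <= 1 -> 0 < beta ->
  2 * (3 * C2 * r4 * (2 * Ka + 4)) * beta <= W ^+ 2 -> e <= W / 16 ->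
  3 * (C2 * (r4 * ((2 * a + 2)%:R * beta))) + 2 * e + 2 * (W / 8) < W.
Proof.
move=> a C20 r40 Ka0 W0 W1 b0 Hb He.
have aW : (2 * a + 2)%:R * W <= 2 * Ka + 4.
  have : (Num.truncn (Ka / W))%:R <= Ka / W.
    by rewrite truncn_le; apply: divr_ge0; exact: ltW.
  rewrite ler_pdivlMr// natrD natrM /a -natr1; lra.
have P0 : 0 < 3 * C2 * r4 * beta by rewrite !mulr_gt0.
have H : 3 * (C2 * (r4 * ((2 * a + 2)%:R * beta))) * W <= W * W / 2.
  have := ler_wpM2l (ltW P0) aW; move: Hb; rewrite expr2; lra.
have : 3 * (C2 * (r4 * ((2 * a + 2)%:R * beta))) <= W / 2.
  by rewrite -(ler_pM2r W0); lra.
lra.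
Qed.

(** If no step passed above [b], the bound [f n <= b] would spread from [lo] to all integers,
    including [hi]. *)
Lemma last_step (f : int -> R) (b : R) (lo hi : int) : f lo <= b -> b < f hi ->
  (forall n : int, f n <= f (n + 1)) -> exists n : int, f n <= b /\ b < f (n + 1).
Proof.
move=> flo fhi mono; apply: contrapT => H.
have up : forall n : nat, f (lo + n%:Z) <= b.
  elim=> [|n IH]; first by rewrite addr0.
  rewrite leNgt; apply/negP => h; apply: H; exists (lo + n%:Z); split=> //.
  by rewrite (_ : lo + n%:Z + 1 = lo + n.+1%:Z)//; lia.
have dn : forall n : nat, f (lo - n%:Z) <= b.
  elim=> [|n IH]; first by rewrite subr0.
  by apply: le_trans (mono _) _; rewrite (_ : lo - n.+1%:Z + 1 = lo - n%:Z)//; lia.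
have [h|h] := leP lo hi.
  by have := up (absz (hi - lo)%R); rewrite (_ : lo + _ = hi); [lra|lia].
by have := dn (absz (hi - lo)%R); rewrite (_ : lo - _ = hi); [lra|lia].
Qed.

Context r C al (S : int -> (int -> R) -> R) (HS : pot r C al S) (mE : minEx S).
Context (r0 : (0 < r)%N) (B w0 : R) (k : nat) (Reg : (R -> R) -> Prop).
Context (B0 : 0 <= B) (w00 : 0 < w0) (w01 : w0 <= 1) (HB : bump_family Reg k w0).

Ltac only_goal := clear - HS mE r0 B0 w00 w01 HB; intros.

(* [V1] sits in a gap of the orbit of the periodic minimizer [x], so the number of
   visits of a crossing to its core is bounded; [V2] sits there, off such a crossing. *)
Theorem destroying_bumps : exists2 cb : R, 0 < cb &
  forall (p : nat) (q : int), (5 * r < p)%N -> `|q%:~R / p%:R| <= B ->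
  exists V1 V2 em ep,
  [/\ sitepot V1 /\ Reg V1, sitepot V2 /\ Reg V2, em < ep &
      forall (Om : R) y, 0 < p%:R * Om - q%:~R ->
        (p%:R * Om - q%:~R) * p%:R ^+ (2 * (k * k.+1)) <= cb -> `|Om| <= B ->
        locally_minimal r (addV V2 (addV V1 S)) y ->
        (forall i, y i <= sh p q y i) ->
        (forall i l, `|y (i + l) - y i - l%:~R * Om| <= 1) ->
        ~ (em < y 0 < ep)].
Proof.
pose C2 := C1 r (C + 1 + 1); pose L := (6 * r)%:R * B + 3.
pose K := C1 r (C + 1) * (8 * r)%:R + 1.
have Cp : 0 < C := pot_C0 HS.
have rn : 0 < (2 * r + 1)%:R :> R by rewrite ltr0n; lia.
have C20 : 0 < C2 by rewrite /C2 /C1 mulr_gt0//; lra.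
have K0 : 0 < K.
  by rewrite /K ltr_wpDl// mulr_ge0 ?ler0n// /C1 mulr_ge0 ?(ltW rn)//; lra.
have L0 : 0 < L by rewrite /L ltr_wpDl// mulr_ge0.
pose gn := gain r (C + 1 + 1) al L; pose r4 : R := (4 * r)%:R.
have r40 : 0 < r4 by rewrite /r4 ltr0n; lia.
(* For the [d0] chosen below, [G1 * W2] is the gain per window, so that about [Ka / W2] windows pay
   for a cut, and [Kb] is the seam constant of [surgery_budget]. The power of 2 in [w1] absorbs
   [p + 1 <= 2 * p]. All these constants precede [p]. *)
pose G1 := gn / (16 * C2 * r4 ^+ 2).
pose Ka := C2 * (r4 * L) ^+ 2 / G1.
pose Kb := 3 * C2 * r4 * (2 * Ka + 4).
pose w1 := w0 * (w0 / (3 * (K + 1))) ^+ k / 2 ^+ (k * k.+1).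
have w10 : 0 < w1.
  by rewrite /w1 divr_gt0 ?exprn_gt0// mulr_gt0// exprn_gt0// divr_gt0//; lra.
have gn0 : 0 < gn.
  have [V [HV _ _ _]] := HB 0 ltr01 (lexx 1).
  exact: gain_gt0 (pot_addV (pot_addV HS HV) HV) _.
have G10 : 0 < G1.
  by rewrite /G1 divr_gt0// mulr_gt0 ?exprn_gt0//; lra.
have Ka0 : 0 < Ka by rewrite /Ka divr_gt0// mulr_gt0// exprn_gt0// mulr_gt0.
have Kb0 : 0 < Kb.
  by rewrite /Kb; apply: mulr_gt0; [apply: mulr_gt0 => //; lra|lra].
exists (w1 ^+ 2 / (2 * Kb)); first by rewrite divr_gt0 ?exprn_gt0//; lra.
move=> p q rp qB; have rp2 : (2 * r < p)%N by ilia.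
have p0 : 0 < p%:R :> R by rewrite ltr0n; ilia.
have [x Hx] := mE (leq_ltn_trans (leq0n _) rp2) q.
pose g : R := (p.+1%:R)^-1.
have g0 : 0 < g by rewrite invr_gt0 ltr0n.
have g1 : g <= 1 by rewrite invf_le1 ?ltr0n// ler1n.
have [j [_ jfree]] := @free_interval [seq x n%:Z | n <- iota 0 p] 0 g p g0
  ltac:(by rewrite mulfV ?pnatr_eq0) ltac:(by rewrite size_map size_iota).
pose c := 0 + j%:R * g.
have xfree i (l : int) : ~ (c < x i + l%:~R < c + g).
  have pZ : 0 < p%:Z by ilia.
  have m0 := modz_ge0 i (lt0r_neq0 pZ); have mp := ltz_pmod i pZ.
  have -> : x i = x (i %% p%:Z)%Z + ((i %/ p%:Z)%Z * q)%:~R.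
    have := per_div 0 i Hx.1; rewrite subr0 add0r intrM => -> //; exact: lt0r_neq0.
  set m := modz i p%:Z in m0 mp *.
  rewrite -addrA -intrD => h; apply: (jfree (x m) _ ((i %/ p%:Z)%Z * q + l)).
    apply/mapP; exists (absz m); first by rewrite mem_iota add0n /=; ilia.
    by congr x; ilia.
  by rewrite -natr1 mulrDl mul1r addrA.
have [V1 [HV1 RV1 V1out V1in]] := HB c g0 g1.
have V1x i : V1 (x i) = 0 by apply: V1out => l; exact: xfree.
pose W1 := w0 * g ^+ k; have W10 : 0 < W1 by rewrite mulr_gt0// exprn_gt0.
pose n1 := Num.truncn (K / W1); pose g2 := g / (3 * n1.+1%:R).
have n10 : 0 < n1.+1%:R :> R by rewrite ltr0n.
have g20 : 0 < g2 by rewrite divr_gt0// mulr_gt0.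
have g2E : n1.+1%:R * g2 = g / 3.
  by rewrite /g2; move: (n1.+1%:R : R) n10 => t t0; field; exact: lt0r_neq0.
have g21 : g2 <= 1.
  have : g2 <= n1.+1%:R * g2 by rewrite ler_peMl ?(ltW g20)// ler1n.
  by rewrite g2E; lra.
pose W2 := w0 * g2 ^+ k.
have W20 : 0 < W2 by rewrite mulr_gt0// exprn_gt0.
have W21 : W2 <= 1.
  apply: mulr_ile1 => //; [exact: ltW|exact/exprn_ge0/ltW|].
  by apply: exprn_ile1 => //; exact: ltW.
have W2big : w1 / p%:R ^+ (k * k.+1) <= W2.
  apply: le_trans (core_height k w00 w01 K0 g0 g1).
  rewrite /w1 -mulrA; apply: ler_wpM2l.
    by rewrite mulr_ge0 ?(ltW w00)// exprn_ge0// divr_ge0 ?(ltW w00)//; lra.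
  rewrite -invfM -exprMn -exprVn; apply: lerXn2r; rewrite ?nnegrE ?invr_ge0 ?(ltW g0)//.
  rewrite /g lef_pV2 ?posrE ?ltr0n// ?mulr_gt0// -natrM ler_nat; ilia.
pose e := Num.min 1 (Num.min (W2 / 16) (G1 * W2)).
have e0 : 0 < e by rewrite !lt_min ltr01 divr_gt0//= mulr_gt0.
have [A [M [z [cz bz mz Hz]]]] := crossing_monotone HS mE r0 rp2 Hx HV1 V1x e0.
have visits : Ds A (M * p) (fun i => V1 (z i)) <= K.
  apply: le_trans (crossing_visits HS mE r0 rp2 Hx HV1 V1x cz Hz) _.
  by rewrite /K lerD2l /e ge_min lexx.
have [s [ss sI]] := count_visits W10 (fun i => site_ge0 HV1 (z i)) visits.
have [j2 [j2n j2free]] := @free_interval [seq z i | i <- s] (c + g / 3) g2 n1 g20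
  ltac:(by rewrite g2E; lra) ltac:(by rewrite size_map).
pose b := c + g / 3 + j2%:R * g2.
have b_lo : c + g / 3 <= b by rewrite /b lerDl mulr_ge0// ltW.
have b_hi : b + g2 <= c + 2 * g / 3.
  have : j2.+1%:R * g2 <= n1.+1%:R * g2 by rewrite ler_wpM2r ?(ltW g20)// ler_nat.
  by rewrite g2E /b -natr1; lra.
have zfree i (l : int) : ~ (b < z i + l%:~R < b + g2).
  move=> /andP[h1 h2]; have Wz : W1 <= V1 (z i).
    rewrite -(site_perz (z i) l HV1); apply: V1in.
    by move: h1 h2 b_lo b_hi; only_goal; apply/andP; split; lra.
  have iA : A <= i < A + (M * p)%N%:Z.
    apply/negPn/negP => iA; have : V1 (z i) = 0; last by lra.
    have [ii|ii] := ltP i A; first by rewrite cz.1// ?V1x//; ilia.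
    rewrite cz.2; last by ilia.
    by rewrite (site_per HV1) V1x.
  apply: (j2free (z i) _ l); first by apply/map_f/sI.
  rewrite -/b h1 (_ : c + g / 3 + j2.+1%:R * g2 = b + g2)// /b.
  by rewrite -[j2.+1%:R]natr1 mulrDl mul1r addrA.
have [V2 [HV2 RV2 V2out V2in]] := HB b g20 g21.
have V2z i : V2 (z i) = 0 by apply: V2out => l; exact: zfree.
(* The left end of the core interval is moved into [[x 0, x 0 + 1)], the range through which the
   shifts of [z] rise at site 0. As they avoid the interval, two consecutive ones enclose it. *)
pose l0 := - Num.floor (b - x 0).
pose b0 := b + l0%:~R.
have b0lo : x 0 <= b0 by have := floor_le_tmp (b - x 0); rewrite /b0 /l0 intrN; only_goal; lra.
have b0hi : b0 < x 0 + 1.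
  by have := floorD1_gt (b - x 0); rewrite /b0 /l0 intrN intrD; only_goal; lra.
pose f (n : int) := sh (n * p%:Z) (n * q) z 0.
have fmono (n : int) : f n <= f (n + 1).
  have := mz (n * p%:Z); rewrite /f /sh !add0r mulrDl mul1r (_ : (n + 1) * q = n * q + q); last by ilia.
  by rewrite intrD; only_goal; lra.
have ffree (n : int) : f n <= b0 \/ b0 + g2 <= f n.
  have [h|h] := leP (f n) b0; [by left|right].
  rewrite leNgt; apply/negP => h2; apply: (zfree (n * p%:Z) (- (n * q) - l0)).
  move: h h2; rewrite /f /sh add0r /b0 intrB intrN ; only_goal; apply/andP; split; lra.
have [n [fn fn1]] : exists n : int, f n <= b0 /\ b0 < f (n + 1).
  pose K1 : int := (absz A)%:Z + (absz (A + (M * p)%N%:Z)%R)%:Z + r%:Z + 1.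
  apply: (@last_step f b0 (- K1) (K1 + 1)) => //.
    rewrite /f /sh add0r cz.1; last by rewrite /K1; inia.
    by have := per_mulz (- K1) 0 Hx.1; rewrite add0r => ->; move: b0lo; only_goal; lra.
  have h : K1 + 1 <= (K1 + 1) * p%:Z by rewrite /K1; inia.
  rewrite /f /sh add0r cz.2; last by move: h; rewrite /K1; ilia.
  have := per_mulz (K1 + 1) 0 Hx.1; rewrite add0r => ->; move: b0hi; only_goal; lra.
have [//|fn1'] := ffree (n + 1); first by move: fn1; only_goal; lra.
pose zs := sh (n * p%:Z) (n * q) z.
have [czs Fzs] := crossing_sh r0 rp Hx n (pot_addV HS HV1) cz.
exists V1, V2, (b0 + g2 / 3), (b0 + 2 * g2 / 3); split => //; first lra.
move=> Om y be0 be1 OmB ymin ym yb /andP[y1 y2].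
have W2sq : 2 * Kb * (p%:R * Om - q%:~R) <= W2 ^+ 2.
  have pk : 0 < p%:R ^+ (2 * (k * k.+1)) :> R by rewrite exprn_gt0.
  move: be1; rewrite -ler_pdivlMr// => be1.
  apply: le_trans (_ : 2 * Kb * (w1 ^+ 2 / (2 * Kb) / p%:R ^+ (2 * (k * k.+1))) <= _).
    by rewrite ler_wpM2l//; move: Kb0; only_goal; lra.
  have -> : 2 * Kb * (w1 ^+ 2 / (2 * Kb) / p%:R ^+ (2 * (k * k.+1))) = (w1 / p%:R ^+ (k * k.+1)) ^+ 2.
    have -> : p%:R ^+ (2 * (k * k.+1)) = (p%:R ^+ (k * k.+1)) ^+ 2 :> R.
      by rewrite -exprM mulnC.
    have := exprn_gt0 (k * k.+1) p0; move: (p%:R ^+ (k * k.+1)) => t t0.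
    by move: (Kb) Kb0 (w1) => t1 t10 t2; field; rewrite !lt0r_neq0.
  apply: lerXn2r => //; rewrite nnegrE; last exact: ltW.
  by rewrite divr_ge0 ?(ltW w10)// exprn_ge0// ltW.
(* Chosen so that [C2 * d0 ^ 2] is exactly the share [W2 / 8] of the budget granted to one
   exchange. *)
pose d0 := Num.sqrt (W2 / (8 * C2)).
have C28 : 0 < 8 * C2 by rewrite mulr_gt0.
have d0sq : d0 ^+ 2 = W2 / (8 * C2) by rewrite sqr_sqrtr// divr_ge0// ltW.
have d00 : 0 < d0 by rewrite sqrtr_gt0 divr_gt0.
have G1E : gn * (d0 / r4) ^+ 2 / 2 = G1 * W2.
  by rewrite expr_div_n d0sq /G1; field; rewrite (lt0r_neq0 C20) /= ?andbT lt0r_neq0// ltr0n.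
have eW : e <= W2 / 16 by rewrite /e !ge_min lexx orbT.
pose a := (Num.truncn (Ka / W2)).+1.
have bud := surgery_budget C20 r40 Ka0 W20 W21 be0 W2sq eW.
apply: (@no_minimizer_near_core _ _ _ _ _ HS mE r0 p q x rp Hx V1 V2 HV1 V1x HV2 y zs Om B
  W2 d0 (W2 / 8) e _ M a czs) => //.
- move=> i; have := bz (i + n * p%:Z); have := per_mulz n i Hx.1; rewrite /zs /sh; only_goal; lra.
- move=> i; rewrite /zs /sh; have := mz (i + n * p%:Z); rewrite /sh.
  by rewrite (_ : i + n * p%:Z + p%:Z = i + p%:Z + n * p%:Z); [by only_goal; lra|ilia].
- by rewrite Fzs.
- by move=> i; rewrite /zs /sh -intrN (site_perz _ _ HV2).
- by move: fn; rewrite -/(f n) => fn; apply: le_trans fn _; move: y1 g20; only_goal; lra.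
- suff -> : sh p q zs 0 = f (n + 1) by move: fn1' y2 g20; only_goal; lra.
  rewrite /zs /f /sh !add0r mulrDl mul1r [p%:Z + _]addrC (_ : (n + 1) * q = n * q + q); last by ilia.
  by rewrite intrD; only_goal; lra.
- rewrite -(site_perz (y 0) (- l0) HV2) intrN; apply: V2in.
  by move: y1 y2; rewrite /b0; only_goal; apply/andP; split; lra.
- by rewrite d0sq -/C2; rewrite le_eqVlt; apply/orP; left; apply/eqP; field; exact: lt0r_neq0.
- by rewrite -/L -/gn -/r4 G1E /e !ge_min lexx !orbT.
- rewrite -/L -/gn -/r4 G1E -/C2.
  have := truncnS_gt (Ka / W2); rewrite -/a ltr_pdivrMr// => /ltW h.
  have -> : C2 * (r4 * L) ^+ 2 = Ka * G1 by rewrite /Ka; field; exact: lt0r_neq0.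
  have h' : Ka <= a%:R * W2 := h.
  by have := ler_wpM2l (ltW G10) h'; only_goal; lra.
Qed.

End Construction.

(** * Smooth bumps *)

Section Glue.
Variable R : realType.
Implicit Types (P Q : {poly R}) (s t c g A : R).

(** Carathéodory's criterion: the difference quotient at [s] is [w]. It serves at the gluing points,
    where [w] is defined piecewise. *)
Lemma is_derive_factor (f w : R -> R) s : w x @[x --> s] --> w s ->
  (\forall t \near s, f t = (t - s) * w t) -> is_derive s 1 f (w s).
Proof.
move=> cw ff; have fs : f s = 0 by rewrite (nbhs_singleton ff) subrr mul0r.
suff H : h^-1 *: ((f \o shift s) (h *: (1 : R)) - f s) @[h --> 0^'] --> w s.
  by apply: DeriveDef; [apply/cvg_ex; exists (w s)|exact: cvg_lim].
have hs : (h + s) @[h --> (0 : R)] --> (s : R).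
  by rewrite -[X in _ --> X]add0r; apply: cvgD; [exact: cvg_id|exact: cvg_cst].
have H2 : w (h + s) @[h --> 0^'] --> w s.
  by apply: cvg_within_filter; exact: (cvg_comp _ _ hs cw).
have ff0 : \forall h \near (0 : R), f (h + s) = (h + s - s) * w (h + s).
  exact: (hs _ ff).
have ff1 : \forall h \near (0 : R)^', f (h + s) = (h + s - s) * w (h + s).
  by apply: nbhs_dnbhs; exact: ff0.
apply: (cvg_trans _ H2); apply: (@near_eq_cvg R R (0 : R)^' _ (fun h => w (h + s))).
near=> h.
have h0 : h != 0 by near: h; exact: nbhs_dnbhs_neq.
rewrite /= fs subr0 /GRing.scale /= mulr1.
have -> : f (h + s) = h * w (h + s) by rewrite -[X in X * w _](addrK s); near: h; exact: ff1.
by rewrite mulrA mulVf// mul1r.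
Unshelve. all: by end_near. Qed.

(** Polynomials suffice because only finitely many derivatives matter: a high order of vanishing at
    0 and 1 ensures smoothness, and derivatives are again of this form. *)
Definition glue P : R -> R := fun s => if 0 < s < 1 then P.[s] else 0.

Lemma near_lt_l (a s : R) : s < a -> \forall t \near s, t < a.
Proof. by move=> sa; exact: lt_nbhsl. Qed.

Lemma near_gt_r (a s : R) : a < s -> \forall t \near s, a < t.
Proof. by move=> sa; exact: lt_nbhsr. Qed.

Lemma glue_derive P s : P.[0] = 0 -> P.[1] = 0 -> (P^`()).[0] = 0 -> (P^`()).[1] = 0 ->
  is_derive s 1 (glue P) (glue (P^`()) s).
Proof.
move=> P0 P1 dP0 dP1.
have [s0|s0|s0] := ltgtP 0 s; last first.
- have /factor_theorem[Q PQ] : root P 0 by apply/eqP.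
  rewrite subr0 in PQ.
  have Q0 : Q.[0] = 0.
    by move: dP0; rewrite PQ derivM derivX mulr1 hornerD hornerMX mulr0 add0r.
  rewrite -s0 /glue ltxx /=.
  (* Clamping the argument makes the cofactor continuous: it is [Q] to the right of 0 and [Q.[0] =
     0] to the left. *)
  have cQ : {for (0 : R), continuous (fun h : R => Q.[Num.max 0 h])}.
    apply: (@continuous_comp _ _ _ (fun h : R => Num.max 0 h) (horner Q)).
      by apply: continuous_max; [exact: cst_continuous|exact: cvg_id].
    exact: continuous_horner.
  have := is_derive_factor (f := glue P) cQ.
  rewrite maxxx Q0; apply.
  near=> h; rewrite subr0 /glue.
  have h1 : h < 1 by near: h; apply: near_lt_l.
  rewrite h1 andbT; case: ltP => h0; last by rewrite Q0 mulr0.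
  by rewrite PQ hornerMX mulrC.
- rewrite [X in is_derive _ _ _ X](_ : _ = 0); last by rewrite /glue ltNge (ltW s0).
  apply: (near_eq_is_derive (f := cst 0)) => //; near=> h; rewrite /glue ifF//.
  by apply/negbTE; rewrite negb_and -!leNgt; apply/orP; left; apply/ltW; near: h; exact: near_lt_l.
have [s1|s1|s1] := ltgtP s 1; last first.
- have /factor_theorem[Q PQ] : root P 1 by apply/eqP.
  have Q1 : Q.[1] = 0.
    by move: dP1; rewrite PQ derivM derivXsubC mulr1 hornerD hornerM hornerXsubC subrr mulr0 add0r.
  rewrite s1 /glue ltxx andbF.
  have cQ : {for (1 : R), continuous (fun h : R => Q.[Num.min 1 h])}.
    apply: (@continuous_comp _ _ _ (fun h : R => Num.min 1 h) (horner Q)).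
      by apply: continuous_min; [exact: cst_continuous|exact: cvg_id].
    exact: continuous_horner.
  have := is_derive_factor (f := glue P) cQ.
  rewrite minxx Q1; apply.
  near=> h; rewrite /glue.
  have h0 : 0 < h by near: h; apply: near_gt_r.
  rewrite h0 /=; have [h1|h1] := ltP h 1; last by rewrite Q1 mulr0.
  by rewrite PQ hornerM hornerXsubC mulrC.
- rewrite [X in is_derive _ _ _ X](_ : _ = 0); last by rewrite /glue [s < 1]ltNge (ltW s1) andbF.
  apply: (near_eq_is_derive (f := cst 0)) => //; near=> h; rewrite /glue ifF//.
  by apply/negbTE; rewrite negb_and -!leNgt; apply/orP; right; apply/ltW; near: h; exact: near_gt_r.
rewrite /glue s0 s1 /=.
apply: (near_eq_is_derive (f := horner P)) => //; near=> h; rewrite /glue ifT//.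
by apply/andP; split; near: h; [exact: near_gt_r|exact: near_lt_l].
Unshelve. all: by end_near. Qed.

Definition pbump A c g P : R -> R :=
  fun t => A * glue P ((t - c - (Num.floor (t - c))%:~R) / g).

Lemma glue_out P s : s <= 0 \/ 1 <= s -> glue P s = 0.
Proof.
by rewrite /glue => -[h|h]; rewrite ifF//; apply/negbTE; rewrite negb_and -!leNgt h ?orbT.
Qed.

(** The floor jumps at [c + n]. Written as the sum of two adjacent copies of [glue], the function
    can be differentiated across this point. *)
Lemma pbump_local A c g P (n : int) t : 0 < g -> g <= 1 ->
  c + n%:~R - 1 < t < c + n%:~R + 1 ->
  pbump A c g P t = A * (glue P ((t - (c + n%:~R)) / g) + glue P ((t - (c + n%:~R - 1)) / g)).
Proof.
move=> g0 g1 /andP[t1 t2]; rewrite /pbump; congr (_ * _).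
have [tn|tn] := leP (c + n%:~R) t.
  have -> : Num.floor (t - c) = n by apply: floor_def; rewrite intrD; lra.
  rewrite [glue P ((t - (c + n%:~R - 1)) / g)]glue_out ?addr0; first by congr (glue P (_ / g)); lra.
  by right; rewrite ler_pdivlMr//; lra.
have -> : Num.floor (t - c) = n - 1 by apply: floor_def; rewrite subrK intrB; lra.
rewrite [glue P ((t - (c + n%:~R)) / g)]glue_out ?add0r; first by congr (glue P (_ / g)); rewrite intrB; lra.
by left; rewrite ler_pdivrMr//; lra.
Qed.

Lemma pbump_derive A c g P t : 0 < g -> g <= 1 ->
  P.[0] = 0 -> P.[1] = 0 -> (P^`()).[0] = 0 -> (P^`()).[1] = 0 ->
  is_derive t 1 (pbump A c g P) (pbump (A / g) c g (P^`()) t).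
Proof.
move=> g0 g1 P0 P1 dP0 dP1; set n := Num.floor (t - c).
have n1 := floor_le_tmp (t - c); have n2 := floorD1_gt (t - c).
rewrite -/n intrD in n1 n2.
rewrite (@pbump_local _ c g _ n)//; last by apply/andP; split; lra.
pose aff (d t : R) := (t - d) / g.
have affE d x : is_derive x (1 : R) (aff d) g^-1.
  rewrite /aff; have -> : (fun t => (t - d) / g) = (g^-1 \*: (id - cst d)).
    by apply/funext => u; rewrite /= !fctE /GRing.scale /= mulrC.
  have := is_deriveZ g^-1 (is_deriveB (is_derive_id x (1 : R)) (is_derive_cst d x 1)).
  by rewrite subr0 /GRing.scale /= mulr1.
apply: (near_eq_is_derive (f := A \*: ((glue P \o aff (c + n%:~R)) + (glue P \o aff (c + n%:~R - 1))))).
  near=> u; rewrite (@pbump_local _ c g _ n)//.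
  by apply/andP; split; near: u; [apply: near_gt_r|apply: near_lt_l]; lra.
have d1 d : is_derive t (1 : R) (glue P \o aff d) (g^-1 * glue (P^`()) (aff d t)).
  by rewrite mulrC; apply: is_derive1_comp; exact: glue_derive.
have := is_deriveZ A (is_deriveD (d1 (c + n%:~R)) (d1 (c + n%:~R - 1))).
rewrite /GRing.scale /= -mulrDr mulrA; exact.
Unshelve. all: by end_near. Qed.

Definition vanishing m P : Prop := exists Q, P = ('X * (1 - 'X)) ^+ m * Q.

Lemma vanishing_deriv m P : vanishing m.+1 P -> vanishing m (P^`()).
Proof.
move=> [Q ->]; set W := 'X * (1 - 'X).
exists (W^`() *+ m.+1 * Q + W * Q^`()).
rewrite derivM deriv_exp /= mulrDr exprS; congr (_ + _); last by rewrite mulrCA mulrA.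
by rewrite -mulrnAl mulrA [W ^+ m * _]mulrC mulrnAl.
Qed.

Lemma vanishing_root m P : vanishing m.+1 P -> P.[0] = 0 /\ P.[1] = 0.
Proof.
move=> [Q ->]; rewrite exprS !hornerM !hornerD !hornerN !hornerX !hornerC.
by rewrite subrr !(mul0r, mulr0).
Qed.

Lemma vanishing_derivn m n P : vanishing (m + n) P -> vanishing m (P^`(n)).
Proof.
elim: n m => [|n IH] m; first by rewrite addn0.
by rewrite addnS -addSn derivnS => /IH/vanishing_deriv.
Qed.

Definition coefsum P := \sum_(i < size P) `|P`_i|.

Lemma glue_le P s : `|glue P s| <= coefsum P.
Proof.
have C0 : 0 <= coefsum P by apply: sumr_ge0.
rewrite /glue; case: ifPn => [/andP[s0 s1]|_]; last by rewrite normr0.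
rewrite horner_coef; apply: (le_trans (ler_norm_sum _ _ _)); apply: ler_sum => i _.
rewrite normrM ler_piMr// normrX exprn_ile1//.
by rewrite gtr0_norm// ltW.
Qed.

Lemma lipschitz_of_derive (f f' : R -> R) (C : R) :
  (forall x : R, is_derive x (1 : R) f (f' x)) -> (forall x, `|f' x| <= C) ->
  forall s t, `|f s - f t| <= C * `|s - t|.
Proof.
move=> df bf; suff H s t : s < t -> `|f t - f s| <= C * `|t - s|.
  move=> s t; have [st|st|->] := ltgtP s t.
  - by rewrite distrC [`|s - t|]distrC H.
  - exact: H.
  - by rewrite !subrr normr0 mulr0.
move=> st; have cf : {within `[s, t], continuous f}.
  by apply: derivable_within_continuous => x _; have [] := df x.
have [x _ ->] := MVT st (fun x _ => df x) cf.
by rewrite normrM ler_wpM2r.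
Qed.

Definition smooth_bound k e (V : R -> R) : Prop :=
  exists d : nat -> R -> R,
    [/\ d 0%N = V,
        forall n t, (n <= k)%N -> is_derive t (1 : R) (d n) (d n.+1 t) &
        forall n t, (n <= k)%N -> `|d n t| <= e].

Lemma sitepot_smooth k V : (2 <= k)%N -> smooth_bound k 1 V -> (forall t, 0 <= V t) ->
  (forall t, V (t + 1) = V t) -> sitepot V.
Proof.
move=> k2 [d [<- dd db]] V0 V1.
have k1 : (1 <= k)%N by apply: leq_trans k2.
have d0 t : is_derive t (1 : R) (d 0%N) (d 1%N t) by apply: dd.
have d1 t : is_derive t (1 : R) (d 1%N) (d 2%N t) by apply: dd.
have l0 s t : `|d 0%N s - d 0%N t| <= `|s - t|.
  by rewrite -[leRHS]mul1r; apply: lipschitz_of_derive d0 _ s t => x; exact: db.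
have l1 s t : `|d 1%N s - d 1%N t| <= `|s - t|.
  by rewrite -[leRHS]mul1r; apply: lipschitz_of_derive d1 _ s t => x; exact: db.
split => // t a b a0 b0.
have dh x : is_derive x (1 : R) (fun x => d 0%N (x + b) - d 0%N x) (d 1%N (x + b) - d 1%N x).
  apply: is_deriveB.
  have := @is_derive1_comp R (d 0%N) (fun x => x + b) x (d 1%N (x + b)) 1 (d0 _).
  rewrite mulr1; apply.
  by rewrite -[X in is_derive _ _ _ X]addr0; apply: is_deriveD.
have bh x : `|d 1%N (x + b) - d 1%N x| <= b.
  by apply: (le_trans (l1 _ _)); rewrite addrAC subrr add0r ger0_norm.
have := lipschitz_of_derive dh bh (t + a) t.
rewrite [t + a - t]addrAC subrr add0r (ger0_norm a0) mulrC; congr (`|_| <= _).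
by ring.
Qed.

Lemma smooth_boundW k e e' V : e <= e' -> smooth_bound k e V -> smooth_bound k e' V.
Proof. by move=> ee [d [d0 d1 d2]]; exists d; split => // n t nk; apply: le_trans ee; exact: d2. Qed.

Lemma smooth_bound_opp k e V : smooth_bound k e V -> smooth_bound k e (fun t => V (- t)).
Proof.
move=> [d [<- d1 d2]]; exists (fun n t => (-1) ^+ n * d n (- t)); split.
- by apply/funext => t; rewrite mul1r.
- move=> n t nk; rewrite exprS mulN1r mulNr -mulrN.
  have dc : is_derive t (1 : R) (fun t => d n (- t)) (d n.+1 (- t) * -1).
    exact: (@is_derive1_comp R (d n) (fun t => - t) t _ (-1) (d1 n (- t) nk)
      (is_deriveN (is_derive_id t (1 : R)))).
  by have := is_deriveZ ((-1) ^+ n) dc; rewrite mulrN1.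
- by move=> n t nk; rewrite normrM normrX normrN1 expr1n mul1r; exact: d2.
Qed.

Lemma smooth_bump_family k e : (2 <= k)%N -> 0 < e -> e <= 1 ->
  exists w0, [/\ 0 < w0, w0 <= 1 & bump_family (smooth_bound k e) k w0].
Proof.
(* The exponent [k.+2] makes the derivatives up to order [k.+1] vanish at 0 and 1, as [glue_derive]
   requires for each order up to [k]. *)
move=> k2 e0 e1; pose P : {poly R} := ('X * (1 - 'X)) ^+ k.+2.
pose Bk := 1 + \sum_(n < k.+1) coefsum (P^`(n)).
have cs0 Q : 0 <= coefsum Q by apply: sumr_ge0.
have Bk1 : 1 <= Bk by rewrite lerDl; apply: sumr_ge0.
have Bkn n : (n <= k)%N -> coefsum (P^`(n)) <= Bk.
  move=> nk; rewrite /Bk (bigD1 (inord n)) //= inordK// addrCA lerDl addr_ge0//.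
  by apply: sumr_ge0.
have vP n : (n <= k.+1)%N -> vanishing (k.+2 - n) (P^`(n)).
  by move=> nk; apply: vanishing_derivn; rewrite subnK ?(leqW nk)//; exists 1; rewrite mulr1.
have rP n : (n <= k.+1)%N -> (P^`(n)).[0] = 0 /\ (P^`(n)).[1] = 0.
  by move=> nk; apply: (@vanishing_root (k.+1 - n)); rewrite -subSn//; exact: vP.
have PE s : P.[s] = (s * (1 - s)) ^+ k.+2 by rewrite /P !hornerE.
have B0 : 0 < Bk by lra.
(* Here [2 / 9] is the minimum of [s * (1 - s)] on the middle third. *)
exists (e / Bk * (2 / 9) ^+ k.+2); split.
- by apply: mulr_gt0; [exact: divr_gt0|apply: exprn_gt0; lra].
- apply: mulr_ile1; [by apply: divr_ge0; lra|by apply: exprn_ge0; lra| |].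
    by rewrite ler_pdivrMr//; lra.
  by apply: exprn_ile1; lra.
move=> c g g0 g1; pose A := e * g ^+ k / Bk.
have A0 : 0 <= A by apply: divr_ge0; [apply: mulr_ge0; [|apply: exprn_ge0]|]; lra.
exists (pbump A c g P).
have sm : smooth_bound k e (pbump A c g P).
  exists (fun n => pbump (A / g ^+ n) c g (P^`(n))); split.
  - by rewrite expr0 divr1.
  - move=> n t nk.
    have [P0 P1] := rP n (leqW nk); have [P2 P3] := rP n.+1 nk.
    by rewrite derivnS exprSr invfM mulrA; apply: pbump_derive => //; rewrite -derivnS.
  - move=> n t nk; rewrite /pbump normrM.
    have An : `|A / g ^+ n| <= e / Bk.
      rewrite ger0_norm; last by apply: divr_ge0 => //; apply: exprn_ge0; lra.
      rewrite ler_pdivrMr ?exprn_gt0// /A mulrAC ler_pM2l; last exact: divr_gt0.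
      by apply: ler_wiXn2l => //; lra.
    apply: (le_trans (ler_pM _ _ An (le_trans (glue_le _ _) (Bkn n nk)))) => //.
    by rewrite divfK// gt_eqF.
split => //.
- apply: (sitepot_smooth k2 (smooth_boundW e1 sm)) => t.
    rewrite /pbump mulr_ge0// /glue; case: ifPn => // /andP[s0 s1].
    by rewrite PE; apply: exprn_ge0; apply: mulr_ge0; [exact: ltW|rewrite subr_ge0; exact: ltW].
  rewrite /pbump; congr (A * glue P (_ / g)).
  have n1 := floor_le_tmp (t - c); have n2 := floorD1_gt (t - c); rewrite intrD in n2.
  have -> : Num.floor (t + 1 - c) = Num.floor (t - c) + 1.
    by apply: floor_def; rewrite !intrD; apply/andP; split; lra.
  by rewrite intrD; lra.
- move=> t tV; rewrite /pbump /glue; case: ifPn => [|_]; last by rewrite mulr0.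
  rewrite pmulr_lgt0 ?invr_gt0// ltr_pdivrMr// mul1r => /andP[h1 h2]; case: (tV (- Num.floor (t - c))).
  by rewrite intrN; apply/andP; split; lra.
- move=> t /andP[t1 t2]; rewrite /pbump.
  have -> : Num.floor (t - c) = 0 by apply: floor_def; rewrite add0r; apply/andP; split; lra.
  have s1 : 1 / 3 <= (t - c - 0%:~R) / g by rewrite ler_pdivlMr//; lra.
  have s2 : (t - c - 0%:~R) / g <= 2 / 3 by rewrite ler_pdivrMr//; lra.
  set s := (t - c - _) / g in s1 s2 *.
  rewrite /glue ifT; last by apply/andP; split; lra.
  have L : (2 / 9 : R) ^+ k.+2 <= (s * (1 - s)) ^+ k.+2.
    by apply: lerXn2r; rewrite ?nnegrE; nra.
  rewrite PE mulrAC; have -> : e / Bk * g ^+ k = A by rewrite /A mulrAC.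
  exact: ler_wpM2l.
Qed.

End Glue.

(** * From the conditions to finite differences *)

Section Ptws.
Variable R : realType.

Lemma ptws_cvg (F : set_system (int -> R)) (f : int -> R) : Filter F ->
  (forall i, (fun g : int -> R => g i) @ F --> f i) -> {ptws, F --> f}.
Proof.
move=> FF H; apply/cvg_sup => i.
rewrite cvg_image; last by rewrite eqEsubset; split => // v _; exists (cst v).
move=> W Q; exists (@^~ i @^-1` W); first exact: H.
by rewrite eqEsubset; split => [j [? + <-//]|j Wj]; exists (fun=> j).
Qed.

Lemma ptws_eval (i : int) : continuous ((fun x => x i) : {ptws int -> R} -> R).
Proof. exact: (@proj_continuous int (fun=> R) i). Qed.

Lemma ptws_box_compact (M : R) :
  compact ([set x | forall i, - M <= x i <= M] : set {ptws int -> R}).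
Proof.
have H (i : int) : compact ([set t | - M <= t <= M] : set R).
  rewrite (_ : [set t | _] = [set` `[- M, M]]); first exact: segment_compact.
  by apply/seteqP; split => t; rewrite /= in_itv.
exact: (tychonoff (T := fun=> R) H).
Qed.

End Ptws.

Section Partial.
Variable R : realType.
Implicit Types (x y z : int -> R) (f : (int -> R) -> R) (i k l j : int).

Lemma section_derive f i x t : (forall y, derivable (section_at i f y) (y i) 1) ->
  is_derive t (1 : R) (fun t => f (upd x i t)) (partial i f (upd x i t)).
Proof.
move=> df.
have uE s : dfwith (upd x i t) i (x i + s) = upd x i s.
  apply/funext => j; rewrite /upd; case: dfwithP => [|j' ij]; first by rewrite eqxx.
  by rewrite eq_sym (negbTE ij).
have D : is_derive (x i + t) (1 : R) (section_at i f (upd x i t)) (partial i f (upd x i t)).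
  have := df (upd x i t); rewrite /partial derive1E upd_at => h; exact: DeriveDef.
have -> : (fun t => f (upd x i t)) = section_at i f (upd x i t) \o (fun s => x i + s).
  by apply/funext => s; rewrite /section_at /= uE.
have := @is_derive1_comp R (section_at i f (upd x i t)) (fun s => x i + s) t _ 1 D.
rewrite mulr1; apply.
by rewrite -[X in is_derive _ _ _ X]add0r; apply: is_deriveD.
Qed.

Lemma mvt_from0 (f f' : R -> R) s : (forall x : R, is_derive x (1 : R) f (f' x)) -> 0 <= s ->
  exists2 t, 0 <= t <= s & f s - f 0 = f' t * s.
Proof.
move=> df s0; have cf : {within `[0, s], continuous f}.
  by apply: derivable_within_continuous => x _; have [] := df x.
have [t] := MVT_segment s0 (fun u _ => df u) cf.
by rewrite subr0 in_itv /= => ts ->; exists t.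
Qed.

Lemma mixd_partial f x i s k t : Ck 2 f -> 0 <= s -> 0 <= t ->
  exists s' t', [/\ 0 <= s' <= s, 0 <= t' <= t &
    mixd f x i s k t = partials [:: i; k] f (upd (upd x i s') k t') * (s * t)].
Proof.
move=> [_ c2] s0 t0; have [dk [_ c1]] := c2 k; have [dik _] := c1 i.
have D1 b : is_derive b (1 : R) (fun b => f (upd (upd x i s) k b) - f (upd x k b))
    (partial k f (upd (upd x i s) k b) - partial k f (upd x k b)).
  by apply: is_deriveB; exact: section_derive.
have [t' tt E1] := mvt_from0 D1 t0.
have D2 a := section_derive (upd x k t') a dik.
have [s' ss E2] := mvt_from0 D2 s0.
exists s', t'; split => //=.
move: E1 E2; rewrite !upd0 /mixd [upd (upd x k t') i s]updC [upd (upd x k t') i s']updC => E1 E2.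
by rewrite mulrA -E2 -E1; ring.
Qed.

End Partial.

Section FromConditions.
Variable R : realType.
Variable S : int -> (int -> R) -> R.
Implicit Types (x y z u : int -> R) (i k l j : int).

(** The box is compact in the product topology by Tychonoff, and there a continuous negative
    function is bounded away from 0. *)
Lemma strict_box : (forall j, Ck 2 (S j)) -> condD S -> exists al : R -> R,
  (forall L, 0 < al L) /\ forall L k z, `|k| = 1 -> (forall i, `|z i| <= L) ->
    partials [:: 0; k] (S 0) z <= - al L.
Proof.
move=> c2 [_ D2].
have H (L : R) k : `|k| = 1 -> exists2 a, 0 < a & forall z, (forall i, `|z i| <= L) ->
    partials [:: 0; k] (S 0) z <= - a.
  move=> k1; have [_ /(_ k)[_ [_ /(_ 0)[_ [cg _]]]]] := c2 0.
  have [|c _ Hc] := @compact_EVT_max {ptws int -> R} R _ _ _ (@ptws_box_compact R `|L|)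
    (continuous_subspaceT cg).
    by exists (fun=> 0) => i /=; rewrite lerNl oppr0 normr_ge0.
  exists (- partials [:: 0; k] (S 0) c); first by rewrite oppr_gt0; apply: D2; lia.
  move=> z zL; rewrite opprK; apply: Hc; rewrite inE /= => i.
  by rewrite -ler_norml; apply: (le_trans (zL i)); exact: ler_norm.
have /choice[al Hal] : forall L : R, exists a, 0 < a /\ forall k z, `|k| = 1 ->
    (forall i, `|z i| <= L) -> partials [:: 0; k] (S 0) z <= - a.
  move=> L; have [a a0 Ha] := H L 1 erefl; have [b b0 Hb] := H L (-1) erefl.
  exists (Num.min a b); split; first by rewrite lt_min a0 b0.
  move=> k z k1 zL; have [->|->] : k = 1 \/ k = -1 by lia.
    by apply: (le_trans (Ha z zL)); rewrite lerN2 ge_min lexx.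
  by apply: (le_trans (Hb z zL)); rewrite lerN2 ge_min lexx orbT.
by exists al; split => [L|L k z]; have [h1 h2] := Hal L; [exact: h1|exact: h2].
Qed.

Lemma pot_of_conditions : conditions_AE S ->
  exists r C al, (0 < r)%N /\ pot r C al S.
Proof.
move=> [[[r0 A1] c2] B _ D [C C0 E]].
have [al [al0 Hal]] := strict_box c2 D.
set r := (absz r0).+1.
have loc j x y : (forall i, `|i - j| <= r%:Z -> x i = y i) -> S j x = S j y.
  by move=> xy; apply: A1 => i ij; apply: xy; move: ij; rewrite /r; lia.
have mx j x i s k t : 0 <= s -> 0 <= t -> `|mixd (S j) x i s k t| <= C * (s * t).
  move=> s0 t0; have [s' [t' [_ _ ->]]] := mixd_partial x i k (c2 j) s0 t0.
  by rewrite normrM ler_pM// ?(E i j k _).2// ger0_norm// mulr_ge0.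
exists r, C, (fun L => al (`|L| + 1)); split => //; split => //.
- move=> j x i t; have [_ /(_ i)[di _]] := c2 j.
  have := lipschitz_of_derive (section_derive x ^~ di) (fun t => (E i j i _).1) t 0.
  by rewrite upd0 subr0.
- move=> j x i k s t ik s0 t0; apply/andP; split.
    by have := mx j x i s k t s0 t0; rewrite ler_norml => /andP[].
  have [s' [t' [_ _ ->]]] := mixd_partial x i k (c2 j) s0 t0.
  by rewrite mulr_le0_ge0 ?mulr_ge0// D.1.
- by move=> j x i s t; exact: mx.
- move=> L j k c x s t kj s0 t0 H.
  pose n := Num.floor c.
  (* Condition B recentres the configuration at site 0 and near height 0; sites out of range are set
     to 0. The result lies in the box of size [|L| + 1], the 1 being lost in rounding [c] to [n]. *)
  pose T u : int -> R := fun i => if `|i| <= r%:Z then u (i + j) - n%:~R else 0.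
  have ST u : S j u = S 0 (T u).
    rewrite (B j (- j) (- n) u) subrr; apply: loc => i; rewrite subr0 => ir.
    by rewrite /T /shift_seq ir opprK intrN.
  have Tu u m a : `|m - j| <= r%:Z -> T (upd u m a) = upd (T u) (m - j) a.
    move=> mr; apply/funext => i; rewrite /T /upd.
    case: (eqVneq (i + j) m) => [E1|im].
      have ir : `|i| <= r%:Z by move: mr; rewrite -E1 addrK.
      by rewrite ir -E1 addrK eqxx addrAC.
    by case: (eqVneq i (m - j)) => [E2|//]; rewrite E2 subrK eqxx in im.
  have jr : `|j - j| <= r%:Z by rewrite subrr.
  have kr : `|k - j| <= r%:Z by rewrite kj /r; lia.
  have -> : mixd (S j) x j s k t = mixd (S 0) (T x) 0 s (k - j) t.
    by rewrite /mixd !ST !Tu// subrr.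
  have [s' [t' [/andP[s1 s2] /andP[t1 t2] ->]]] := mixd_partial (T x) 0 (k - j) (c2 0) s0 t0.
  rewrite -mulNr; apply: ler_wpM2r; first exact: mulr_ge0.
  apply: Hal => // i.
  have -> : upd (upd (T x) 0 s') (k - j) t' = T (upd (upd x j s') k t') by rewrite !Tu// subrr.
  rewrite /T; case: ifP => [ir|_]; last by rewrite normr0 addr_ge0.
  have [] := H (i + j); first by rewrite addrK.
  have n1 := floor_le_tmp c; have n2 := floorD1_gt c; rewrite -/n intrD in n1 n2.
  have L1 := ler_norm L.
  rewrite !ler_norml /upd => /andP[a1 a2] /andP[].
  by clear H E mx loc ST Tu; case: (i + j == k); case: (i + j == j) => b1 b2;
    move: s1 s2 t1 t2 a1 a2 b1 b2 n1 n2 L1; clear=> *; apply/andP; split; lra.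
Qed.

Definition coercive : Prop :=
  forall M : R, exists A : R, forall j x, A <= `|x (j + 1) - x j| -> M <= S j x.

Lemma coercive_of_condC : condB S -> condC S -> coercive.
Proof.
move=> B C M; have [A HA] := C 0 1 erefl M; exists A => j x jx.
rewrite (B j (- j) 0) subrr; apply: HA; rewrite /shift_seq !addr0 opprK.
by rewrite add0r [1 + j]addrC.
Qed.

(** Where the increment is small, changing [x (j + 1)] by [2 * |A|] makes it large, and the
    Lipschitz bound limits the effect of this change. *)
Lemma coercive_lb r C al : pot r C al S -> coercive -> exists m, forall j x, m <= S j x.
Proof.
move=> HS /(_ 0)[A HA]; have C0 := pot_C0 HS; exists (- (C * (2 * `|A|))) => j x.
have [h|h] := leP A `|x (j + 1) - x j|.
  by apply: (le_trans _ (HA j x h)); rewrite oppr_le0 !mulr_ge0// ltW.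
have {}h : `|x (j + 1) - x j| <= `|A| by apply: ltW; apply: (lt_le_trans h); exact: ler_norm.
have := HA j (upd x (j + 1) (2 * `|A|)); rewrite upd_at /upd ifF; last by lia.
move=> /(_ _)H; have {}H : 0 <= S j (upd x (j + 1) (2 * `|A|)).
  apply: H; apply: (le_trans (ler_norm A)); apply: le_trans (ler_norm _).
  by move: h; rewrite ler_norml => /andP[]; lra.
have := pot_lip HS j x (j + 1) (2 * `|A|); rewrite ler_norml => /andP[_].
by rewrite [`|2 * _|]ger0_norm ?mulr_ge0//; lra.
Qed.

(** The direct method. An energy below that of [u0] forces bounded increments, so that after an
    integer translation one period of [u] lies in a compact box. [closing] makes periodic
    configurations of the whole box, continuously. *)
Lemma minEx_of_coercive r C al : pot r C al S ->
  (forall j, continuous (S j : {ptws int -> R} -> R)) -> coercive -> minEx S.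
Proof.
move=> HS cS co P P0 Q; have [m mS] := coercive_lb HS co.
pose u0 : int -> R := closing 0 P Q (fun=> 0).
have u0p : per P Q u0 by exact: closing_per.
(* A single increment beyond [A] costs so much that, with at least [m] from each of the other
   [P - 1] terms, the total is no less than that of [u0]. *)
have [A HA] := co (En S 0 P u0 - P%:R * m + m).
pose B := 1 + P%:R * `|A|.
have cE : continuous ((fun v => En S 0 P (closing 0 P Q v)) : {ptws int -> R} -> R).
  rewrite /En /Ds; apply: continuous_big => [|i _]; first exact: add_continuous.
  have cc : continuous (closing 0 P Q : {ptws int -> R} -> {ptws int -> R}).
    move=> v.
    apply: (@ptws_cvg R (closing 0 P Q @ nbhs (v : {ptws int -> R})) (closing 0 P Q v)).
    move=> l; rewrite /closing; apply: cvgD; last exact: cvg_cst.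
    exact: (@ptws_eval R _ v).
  move=> v; exact: (continuous_comp (cc v) (@cS _ _)).
have B0 : 0 <= B by rewrite addr_ge0// mulr_ge0.
have [|c _ Hc] := @compact_EVT_min {ptws int -> R} R _ _ _ (@ptws_box_compact R B)
    (continuous_subspaceT cE).
  by exists (fun=> 0) => i /=; rewrite lerNl oppr0 B0.
exists (closing 0 P Q c); split; first exact: closing_per.
have clE u : per P Q u -> closing 0 P Q u = u.
  move=> up; apply/funext => i; rewrite /closing.
  by rewrite [RHS](per_div 0 i up)//; lia.
move=> u up.
have [h|h] := leP (En S 0 P u0) (En S 0 P u).
  apply: le_trans h; apply: Hc.
  by rewrite inE /= => i; rewrite lerNl oppr0 B0.
have inc i : `|u (i + 1) - u i| <= A.
  rewrite leNgt; apply/negP => /ltW/HA Hi; move: h; rewrite -(En_per HS i up) ltNge => /negP; apply.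
  have -> : En S i P u = S i u + En S (i + 1) P.-1 u.
    rewrite -[in LHS](prednK P0) -[P.-1.+1]add1n En_cat; congr (_ + _).
    by rewrite /En /Ds big_ord1 addr0.
  have : P.-1%:R * m <= En S (i + 1) P.-1 u by rewrite -(Ds_cst (i + 1)) /En; apply: Ds_le.
  have PR : P%:R = P.-1%:R + 1 :> R by rewrite natr1 prednK.
  by move: Hi; rewrite PR; clear; lra.
pose n := Num.floor (u 0); pose v i := u i - n%:~R.
have vp : per P Q v by move=> i; rewrite /v up addrAC.
have vu : En S 0 P v = En S 0 P u.
  by have := En_sh HS 0 P 0 n u; rewrite addr0 /sh => <-; congr En; apply/funext => i; rewrite addr0.
rewrite -vu -(clE v vp).
pose v' i := if 0 <= i < P then v i else 0.
have -> : closing 0 P Q v = closing 0 P Q v'.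
  apply/funext => i; rewrite /closing /v' !subr0 !add0r ifT//.
  by rewrite modz_ge0 ?ltz_pmod//; lia.
apply: Hc; rewrite inE /= => i; rewrite /v' -ler_norml; case: ifP => [iP|_]; last by rewrite normr0.
have n1 := floor_le_tmp (u 0); have n2 := floorD1_gt (u 0); rewrite -/n intrD in n1 n2.
have H (a : nat) : `|u a - u 0| <= a%:R * `|A|.
  elim: a => [|a IH]; first by rewrite subrr normr0 mul0r.
  have -> : a.+1%:Z = a%:Z + 1 by lia.
  have -> : u (a%:Z + 1) - u 0 = (u (a%:Z + 1) - u a) + (u a - u 0) by clear; lra.
  apply: (le_trans (ler_normD _ _)); rewrite -natr1 mulrDl mul1r addrC lerD//.
  by apply: (le_trans (inc a)); exact: ler_norm.
have ia : i = (absz i)%:Z by lia.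
have aP : (absz i)%:R <= P%:R :> R by rewrite ler_nat; lia.
apply: (@le_trans _ _ (`|u i - u 0| + `|v 0|)).
  by rewrite (_ : v i = u i - u 0 + v 0) ?ler_normD// /v; lra.
rewrite /B addrC lerD//; first by rewrite ler_norml /v; apply/andP; split; lra.
by rewrite ia; apply: (le_trans (H _)); apply: ler_wpM2r.
Qed.

End FromConditions.

(** * The perturbed potentials *)

Section SitePartials.
Variable R : realType.
Implicit Types (x y z : int -> R) (f g : (int -> R) -> R) (i j : int).

Lemma section_at_site (h : R -> R) i j x :
  section_at i (fun x => h (x j)) x = if i == j then h else cst (h (x j)).
Proof.
apply/funext => t; rewrite /section_at; case: (eqVneq i j) => [->|ij].
  by rewrite dfwithin.
by rewrite dfwithout.
Qed.

Lemma derivable_site (h h' : R -> R) i j x : (forall t : R, is_derive t (1 : R) h (h' t)) ->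
  derivable (section_at i (fun x => h (x j)) x) (x i) 1.
Proof.
move=> hh; rewrite section_at_site; case: eqP => _; last exact: derivable_cst.
by have [] := hh (x i).
Qed.

Lemma partial_site (h h' : R -> R) i j : (forall t : R, is_derive t (1 : R) h (h' t)) ->
  partial i (fun x => h (x j)) = if i == j then (fun x => h' (x j)) else (fun=> 0).
Proof.
move=> hh; apply/funext => x; rewrite /partial section_at_site.
case: (eqVneq i j) => [->|ij]; last by rewrite derive1_cst.
by rewrite derive1E; have [_ ->] := hh (x j).
Qed.

Lemma partial_cst (c : R) i : partial i (fun=> c) = (fun=> 0 : R).
Proof. by apply/funext => x; rewrite /partial /section_at derive1_cst. Qed.

Lemma partialD f g i : (forall x, derivable (section_at i f x) (x i) 1) ->
  (forall x, derivable (section_at i g x) (x i) 1) ->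
  partial i (fun x => f x + g x) = (fun x => partial i f x + partial i g x).
Proof.
move=> df dg; apply/funext => x; rewrite /partial !derive1E.
exact: (deriveD (df x) (dg x)).
Qed.

Lemma Ck_cst k (c : R) : Ck k (fun _ : int -> R => c).
Proof.
elim: k c => [|k IH] c; split=> //; try exact: cst_continuous.
move=> i; split; last by rewrite partial_cst.
by move=> x; exact: derivable_cst.
Qed.

Lemma Ck_add k f g : Ck k f -> Ck k g -> Ck k (fun x => f x + g x).
Proof.
elim: k f g => [|k IH] f g [cf df] [cg dg]; split=> //.
- by move=> x; exact: (cvgD (cf x) (cg x)).
- by move=> x; exact: (cvgD (cf x) (cg x)).
move=> i; have [dfi ci] := df i; have [dgi cgi] := dg i; split.
  by move=> x; exact: (derivableD (dfi x) (dgi x)).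
by rewrite partialD//; exact: IH.
Qed.

Section Deriv.
Variables (k : nat) (d : nat -> R -> R).
Hypothesis dd : forall n (t : R), (n <= k)%N -> is_derive t (1 : R) (d n) (d n.+1 t).

Lemma Ck_site m n j : (m + n <= k)%N -> Ck m (fun x => d n (x j)).
Proof.
elim: m n => [|m IH] n mn; have nk : (n <= k)%N by lia.
all: have cn : continuous ((fun x => d n (x j)) : {ptws int -> R} -> R).
1,3: move=> x; apply: (@continuous_comp {ptws int -> R} R R (fun x => x j) (d n)); first exact: ptws_eval.
1,2: by apply: differentiable_continuous; apply/derivable1_diffP; have [] := dd (x j) nk.
- by [].
split => // i; split; first by move=> x; exact: derivable_site (fun t => dd t nk).
rewrite (partial_site _ _ (fun t => dd t nk)); case: eqP => _; last exact: Ck_cst.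
by apply: IH; lia.
Qed.

Lemma partials_site s j : (size s <= k.+1)%N ->
  partials s (fun x => d 0%N (x j)) =
  if all (pred1 j) s then (fun x => d (size s) (x j)) else (fun=> 0).
Proof.
elim: s => //= i s IH sk; rewrite IH; last by lia.
case: (all _ s); last by rewrite andbF partial_cst.
by rewrite andbT (partial_site _ _ (fun t => dd t sk)).
Qed.

End Deriv.

Lemma smooth_bound_Ck k e (V : R -> R) j : smooth_bound k e V -> Ck k (fun x => V (x j)).
Proof. by move=> [d [<- dd _]]; apply: (@Ck_site _ _ dd _ 0%N); rewrite addn0. Qed.

Lemma smooth_bound_norm k e (V : R -> R) j : 0 <= e -> smooth_bound k e V ->
  (Ck_norm k (fun x => V (x j)) <= e%:E)%E.
Proof.
move=> e0 [d [<- dd db]]; apply: ge_ereal_sup => _ [s sk [x _ <-]].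
rewrite lee_fin (partials_site dd); last by rewrite leqW.
by case: ifP => _; [exact: db|rewrite normr0].
Qed.

Lemma smooth_boundD k e e' (V V' : R -> R) : smooth_bound k e V -> smooth_bound k e' V' ->
  smooth_bound k (e + e') (fun t => V t + V' t).
Proof.
move=> [d [<- d1 d2]] [d' [<- d1' d2']]; exists (fun n t => d n t + d' n t); split => //.
  by move=> n t nk; apply: is_deriveD; [exact: d1|exact: d1'].
by move=> n t nk; apply: (le_trans (ler_normD _ _)); rewrite lerD ?d2 ?d2'.
Qed.

Lemma partials2D f g i l : Ck 2 f -> Ck 2 g ->
  partials [:: i; l] (fun x => f x + g x) =
  (fun x => partials [:: i; l] f x + partials [:: i; l] g x).
Proof.
move=> [_ /(_ l)[df [_ cf]]] [_ /(_ l)[dg [_ cg]]] /=.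
rewrite (@partialD f g l df dg).
exact: (@partialD (partial l f) (partial l g) i (cf i).1 (cg i).1).
Qed.

(** A site potential has no mixed derivatives, so the twist is unchanged; being nonnegative, it
    preserves coercivity. *)
Lemma conditions_addV k e (V : R -> R) S : (2 <= k)%N -> 0 <= e -> smooth_bound k e V ->
  (forall t, 0 <= V t) -> (forall t (l : int), V (t + l%:~R) = V t) ->
  conditions_AE S -> conditions_AE (addV V S).
Proof.
move=> k2 e0 sV V0 Vp [[[r A1] c2] B C [D1 D2] [M M0 E]].
have [d [Vd dd db]] := sV.
have c2V j : Ck 2 (fun x => V (x j)) by rewrite -Vd; apply: (@Ck_site _ _ dd _ 0%N); rewrite addn0.
have pV (s : seq int) j : (size s <= 2)%N -> partials s (fun x => V (x j)) =
  if all (pred1 j) s then (fun x => d (size s) (x j)) else (fun=> 0).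
  by move=> s2; rewrite -Vd (partials_site dd)//; lia.
have pVb (s : seq int) j x : (size s <= 2)%N -> `|partials s (fun x => V (x j)) x| <= e.
  by move=> s2; rewrite pV//; case: ifP => _; [apply: db; lia|rewrite normr0].
split.
- split; last by move=> j; exact: Ck_add.
  exists (absz r)%:Z => j x y xy; rewrite /addV (A1 j x y); last by move=> i ij; apply: xy; lia.
  by rewrite xy//; lia.
- move=> j l m x; rewrite /addV -B; congr (_ + _).
  by rewrite /shift_seq addrK Vp.
- move=> j l jl m; have [A HA] := C j l jl m; exists A => x /HA h.
  by rewrite /addV; have := V0 (x j); lra.
- split.
    move=> j i l x il; rewrite /addV partials2D// pV//= ifF ?addr0; first exact: D1.
    by apply/negbTE/negP => /and3P[/eqP ii /eqP ll _]; rewrite ii ll eqxx in il.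
  move=> j l x jl; rewrite /addV partials2D// pV//= ifF ?addr0; first exact: D2.
  by apply/negbTE/negP => /and3P[_ /eqP ll _]; rewrite ll subrr in jl.
- exists (M + e); first by lra.
  move=> i j l x; have [E1 E2] := E i j l x; split.
    have [_ /(_ i)[df _]] := c2 j; have [_ /(_ i)[dg _]] := c2V j.
    rewrite /addV (@partialD (S j) (fun x => V (x j)) i df dg).
    apply: (le_trans (ler_normD _ _)); rewrite lerD//.
    exact: (pVb [:: i]).
  rewrite /addV partials2D//; apply: (le_trans (ler_normD _ _)); rewrite lerD//.
  exact: pVb.
Qed.

End SitePartials.

(** * Rotation numbers *)

Section Minimizer.
Variable R : realType.
Implicit Types (x y z u v : int -> R) (i j k l : int).

Lemma locally_minimal_of_global r S y :
  (forall j u v, (forall i, `|i - j| <= r%:Z -> u i = v i) -> S j u = S j v) ->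
  global_minimizer S y -> locally_minimal r S y.
Proof.
move=> loc gm A N v vl vr; pose z i := v i - y i.
have vE : v = y + z by apply/funext => i; rewrite /z fctE addrC subrK.
pose s : seq int := [seq A + n%:Z | n <- iota 0 N].
have sE i : (i \in s) = (A <= i < A + N%:Z).
  apply/mapP/idP => [[n]|iA]; first by rewrite mem_iota => nN ->; lia.
  by exists (absz (i - A)); [rewrite mem_iota; lia|lia].
have us : uniq s by rewrite map_inj_uniq ?iota_uniq// => a b; lia.
have fz : finite_set [set i | z i != 0].
  apply: (@sub_finite_set _ _ [set` s]); last exact: finite_seq.
  move=> i /= zi; rewrite sE; apply: contraNT zi => iA; rewrite /z.
  have [iA'|iA'] := ltP i (A + r%:Z); first by rewrite vl ?subrr.
  by rewrite vr ?subrr//; ilia.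
have := gm z fz; rewrite (fsbigE s)//; last first.
  move=> j _; rewrite sE => jA; apply/eqP; rewrite subr_eq0; apply/eqP.
  apply: loc => i ij; rewrite -vE.
  have [iA'|iA'] := ltP i (A + r%:Z); first exact: vl.
  by apply: vr; ilia.
rewrite /s big_map -vE /En /Ds => H; rewrite -subr_ge0 -sumrB; apply: (le_trans H).
rewrite -(big_mkord xpredT (fun n => S (A + n%:Z) v - S (A + n%:Z) y)).
by rewrite /index_iota subn0 (eq_bigl xpredT)// => j; rewrite in_setT.
Qed.

Lemma rotation_eventually x Om : rotation_number x Om -> forall e, 0 < e ->
  exists N : nat, forall n : nat, (N <= n)%N ->
    `|x n - n%:R * Om| <= e * n%:R /\ `|x (- n%:Z) + n%:R * Om| <= e * n%:R.
Proof.
move=> [h1 h2] e e0.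
have /cvgrPdist_le/(_ e e0)[N1 _ H1] := h1; have /cvgrPdist_le/(_ e e0)[N2 _ H2] := h2.
exists (maxn 1 (maxn N1 N2)) => n; rewrite !geq_max => /and3P[n0 n1 n2].
have n0' : 0 < n%:R :> R by rewrite ltr0n.
have {H1} := H1 n n1; have {H2} := H2 n n2; rewrite /= => a b.
have E t : `|Om - t / n%:R| <= e -> `|t - n%:R * Om| <= e * n%:R.
  move=> h; have -> : t - n%:R * Om = - ((Om - t / n%:R) * n%:R) by field; rewrite gt_eqF.
  by rewrite normrN normrM [`|n%:R|]gtr0_norm// ler_wpM2r// ltW.
split; first exact: E.
have -> : x (- n%:Z) + n%:R * Om = - (- x (- n%:Z) - n%:R * Om) by lra.
have EE : - x (- n%:Z) / n%:R = x (- n%:Z) / - n%:R by rewrite invrN mulrN mulNr.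
by rewrite normrN; apply: E; rewrite EE.
Qed.

(** Iteration gives [x 0 + n * l <= x (n * k)], and the right side grows like [n * k * Om]. *)
Lemma rotation_rate x Om k l : rotation_number x Om ->
  (forall i, x i <= sh k l x i) -> l%:~R <= k%:~R * Om.
Proof.
move=> rx H; rewrite leNgt; apply/negP => kl.
have it (n : nat) i : x i + n%:R * l%:~R <= x (i + n%:Z * k).
  elim: n i => [|n IH] i; first by rewrite !mul0r !addr0.
  have := IH (i + k); have := H i; rewrite /sh -natr1.
  by rewrite (_ : i + k + n%:Z * k = i + n.+1%:Z * k); [lra|ilia].
pose D := l%:~R - k%:~R * Om; have D0 : 0 < D by rewrite subr_gt0.
pose kn : R := (absz k)%:R; have kn0 : 0 <= kn by exact: ler0n.
have k1 : 0 < 2 * (kn + 1) by lra.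
pose e := D / (2 * (kn + 1)); have e0 : 0 < e by exact: divr_gt0.
have [N HN] := rotation_eventually rx e0.
have ub (n : nat) : (N <= n)%N -> x (n%:Z * k) <= n%:R * (k%:~R * Om) + n%:R * D / 2 + `|x 0|.
  move=> nN; have n0 : 0 <= n%:R :> R by exact: ler0n.
  have eb : e * (n%:R * kn) <= n%:R * D / 2.
    have -> : n%:R * D / 2 = e * (n%:R * (kn + 1)) by rewrite /e; field; rewrite gt_eqF//; lra.
    by apply: ler_wpM2l; [exact: ltW|apply: ler_wpM2l => //; lra].
  have x0 := normr_ge0 (x 0).
  have [k0|k0] := eqVneq k 0.
    by rewrite k0 mulr0; have := ler_norm (x 0); have := mulr_ge0 n0 (ltW D0); lra.
  have := HN (n * absz k)%N; rewrite natrM -/kn => /(_ _)[]; first by nia.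
  have [k2|k2] := leP 0 k.
    have -> : (n * absz k)%N%:Z = n%:Z * k by nia.
    have knE : kn = k%:~R by rewrite /kn -[k in RHS]gez0_abs.
    rewrite ler_norml => -[/andP[_ a] _]; move: a eb x0; rewrite knE.
    by clearbody e; clear; lra.
  have -> : - (n * absz k)%N%:Z = n%:Z * k by nia.
  have knE : kn = - k%:~R by rewrite /kn -intrN -ltz0_abs.
  move=> _; rewrite ler_norml => /andP[_ a]; move: a eb x0; rewrite knE.
  by clearbody e; clear; lra.
have H2 n : (N <= n)%N -> n%:R * D / 2 <= 2 * `|x 0|.
  move=> nN; have := ub n nN; have := it n 0; rewrite add0r.
  have := ler_norm (- x 0); rewrite normrN /D; lra.
pose n := maxn N (Num.trunc (4 * `|x 0| / D)).+1.
have := H2 n (leq_maxl _ _).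
have nb : 4 * `|x 0| / D < n%:R.
  apply: (@lt_le_trans _ _ (Num.trunc (4 * `|x 0| / D)).+1%:R); first exact: truncnS_gt.
  by rewrite ler_nat leq_maxr.
by move: nb; rewrite ltr_pdivrMr//; lra.
Qed.

Lemma rotation_rate_le x Om k l : rotation_number x Om ->
  (forall i, sh k l x i <= x i) -> k%:~R * Om <= l%:~R.
Proof.
move=> rx H; have := @rotation_rate x Om (- k) (- l) rx.
rewrite !intrN mulNr lerN2; apply => i.
by have := H (i - k); rewrite /sh subrK intrN; lra.
Qed.

Lemma ordered_sh x k l : totally_ordered (translates x) ->
  (forall i, x i <= sh k l x i) \/ (forall i, sh k l x i <= x i).
Proof.
have E a b : translates x (sh a b x).
  exists (- a) => //; exists (- b) => //.
  by apply/funext => i; rewrite /shift_seq /sh opprK intrN.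
have x0 : sh 0 0 x = x by apply/funext => i; rewrite /sh addr0 subr0.
move=> /(_ _ _ (E 0 0) (E k l)); rewrite x0 => -[/lefP h|/lefP h]; [left|right] => i; exact: h.
Qed.

End Minimizer.

(** * Assembly *)

Section Destroy.
Variable R : realType.
Implicit Types (x y z u v : int -> R) (S : int -> (int -> R) -> R).

(** [s] is the sign of [p * Om - q]. As a parameter, [cb] is fixed before [p] and [q], which are
    then chosen in terms of it. *)
Definition destroys S (r k : nat) (e B cb s : R) : Prop :=
  forall (p : nat) (q : int), (5 * r < p)%N -> `|q%:~R / p%:R| <= B ->
  exists V em ep,
  [/\ forall t, 0 <= V t, forall t (l : int), V (t + l%:~R) = V t,
      smooth_bound k (e + e) V, em < ep &
      forall (Om : R) y, 0 < s * (p%:R * Om - q%:~R) ->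
        s * (p%:R * Om - q%:~R) * p%:R ^+ (2 * (k * k.+1)) <= cb -> `|Om| <= B ->
        locally_minimal r (addV V S) y ->
        (forall i, 0 <= s * (sh p q y i - y i)) ->
        (forall i l, `|y (i + l) - y i - l%:~R * Om| <= 1) ->
        ~ (em < y 0 < ep)].

Lemma addV_addV (V V' : R -> R) S : addV V' (addV V S) = addV (fun t => V t + V' t) S.
Proof. by apply/funext => j; apply/funext => u; rewrite /addV addrA. Qed.

Lemma flip_addV (V : R -> R) S :
  addV V (flipS 1 S) = flipS 1 (addV (fun t => V (- t)) S).
Proof. by apply/funext => j; apply/funext => u; rewrite /addV /flipS /flip !mul1r opprK. Qed.

Lemma locally_minimal_flip r S y :
  locally_minimal r S y -> locally_minimal r (flipS 1 S) (flip 1 y).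
Proof.
move=> H A N v vl vr; rewrite !En_flip1 flipK//.
have E i : flip 1 v i = - v i by rewrite /flip mul1r.
have E' i : flip 1 y i = - y i by rewrite /flip mul1r.
by apply: H => i iA; rewrite E; [rewrite vl|rewrite vr]; rewrite // E' opprK.
Qed.

Lemma destroys_pos r C al S k e B : pot r C al S -> minEx S -> (0 < r)%N ->
  (2 <= k)%N -> 0 < e -> e <= 1 -> 0 <= B ->
  exists2 cb, 0 < cb & destroys S r k e B cb 1.
Proof.
move=> HS mE r0 k2 e0 e1 B0.
have [w0 [w00 w01 HB]] := smooth_bump_family k2 e0 e1.
have [cb cb0 H] := destroying_bumps HS mE r0 B0 w00 w01 HB.
exists cb => // p q rp qB; have [V1 [V2 [em [ep [[s1 b1] [s2 b2] emp Hy]]]]] := H p q rp qB.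
exists (fun t => V1 t + V2 t), em, ep; split => //.
- by move=> t; apply: addr_ge0; [exact: site_ge0 s1 t|exact: site_ge0 s2 t].
- by move=> t l; rewrite (site_perz _ _ s1) (site_perz _ _ s2).
- exact: smooth_boundD.
move=> Om y; rewrite !mul1r -addV_addV => p1 p2 p3 p4 p5 p6; apply: (Hy Om) => // i.
by have := p5 i; rewrite mul1r subr_ge0.
Qed.

Lemma destroys_neg r C al S k e B : pot r C al S -> minEx S -> (0 < r)%N ->
  (2 <= k)%N -> 0 < e -> e <= 1 -> 0 <= B ->
  exists2 cb, 0 < cb & destroys S r k e B cb (-1).
Proof.
move=> HS mE r0 k2 e0 e1 B0.
have HS' : pot r C al (flipS 1 S) by apply: pot_flip.
have [cb cb0 H] := destroys_pos HS' (minEx_flip1 mE) r0 k2 e0 e1 B0.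
exists cb => // p q rp qB.
have qB' : `|(- q)%:~R / p%:R| <= B by rewrite intrN mulNr normrN.
have [V [em [ep [V0 Vp b emp Hy]]]] := H p (- q) rp qB'.
exists (fun t => V (- t)), (- ep), (- em); split => //.
- by move=> t l; rewrite opprD -intrN Vp.
- exact: smooth_bound_opp.
- by rewrite ltrN2.
move=> Om y p1 p2 p3 p4 p5 p6 /andP[y1 y2].
have fE i : flip 1 y i = - y i by rewrite /flip mul1r.
have E : 1 * (p%:R * - Om - (- q)%:~R) = -1 * (p%:R * Om - q%:~R) by rewrite intrN; ring.
apply: (Hy (- Om) (flip 1 y)); rewrite ?E ?normrN//.
- by rewrite flip_addV; apply: locally_minimal_flip.
- by move=> i; have := p5 i; rewrite /sh !fE intrN; lra.
- move=> i l; rewrite !fE; have := p6 i l; rewrite -normrN.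
  by congr (`|_| <= _); ring.
- by rewrite fE; apply/andP; split; lra.
Qed.

Lemma powR_large (K s : R) : 0 < s -> 0 < K -> exists N : nat, forall n : nat, (N <= n)%N ->
  K <= n%:R `^ s.
Proof.
move=> s0 K0; exists (Num.trunc (K `^ s^-1)).+1 => n nN.
have h : K `^ s^-1 <= n%:R.
  by apply: ltW; apply: (lt_le_trans (truncnS_gt _)); rewrite ler_nat.
have := @ge0_ler_powR R s (ltW s0) (K `^ s^-1) n%:R.
rewrite -powRrM mulVf ?gt_eqF// powRr1; last exact: ltW.
by apply; rewrite // nnegrE ?powR_ge0 ?ler0n.
Qed.

End Destroy.

Theorem theorem1p4 (R : realType) (S : int -> (int -> R) -> R)
    (hS : conditions_AE S) (eps : R) (heps : 0 < eps)
    (k : nat) (hk : (2 <= k)%N)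
    (gamma sigma : R) (hgamma : 0 < gamma)
    (hsigma : 1 + 2 * k%:R * (k%:R + 1) < sigma)
    (omega : R) (homega : Liouville_set gamma sigma omega) :
  exists Seps : int -> (int -> R) -> R,
    [/\ conditions_AE Seps,
        forall j : int, Ck k (fun x => Seps j x - S j x),
        forall j : int,
          (Ck_norm k (fun x => (Seps j x - S j x)%R) <= eps%:E)%E &
        exists delta eta_m eta_p : R,
          [/\ 0 < delta, eta_m < eta_p &
              forall (Omega : R) (x : int -> R),
                `|omega - Omega| <= delta ->
                global_minimizer Seps x ->
                rotation_number x Omega ->
                totally_ordered (translates x) ->
                maximally_periodic x Omega ->
                x 0 \notin `]eta_m, eta_p[ ]].
Proof.
have [r [C [al [r0 HS]]]] := pot_of_conditions hS.
have mE : minEx S.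
  apply: (minEx_of_coercive HS); last exact: coercive_of_condC (conditions_B hS) (conditions_C hS).
  by move=> j; have [_ c2] := conditions_A hS; have [] := c2 j.
pose e := Num.min 1 (eps / 2).
have e0 : 0 < e by rewrite lt_min ltr01 divr_gt0.
have e1 : e <= 1 by rewrite ge_min lexx.
have e2 : e + e <= eps.
  have : e <= eps / 2 by rewrite ge_min lexx orbT.
  by lra.
pose B := `|omega| + 2; have B0 : 0 <= B by rewrite addr_ge0.
have [cbp cbp0 Hp] := destroys_pos HS mE r0 hk e0 e1 B0.
have [cbn cbn0 Hn] := destroys_neg HS mE r0 hk e0 e1 B0.
pose cb := Num.min cbp cbn; have cb0 : 0 < cb by rewrite lt_min cbp0 cbn0.
case: homega => irr [pp [qq [pp1 pq pinf]]].
pose m := (2 * (k * k.+1))%N.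
(* The surplus of [sigma] over [m.+1]. The factor [p ^ s] exceeds any constant for large [p], which
   pushes [X], the distance to [q / p] times [p ^ (m + 1)], below [cb / 2]. *)
pose s := sigma - m.+1%:R.
have mE1 : m.+1%:R = 1 + 2 * k%:R * (k%:R + 1) :> R.
  by rewrite -natr1 /m !natrM -[k.+1%:R]natr1; ring.
have s0 : 0 < s by rewrite /s subr_gt0 mE1.
pose K := Num.max (2 * gamma / cb) gamma.
have K0 : 0 < K by rewrite lt_max hgamma orbT.
have [N HN] := powR_large s0 K0.
have [j [rp Np]] : exists j, (5 * r < pp j)%N /\ (N <= pp j)%N.
  have := @nbhs_infty_ge (maxn (5 * r).+1 N); move=> /pinf[j _ /(_ j (leqnn _))] /=.
  by rewrite geq_max => /andP[]; exists j.
move: (pp j) (qq j) (pq j) rp Np => p q pqj rp Np.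
have pn : (0 < p)%N by apply: leq_ltn_trans rp.
have p0 : 0 < p%:R :> R by rewrite ltr0n.
have p1 : 1 <= p%:R :> R by rewrite ler1n.
pose D := `|omega - q%:~R / p%:R|.
have Dp : D * (p%:R `^ s * p%:R ^+ m.+1) < gamma.
  rewrite -powR_mulrn ?ltW// -powRD; last by rewrite (gt_eqF p0) implybT.
  by rewrite /s subrK -ltr_pdivlMr ?powR_gt0.
have Ks := HN p Np.
pose X := D * p%:R ^+ m.+1.
have X0 : 0 <= X by apply: mulr_ge0; [exact: normr_ge0|apply: exprn_ge0; exact: ltW].
have XK : X * K < gamma.
  apply: le_lt_trans Dp; rewrite [p%:R `^ s * _]mulrC mulrA.
  exact: ler_wpM2l.
have XK2 : X * (2 * gamma / cb) < gamma.
  by apply: le_lt_trans XK; rewrite ler_wpM2l// le_max lexx.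
have Xcb : 2 * X <= cb.
  move: XK2; rewrite mulrA ltr_pdivrMr// => h.
  have : (2 * X) * gamma <= cb * gamma by move: h; clear; lra.
  by rewrite ler_pM2r.
have X1 : X <= 1.
  have : X * gamma <= 1 * gamma.
    by rewrite mul1r ltW//; apply: le_lt_trans XK; rewrite ler_wpM2l// le_max lexx orbT.
  by rewrite ler_pM2r.
have DX : D <= X by apply: ler_peMr; [exact: normr_ge0|exact: exprn_ege1].
have D0 : 0 < D.
  rewrite normr_gt0 subr_eq0; apply/negP => /eqP E; apply: irr.
  by exists (q%:~R / p%:R) => //; rewrite fmorph_div rmorph_int rmorph_nat.
have qB : `|q%:~R / p%:R| <= B.
  have -> : q%:~R / p%:R = omega - (omega - q%:~R / p%:R) by rewrite subKr.
  by apply: (le_trans (ler_normB _ _)); rewrite /B lerD2l -/D; lra.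
have [sg [cbs [sg1 sD cbcb /(_ p q rp qB)]]] : exists sg cbs : R,
    [/\ sg = 1 \/ sg = -1, sg * (omega - q%:~R / p%:R) = D, cb <= cbs & destroys S r k e B cbs sg].
  have [h|h] := leP 0 (omega - q%:~R / p%:R).
    by exists 1, cbp; split; [left|rewrite mul1r /D ger0_norm|rewrite ge_min lexx|].
  by exists (-1), cbn; split; [right|rewrite mulN1r /D ltr0_norm|rewrite ge_min lexx orbT|].
move=> [V [em [ep [V0 Vp sV emp HV]]]].
have dE i : (fun x => addV V S i x - S i x) = (fun x => V (x i)).
  by apply/funext => x; rewrite /addV addrAC subrr add0r.
have HVS := conditions_addV hk (addr_ge0 (ltW e0) (ltW e0)) sV V0 Vp hS.
exists (addV V S); split => //.
- by move=> i; rewrite dE; exact: smooth_bound_Ck sV.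
- move=> i; rewrite dE; apply: le_trans (smooth_bound_norm i (addr_ge0 (ltW e0) (ltW e0)) sV) _.
  by rewrite lee_fin.
(* Half the distance from [omega] to [q / p] keeps [Om] on the same side of [q / p] as [omega], and
   at distance at most [2 * D] from it. *)
exists (Num.min 1 (D / 2)), em, ep; split => //; first by rewrite lt_min ltr01 divr_gt0.
move=> Om x; rewrite le_min => /andP[Om1 OmD] gm rx tot _.
have rate : sg * (p%:R * Om - q%:~R) = p%:R * (D + sg * (Om - omega)).
  by rewrite -sD; field; rewrite gt_eqF.
have OmD' : `|sg * (Om - omega)| <= D / 2.
  by rewrite normrM distrC; case: sg1 => ->; rewrite ?normrN normr1 mul1r.
move: OmD'; rewrite ler_norml => /andP[Oa Ob].
have rate0 : 0 < sg * (p%:R * Om - q%:~R) by rewrite rate mulr_gt0//; lra.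
have shx i : 0 <= sg * (sh p q x i - x i).
  have := ordered_sh p q tot; case: sg1 rate0 => ->; rewrite ?mul1r ?mulN1r ?oppr_gt0 ?oppr_ge0.
    by rewrite subr_gt0 subr_ge0 => rt [h|/(rotation_rate_le rx)]; [exact: h|rewrite leNgt rt].
  rewrite subr_lt0 subr_le0 => rt [/(rotation_rate rx)|h]; [by rewrite leNgt rt|exact: h].
rewrite in_itv /=; apply/negP; apply: (HV Om) => //.
- apply: le_trans cbcb; apply: le_trans Xcb; rewrite rate /X exprS.
  have pm : 0 <= p%:R * p%:R ^+ m :> R by rewrite mulr_ge0// ?exprn_ge0// ltW.
  have : (D + sg * (Om - omega)) * (p%:R * p%:R ^+ m) <= (2 * D) * (p%:R * p%:R ^+ m).
    by apply: ler_wpM2r => //; lra.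
  by congr (_ <= _); ring.
- rewrite -[Om](subKr omega); apply: (le_trans (ler_normB _ _)); rewrite /B lerD2l; lra.
- apply: locally_minimal_of_global => // i u v uv.
  by rewrite /addV (pot_loc HS uv) uv// subrr.
- move=> i l; apply: birkhoff_bound.
  + by move=> a b; exact: ordered_sh.
  + by move=> a b; exact: rotation_rate.
  + by move=> a b; exact: rotation_rate_le.
Qed.
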